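(* Let $\sigma\colon(\mathcal M,L)\to(\mathcal B,\tilde L)$ be a pseudo-Finsler submersion such that for every $v\in\mathcal A$ the vertical space at $\pi(v)$ is $g_v$-non-degenerate, and let $\nabla,\tilde\nabla$ be the Levi-Civita–Chern connections of $(\mathcal M,L)$ and $(\mathcal B,\tilde L)$. For each projectable and horizontal vector field $V$ defined in a neighborhood of $p$, and projectable vector fields $X,Y$ that are locally $g_V$-horizontal, with projections $\tilde V,\tilde X,\tilde Y$, $$(\nabla^V_XY)^\bot_V=(\tilde\nabla^{\tilde V}_{\tilde X}\tilde Y)^\ast_V+\tilde Q^V_XY,$$ where $(\cdot)^\ast_V$ denotes the $g_V$-horizontal lift.
   Context: **Metrics.** A pseudo-Finsler metric on $\mathcal M$ (with projection $\pi\colon T\mathcal M\to\mathcal M$) is a smooth $L\colon\mathcal A\to\mathbb R$, $\mathcal A\subset T\mathcal M\setminus\mathbf 0$ open and invariant under positive scalar multiplication, with $L(\lambda v)=\lambda^2L(v)$ for $\lambda>0$ and with non-degenerate fundamental tensor $g_v(e,h)=\frac12\frac{\partial^2}{\partial s\partial t}L(v+se+th)|_{s=t=0}$. Elements of $\mathcal A$ are admissible. Cartan tensor: $C_v(b,e,h)=\frac14\frac{\partial^3}{\partial r\partial s\partial t}L(v+rb+se+th)|_{r=s=t=0}$; $C^\sharp_v$ is defined by $g_v(b,C^\sharp_v(e,h))=C_v(b,e,h)$. **Anisotropic calculus.** An anisotropic tensor $T$ assigns smoothly to $v\in\mathcal A$ a tensor $T_v$ (or $T^v$) on $T_{\pi(v)}\mathcal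 M$; an anisotropic vector field $\mathcal X$ assigns $\mathcal X_v\in T_{\pi(v)}\mathcal M$. $T_V$ (or $T^V$) is the ordinary tensor $(T_V)_q=T_{V_q}$ for an admissible local vector field $V$. An anisotropic connection assigns to vector fields $E,H$ an anisotropic vector field $v\mapsto\nabla^v_EH$, $C^\infty$-linear in $E$, additive and Leibniz in $H$; $(\nabla^V_EH)_q=\nabla^{V_q}_EH$. For anisotropic vector fields $\nabla^v_e\mathcal X=\nabla^v_e(\mathcal X_V)-\frac{d}{dt}\mathcal X_{v+t\nabla^v_eV}|_{t=0}$ for any admissible local extension $V$ of $v$. The Levi-Civita–Chern connection is the unique anisotropic connection with $\nabla^v_EH-\nabla^v_HE=[E,H]_{\pi(v)}$ and $e(g_V(H,B))=g_v(\nabla^v_eH,B)+g_v(H,\nabla^v_eB)+2C_v(H,B,\nabla^v_eV)$ for all $v$, $e$ and local admissible extensions $V$ of $v$. **Submersions.** Let $\sigma\colon\mathcal M\to\mathcal B$ be a surjective map with surjective differential, $\mathcal V_p=\ker d\sigma_p$ (vertical vectors). An admissible $v\in T_p\mathcal M$ is horizontal if $g_v(v,w)=0$ for all $w\in\mathcal V_p$; a vector is $g_v$-horizontal if it is $g_v$-orthogonal to $\mathcal V_p$. A vector field $V$ is horizontal if all its values are horizontal; $X$ is $g_V$-horizontal if $X_q$ is $g_{V_q}$-horizontal for all $q$; $X$ is projectable if $d\sigma\circ X=\tilde X\circ\sigma$ for some vector field $\tilde X$ on $\mathcal B$. $\sigma\colon(\mathcal M,L)\to(\mathcal B,\tilde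 L)$ is a pseudo-Finsler submersion if the restriction of $L$ to the tangent spaces of the fibers is a pseudo-Finsler metric on each fiber, and $L(v)=\tilde L(d\sigma(v))$ for every horizontal $v$ (in particular $d\sigma(v)$ is admissible). **Tensors $\mathbf A$, $\tilde Q$.** For admissible $v\in T_p\mathcal M$, write $e=e^\top_v+e^\bot_v$ with $e^\top_v\in\mathcal V_p$ and $e^\bot_v$ $g_v$-horizontal; $E^\top,E^\bot$ are the anisotropic vector fields $v\mapsto(E_{\pi(v)})^\top_v$, $v\mapsto(E_{\pi(v)})^\bot_v$. Put $\chi^v_he=(\nabla^v_hE^\bot)^\top_v+(\nabla^v_hE^\top)^\bot_v$ for any extension $E$ of $e$ (tensorial), and $\mathbf A^v_be=\chi^v_{b^\bot_v}e$. $\tilde Q^v_we=\tilde Q^v_ew=0$ for $w$ vertical and $e$ arbitrary, and for $g_v$-horizontal $x,y$: $\tilde Q^v_xy=\big(\mathbf A^v_vC^\sharp_v(x,y)+C^\sharp_v(\mathbf A^v_vx,y)+C^\sharp_v(x,\mathbf A^v_vy)\big)^\bot_v$. *)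

(* Defs.v *)
From HB Require Import structures.
From mathcomp Require Import all_boot all_order all_algebra.
From mathcomp Require Import all_classical all_reals all_analysis.

Set Implicit Arguments.
Unset Strict Implicit.
Unset Printing Implicit Defensive.

Import Order.TTheory GRing.Theory Num.Theory.
Import numFieldNormedType.Exports.

Local Open Scope classical_set_scope.
Local Open Scope ring_scope.

(** * Smooth maps between (finite-dimensional) normed spaces *)

(* On an open set [U], [Ck k U f] is the usual C^k: f is Frechet differentiable
   at every point of U and all its directional derivatives are C^(k-1). *)
Fixpoint Ck (R : realType) (V W : normedModType R) (k : nat)
    (U : set V) (f : V -> W) : Prop :=
  match k with
  | 0 => forall x, U x -> {for x, continuous f}
  | k'.+1 => (forall x, U x -> differentiable f x) /\
             (forall v : V, Ck k' U (fun x => 'd f x v))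
  end.

Definition smooth_on (R : realType) (V W : normedModType R)
    (U : set V) (f : V -> W) : Prop :=
  forall k, Ck k U f.

(** * Manifolds *)

(* [cfun] and [cinv] are total; they are only meaningful on [cdom] and on the
   image [ccod]. *)
Record chart (R : realType) (n : nat) (T : topologicalType) := Chart {
  cdom : set T;
  cfun : T -> 'rV[R]_n;
  cinv : 'rV[R]_n -> T;
  cdom_open : open cdom;
  cimg_open : open (cfun @` cdom);
  cfunK : forall p, cdom p -> cinv (cfun p) = p;
  cfun_cont : forall p, cdom p -> {for p, continuous cfun};
  cinv_cont : forall x, (cfun @` cdom) x -> {for x, continuous cinv} }.

Definition ccod (R : realType) (n : nat) (T : topologicalType)
    (c : chart R n T) : set 'rV[R]_n := cfun c @` cdom c.

(* A smooth manifold of dimension n.  [chart_at p] is a preferred chart around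
   p; it is used to realize the tangent space T_pM as 'rV[R]_n (see below).
   The atlas need not be maximal. *)
Record manifold (R : realType) (n : nat) := Manifold {
  carrier :> topologicalType;
  hausdorff : hausdorff_space carrier;
  countable_base : @second_countable carrier;
  atlas : set (chart R n carrier);
  chart_at : carrier -> chart R n carrier;
  chart_at_atlas : forall p, atlas (chart_at p);
  chart_at_dom : forall p, cdom (chart_at p) p;
  compatible : forall c c', atlas c -> atlas c' ->
    smooth_on [set x | ccod c x /\ cdom c' (cinv c x)]
              (cfun c' \o cinv c) }.

(* A tangent vector at p is its coordinate vector in the chart [chart_at p]:
   every T_pM is 'rV[R]_n.  All the notions below go through the coordinate
   changes [tcoord] and [tvec]. *)
Definition vfield (R : realType) (n : nat) (M : manifold R n) : Type :=
  M -> 'rV[R]_n.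

(* v |-> X_v in T_{pi(v)}M, for v = (p, v). *)
Definition aniso (R : realType) (n : nat) (M : manifold R n) : Type :=
  M -> 'rV[R]_n -> 'rV[R]_n.

Section Manifolds.
Variables (R : realType) (n : nat) (M : manifold R n).

(* components in the chart c of a vector v of T_qM, and conversely *)
Definition tcoord (c : chart R n M) (q : M) (v : 'rV[R]_n) : 'rV[R]_n :=
  'd (cfun c \o cinv (chart_at q)) (cfun (chart_at q) q) v.

Definition tvec (c : chart R n M) (q : M) (y : 'rV[R]_n) : 'rV[R]_n :=
  'd (cfun (chart_at q) \o cinv c) (cfun c q) y.

Definition smooth_fun (U : set M) (f : M -> R) : Prop :=
  forall c, atlas c ->
    smooth_on [set x | ccod c x /\ U (cinv c x)] (f \o cinv c : _ -> R^o).

Definition smooth_vfield (U : set M) (X : vfield M) : Prop :=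
  forall c, atlas c ->
    smooth_on [set x | ccod c x /\ U (cinv c x)]
      (fun x => tcoord c (cinv c x) (X (cinv c x))).

(* derivative of f in the direction e of T_pM *)
Definition dfun (f : M -> R) (p : M) (e : 'rV[R]_n) : R :=
  'd (f \o cinv (chart_at p) : _ -> R^o) (cfun (chart_at p) p) e.

(* the Lie bracket, computed in the chart [chart_at p] *)
Definition bracket (E H : vfield M) : vfield M := fun p =>
  let c := chart_at p in
  let co (X : vfield M) x := tcoord c (cinv c x) (X (cinv c x)) in
  'd (co H) (cfun c p) (E p) - 'd (co E) (cfun c p) (H p).

(* a local extension of e in T_pM: constant components in [chart_at p] *)
Definition extend (p : M) (e : 'rV[R]_n) : vfield M :=
  fun q => tvec (chart_at p) q e.

(* the subset of ccod c * R^n representing A in the chart of TM induced by c *)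
Definition tchart (c : chart R n M) (A : M -> set 'rV[R]_n) :
    set ('rV[R]_n * 'rV[R]_n) :=
  [set z | ccod c z.1 /\ A (cinv c z.1) (tvec c (cinv c z.1) z.2)].

Definition smooth_TM (A : M -> set 'rV[R]_n) (F : M -> 'rV[R]_n -> R) : Prop :=
  forall c, atlas c ->
    smooth_on (tchart c A)
      (fun z => F (cinv c z.1) (tvec c (cinv c z.1) z.2) : R^o).

Definition smooth_aniso (A : M -> set 'rV[R]_n) (X : aniso M) : Prop :=
  forall c, atlas c ->
    smooth_on (tchart c A)
      (fun z => tcoord c (cinv c z.1)
                  (X (cinv c z.1) (tvec c (cinv c z.1) z.2))).

End Manifolds.

Section Maps.
Variables (R : realType) (n m : nat) (M : manifold R n) (B : manifold R m).

Definition smooth_map (f : M -> B) : Prop :=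
  continuous f /\
  forall c c', atlas c -> atlas c' ->
    smooth_on [set x | ccod c x /\ cdom c' (f (cinv c x))]
              (cfun c' \o f \o cinv c).

Definition dmap (f : M -> B) (p : M) (v : 'rV[R]_n) : 'rV[R]_m :=
  'd (cfun (chart_at (f p)) \o f \o cinv (chart_at p)) (cfun (chart_at p) p) v.

Definition embedding (f : M -> B) : Prop :=
  [/\ smooth_map f,
      injective f,
      forall p v, dmap f p v = 0 -> v = 0
    & forall U : set M, open U -> exists2 W : set B, open W & U = f @^-1` W].

End Maps.

(** * Pseudo-Finsler metrics *)

(* The domain of the metric is given by the sets A p = A `&` T_pM; the values
   of L outside A are irrelevant, A being open. *)
Section Metric.
Variables (R : realType) (n : nat) (M : manifold R n).
Variables (A : M -> set 'rV[R]_n) (L : M -> 'rV[R]_n -> R).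

Definition fund (p : M) (v e h : 'rV[R]_n) : R :=
  2^-1 * derive1 (fun s : R => derive1 (fun t : R =>
    L p (v + s *: e + t *: h) : R^o) 0 : R^o) 0.

Definition cartan (p : M) (v b e h : 'rV[R]_n) : R :=
  4^-1 * derive1 (fun r : R => derive1 (fun s : R => derive1 (fun t : R =>
    L p (v + r *: b + s *: e + t *: h) : R^o) 0 : R^o) 0 : R^o) 0.

Record pseudo_finsler : Prop := PseudoFinsler {
  pf_nonzero : forall p v, A p v -> v <> 0;
  pf_open : forall c : chart R n M, atlas c -> open (tchart c A);
  pf_cone : forall p v (l : R), 0 < l -> A p v -> A p (l *: v);
  pf_smooth : smooth_TM A L;
  pf_homog : forall p v (l : R), 0 < l -> A p v -> L p (l *: v) = l ^+ 2 * L p v;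
  pf_nondeg : forall p v, A p v ->
    forall e, (forall h, fund p v e h = 0) -> e = 0 }.

(* C^sharp_v(e,h) *)
Definition csharp (p : M) (v e h : 'rV[R]_n) : 'rV[R]_n :=
  xget 0 [set w | forall b, fund p v b w = cartan p v b e h].

End Metric.

(** * Anisotropic connections *)

(* [nabla E H p v] is nabla^v_E H for v in A p. *)
Definition connection (R : realType) (n : nat) (M : manifold R n) : Type :=
  vfield M -> vfield M -> aniso M.

Section Connection.
Variables (R : realType) (n : nat) (M : manifold R n).
Variables (A : M -> set 'rV[R]_n) (L : M -> 'rV[R]_n -> R).
Variable nabla : connection M.

(* Vector fields and functions are local: they are required to be smooth only
   on some open set U containing the base point p, their values outside U being
   arbitrary. *)
Record aniso_connection : Prop := AnisoConnection {
  ac_smooth : forall (U : set M) (E H : vfield M), open U ->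
    smooth_vfield U E -> smooth_vfield U H ->
    smooth_aniso (fun p => [set v | U p /\ A p v]) (nabla E H);
  ac_addl : forall (U : set M) (E E' H : vfield M) p v, open U -> U p -> A p v ->
    smooth_vfield U E -> smooth_vfield U E' -> smooth_vfield U H ->
    nabla (fun q => E q + E' q) H p v = nabla E H p v + nabla E' H p v;
  ac_mull : forall (U : set M) (f : M -> R) (E H : vfield M) p v,
    open U -> U p -> A p v ->
    smooth_fun U f -> smooth_vfield U E -> smooth_vfield U H ->
    nabla (fun q => f q *: E q) H p v = f p *: nabla E H p v;
  ac_addr : forall (U : set M) (E H H' : vfield M) p v, open U -> U p -> A p v ->
    smooth_vfield U E -> smooth_vfield U H -> smooth_vfield U H' ->
    nabla E (fun q => H q + H' q) p v = nabla E H p v + nabla E H' p v;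
  ac_leibniz : forall (U : set M) (f : M -> R) (E H : vfield M) p v,
    open U -> U p -> A p v ->
    smooth_fun U f -> smooth_vfield U E -> smooth_vfield U H ->
    nabla E (fun q => f q *: H q) p v
      = dfun f p (E p) *: H p + f p *: nabla E H p v }.

(* The conditions characterizing the Levi-Civita--Chern connection uniquely. *)
Record levi_civita_chern : Prop := LeviCivitaChern {
  lcc_connection : aniso_connection;
  lcc_torsion : forall (U : set M) (E H : vfield M) p v, open U -> U p -> A p v ->
    smooth_vfield U E -> smooth_vfield U H ->
    nabla E H p v - nabla H E p v = bracket E H p;
  lcc_metric : forall (U : set M) (V E H B : vfield M) p, open U -> U p ->
    smooth_vfield U V -> (forall q, U q -> A q (V q)) ->
    smooth_vfield U E -> smooth_vfield U H -> smooth_vfield U B ->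
    dfun (fun q => fund L q (V q) (H q) (B q)) p (E p)
      = fund L p (V p) (nabla E H p (V p)) (B p)
      + fund L p (V p) (H p) (nabla E B p (V p))
      + 2 * cartan L p (V p) (H p) (B p) (nabla E V p (V p)) }.

(* nabla^v_e H for a vector e and nabla^v_e X for an anisotropic field X.  By
   tensoriality in e and independence of the admissible extension V of v, the
   particular extensions chosen here are immaterial. *)
Definition nabla_at (p : M) (v e : 'rV[R]_n) (H : vfield M) : 'rV[R]_n :=
  nabla (extend p e) H p v.

Definition nabla_aniso (p : M) (v e : 'rV[R]_n) (X : aniso M) : 'rV[R]_n :=
  let V := extend p v in
  nabla_at p v e (fun q => X q (V q))
  - derive1 (fun t : R => X p (v + t *: nabla_at p v e V)) 0.

End Connection.

(** * Submersions *)

Section Submersion.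
Variables (R : realType) (n m : nat) (M : manifold R n) (B : manifold R m).
Variables (A : M -> set 'rV[R]_n) (L : M -> 'rV[R]_n -> R).
Variables (At : B -> set 'rV[R]_m) (Lt : B -> 'rV[R]_m -> R).
Variable sigma : M -> B.

Definition vertical (p : M) (w : 'rV[R]_n) : Prop := dmap sigma p w = 0.

(* x is g_v-horizontal *)
Definition ghorizontal (p : M) (v x : 'rV[R]_n) : Prop :=
  forall w, vertical p w -> fund L p v x w = 0.

Definition horizontal (p : M) (v : 'rV[R]_n) : Prop :=
  A p v /\ ghorizontal p v v.

Definition vertical_nondeg : Prop := forall p v, A p v ->
  forall w, vertical p w -> (forall u, vertical p u -> fund L p v w u = 0) ->
  w = 0.

(* The fibers are the regular level sets of sigma; the manifold structure of
   the fiber over b is given by any embedding i : F -> M with image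
   sigma^-1(b), and the restriction of L to its tangent spaces by pull-back
   along di. *)
Record finsler_submersion : Prop := FinslerSubmersion {
  fs_total : pseudo_finsler A L;
  fs_base : pseudo_finsler At Lt;
  fs_smooth : smooth_map sigma;
  fs_surj : forall b, exists p, sigma p = b;
  fs_dsurj : forall p u, exists v, dmap sigma p v = u;
  fs_fiber : forall (b : B) (k : nat) (F : manifold R k) (i : F -> M),
    embedding i -> range i = sigma @^-1` [set b] ->
    pseudo_finsler (fun q u => A (i q) (dmap i q u))
                   (fun q u => L (i q) (dmap i q u));
  fs_isometry : forall p v, horizontal p v ->
    At (sigma p) (dmap sigma p v) /\ L p v = Lt (sigma p) (dmap sigma p v) }.

(* Xt is a projection of X over the open set U; sigma @` U is open since sigma
   is a submersion *)
Definition projects (U : set M) (X : vfield M) (Xt : vfield B) : Prop :=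
  smooth_vfield (sigma @` U) Xt /\
  forall q, U q -> dmap sigma q (X q) = Xt (sigma q).

(* e^top_v, e^bot_v, and the g_v-horizontal lift of u in T_sigma(p) B: unique
   when the vertical space is g_v-nondegenerate *)
Definition vpart (p : M) (v e : 'rV[R]_n) : 'rV[R]_n :=
  xget 0 [set w | vertical p w /\ ghorizontal p v (e - w)].

Definition hpart (p : M) (v e : 'rV[R]_n) : 'rV[R]_n := e - vpart p v e.

Definition hlift (p : M) (v : 'rV[R]_n) (u : 'rV[R]_m) : 'rV[R]_n :=
  xget 0 [set x | ghorizontal p v x /\ dmap sigma p x = u].

Variable nabla : connection M.

(* chi^v_h e, with the extension [extend p e] of e (tensorial) *)
Definition chi (p : M) (v h e : 'rV[R]_n) : 'rV[R]_n :=
  let E := extend p e in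
  vpart p v (nabla_aniso nabla p v h (fun q w => hpart q w (E q)))
  + hpart p v (nabla_aniso nabla p v h (fun q w => vpart q w (E q))).

Definition Atensor (p : M) (v b e : 'rV[R]_n) : 'rV[R]_n :=
  chi p v (hpart p v b) e.

(* the tensor Q~^v, which vanishes as soon as one argument is vertical *)
Definition Qtilde (p : M) (v e h : 'rV[R]_n) : 'rV[R]_n :=
  let x := hpart p v e in
  let y := hpart p v h in
  hpart p v (Atensor p v v (csharp L p v x y)
             + csharp L p v (Atensor p v v x) y
             + csharp L p v x (Atensor p v v y)).

End Submersion.

(* Main.v *)
(* Put [S x y := dsigma (nabla_X Y) - nablat_Xt Yt], a symmetric tensor at [p].
   By the inverse function theorem the horizontal vectors of a fiber form a
   submanifold near [v], so differentiating [L = Lt o dsigma] along it shows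
   that [dsigma] carries the fundamental and Cartan tensors on horizontal
   arguments to those of the base.  Differentiating
   [g_V (F, -) = gt_Vt (dsigma F, dsigma -)] for horizontal fields [F] and
   inserting both metric identities expresses [gt (S e x) (dsigma y)],
   symmetrized in [x] and [y], by Cartan tensors of [nabla_e V].  As in Koszul's
   formula, the symmetry of [S] then isolates [gt (S x y) (dsigma z)], in which
   only the vertical parts of the derivatives of [V] survive; these are minus
   the values of [A_v].  The skew-symmetry of [A_v] turns the result into
   [g (Q x y) z]. *)
From HB Require Import structures.
Require Import Defs.
From mathcomp Require Import all_boot all_order all_algebra.
From mathcomp Require Import all_classical all_reals all_analysis.
From mathcomp Require Import ring lra.
Import Order.TTheory GRing.Theory Num.Theory.
Import numFieldNormedType.Exports.
Local Open Scope classical_set_scope.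
Local Open Scope ring_scope.

Set Implicit Arguments.
Unset Strict Implicit.
Unset Printing Implicit Defensive.

(* Otherwise conversion unfolds ['d] down to its defining choice operator. *)
#[local] Opaque diff.

(** * Differential calculus *)

(** The Chern connection is metric only up to the Cartan term [2 C(x, y, nabla_e V)], and this term
    is circular here: the projection of [nabla_e V] differs from the derivative of the base field by
    [S e v], the unknown itself. The circle is broken by inserting [v], on which both Cartan tensors
    vanish by homogeneity. This gives [S v v = 0], a zero vertical part of [nabla_v V], and
    [S v x = 0] for horizontal [x]; then the cyclic sum contains no unknown Cartan term.

    The tensor [A_v] is defined by anisotropic derivatives along the coordinate extension of [v],
    not along [V]. Differentiating [g_w(e^bot_w, u^top_w) = 0] both along that extension and inside
    the fiber, and using that [u^top_w] projects to zero, ties [A_v] to [S v], hence to the vertical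
    parts of [nabla V].

    Tangent vectors are coordinates in a chart that changes with the point, so every field is moved
    to one fixed chart before it is differentiated. There a connection is a derivative plus
    Christoffel symbols, and the horizontal projection is rational in the Gram matrix and the
    Jacobian, hence smooth. *)

Section Differential.
Variable R : realType.
Implicit Types (V W Z : normedModType R).

(* Carrying the differential explicitly avoids rewriting under ['d]. *)
Definition hasD V W (f : V -> W) (x : V) (df : V -> W) :=
  differentiable f x /\ forall v, 'd f x v = df v.

Lemma hasD_ext V W (f : V -> W) x df dg :
  hasD f x df -> (forall v, df v = dg v) -> hasD f x dg.
Proof. by move=> [f1 f2] e; split=> // v; rewrite f2. Qed.

Lemma hasD_unique V W (f : V -> W) x df dg :
  hasD f x df -> hasD f x dg -> forall v, df v = dg v.
Proof. by move=> [_ f1] [_ f2] v; rewrite -f1. Qed.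

Lemma hasD_cst V W (c : W) (x : V) : hasD (fun=> c) x (fun=> 0).
Proof.
split; first exact: differentiable_cst.
by move=> v; rewrite (congr1 (@^~ v) (diff_cst c x)).
Qed.

Lemma hasD_lin V W (f : {linear V -> W}) x : continuous f -> hasD f x f.
Proof.
move=> fc; split; first exact: linear_differentiable.
by move=> v; rewrite (congr1 (@^~ v) (diff_lin x fc)).
Qed.

Lemma hasD_id V (x : V) : hasD id x id.
Proof. by apply: (@hasD_lin _ _ idfun) => y A. Qed.

Lemma hasDD V W (f g : V -> W) x df dg : hasD f x df -> hasD g x dg ->
  hasD (fun y => f y + g y) x (fun v => df v + dg v).
Proof.
move=> [f1 f2] [g1 g2]; split; first exact: differentiableD f1 g1.
by move=> v; rewrite (congr1 (@^~ v) (diffD f1 g1)) /= f2 g2.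
Qed.

Lemma hasDN V W (f : V -> W) x df : hasD f x df ->
  hasD (fun y => - f y) x (fun v => - df v).
Proof.
move=> [f1 f2]; split; first exact: differentiableN f1.
by move=> v; rewrite (congr1 (@^~ v) (diffN f1)) /= -f2.
Qed.

Lemma hasDB V W (f g : V -> W) x df dg : hasD f x df -> hasD g x dg ->
  hasD (fun y => f y - g y) x (fun v => df v - dg v).
Proof. by move=> hf hg; apply: hasDD => //; apply: hasDN. Qed.

Lemma hasD_comp V W Z (f : V -> W) (g : W -> Z) x df dg :
  hasD f x df -> hasD g (f x) dg -> hasD (g \o f) x (dg \o df).
Proof.
move=> [f1 f2] [g1 g2]; split; first exact: differentiable_comp.
by move=> v; rewrite (congr1 (@^~ v) (diff_comp f1 g1)) /= f2 g2.
Qed.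

Lemma hasD_pair V W Z (f : V -> W) (g : V -> Z) x df dg :
  hasD f x df -> hasD g x dg ->
  hasD (fun y => (f y, g y)) x (fun v => (df v, dg v)).
Proof.
move=> [f1 f2] [g1 g2]; split; first exact: differentiable_pair.
by move=> v; rewrite (congr1 (@^~ v) (diff_pair f1 g1)) /= f2 g2.
Qed.

Lemma scale_bilinear W :
  bilinear_for (GRing.Scale.Law.clone _ _ *:%R _)
    (GRing.Scale.Law.clone _ _ *:%R _) (fun (k : R^o) (w : W) => k *: w).
Proof.
split=> [u'|u] a x y /=.
- by rewrite scalerDl scalerA.
- by rewrite scalerDr !scalerA mulrC.
Qed.

Lemma hasD_scale V W (k dk : V -> R^o) (f df : V -> W) x :
  hasD k x dk -> hasD f x df ->
  hasD (fun y => k y *: f y) x (fun v => k x *: df v + dk v *: f x).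
Proof.
move=> hk hf.
pose bM := bilinear_isBilinear.Build R R^o W W _ _
  (fun (k : R^o) (w : W) => k *: w) (@scale_bilinear W).
pose b : {bilinear R^o -> W -> W} := HB.pack (fun (k : R^o) (w : W) => k *: w) bM.
have sc : continuous (fun p : R^o * W => b p.1 p.2).
  exact: (@scale_continuous R W).
have db : hasD (fun p : R^o * W => b p.1 p.2) (k x, f x)
    (fun q => b (k x) q.2 + b q.1 (f x)).
  split; first exact: differentiable_bilin.
  by move=> v; rewrite (congr1 (@^~ v) (diff_bilin (k x, f x) sc)).
exact: (hasD_comp (hasD_pair hk hf) db).
Qed.

Lemma hasDZ V W (k : R) (f df : V -> W) x :
  hasD f x df -> hasD (fun y => k *: f y) x (fun v => k *: df v).
Proof.
move=> hf; apply: (hasD_ext (hasD_scale (hasD_cst (k : R^o) x) hf)) => v.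
by rewrite scale0r addr0.
Qed.

Lemma hasD_sum V W (I : Type) (r : seq I) (f df : I -> V -> W) x :
  (forall i, hasD (f i) x (df i)) ->
  hasD (fun y => \sum_(i <- r) f i y) x (fun v => \sum_(i <- r) df i v).
Proof.
move=> h; elim: r => [|i r IH].
  have := @hasD_cst V W 0 x; congr (hasD _ _ _);
  by apply/funext => y; rewrite big_nil.
have := hasDD (h i) IH; congr (hasD _ _ _);
by apply/funext => y; rewrite big_cons.
Qed.

Lemma hasD_inv (x : R^o) : x != 0 ->
  hasD (fun y : R^o => y^-1 : R^o) x (fun v => - x ^- 2 * v).
Proof.
move=> x0; split; first exact: differentiable_Rinv.
by move=> v; rewrite (congr1 (@^~ v) (diff_Rinv x0)).
Qed.

(** Locality of the differential rests on this case: two functions equal near [x] differ by one that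
    vanishes there, for which the zero map is a first-order expansion. *)
Lemma hasD0_near V W (k : V -> W) x :
  (\forall y \near x, k y = 0) -> hasD k x (fun=> 0).
Proof.
move=> k0.
have kx : k x = 0 by exact: nbhs_singleton k0.
pose z : {linear V -> W} := \0%R.
have zc : continuous z by move=> y; apply: cst_continuous.
have e : k \o shift x = cst (k x) + z +o_ 0 id.
  apply/eqaddoP => _/posnumP[e].
  rewrite [\forall x \near _, _ <= _](near_shift x) sub0r.
  near=> y.
  have ky : k y = 0 by near: y.
  rewrite /= -[X in `|X|]/(k (y - x + x) - (k x + 0)) subrK ky kx.
  by rewrite addr0 subrr normr0 mulr_ge0.
have dz := diff_unique zc e.
split; last by move=> v; rewrite (congr1 (@^~ v) dz).
by apply/diff_locallyP; rewrite dz.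
Unshelve. all: by end_near. Qed.

Lemma near_eq_hasD V W (f g : V -> W) x df :
  (\forall y \near x, f y = g y) -> hasD f x df -> hasD g x df.
Proof.
move=> fg hf.
have h : hasD (fun y => g y - f y) x (fun=> 0).
  apply: hasD0_near; near=> y.
  by have -> : f y = g y by [near: y]; rewrite subrr.
have := hasDD hf h; congr (hasD _ _ _).
  by apply/funext => y; rewrite addrC subrK.
by apply/funext => v; rewrite addr0.
Unshelve. all: by end_near. Qed.

Lemma hasD_continuous V W (f : V -> W) x df :
  hasD f x df -> {for x, continuous f}.
Proof. by case=> + _; exact: differentiable_continuous. Qed.

Lemma hasD_derive V W (f : V -> W) x df v : hasD f x df -> 'D_v f x = df v.
Proof. by case=> f1 <-; exact: deriveE. Qed.

End Differential.

(** * Closure properties of C^k maps *)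

Section Smooth.
Variable R : realType.
Implicit Types (V W Z : normedModType R).

Lemma open_near (T : topologicalType) (U : set T) (P : T -> Prop) x :
  open U -> U x -> (forall y, U y -> P y) -> \forall y \near x, P y.
Proof. by move=> oU Ux UP; apply: filterS (open_nbhs_nbhs (conj oU Ux)). Qed.

Lemma Ck_hasD V W k U (f : V -> W) x : Ck k.+1 U f -> U x -> hasD f x ('d f x).
Proof. by move=> [h _] Ux; split; first exact: h. Qed.

Lemma Ck_pred V W k U (f : V -> W) : Ck k.+1 U f -> Ck k U f.
Proof.
elim: k f => [|k IH] f [h1 h2].
  by move=> x Ux; apply: differentiable_continuous; exact: h1.
by split=> // v; apply: IH.
Qed.

Lemma Ck_subset V W k (U U' : set V) (f : V -> W) :
  U' `<=` U -> Ck k U f -> Ck k U' f.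
Proof.
move=> sU; elim: k f => [|k IH] f; first by move=> h x /sU; exact: h.
move=> [h1 h2]; split=> [x U'x|v]; last by apply: IH; exact: h2.
by apply: h1; exact: sU.
Qed.

Lemma Ck_eq V W k (U : set V) (f g : V -> W) : open U ->
  (forall x, U x -> f x = g x) -> Ck k U f -> Ck k U g.
Proof.
move=> oU; elim: k f g => [|k IH] f g fg.
  move=> h x Ux; have fx := h x Ux.
  have near_fg : \forall y \near x, f y = g y.
    exact: open_near fg.
  have gfx : g @ x --> f x by apply: cvg_trans fx; apply: near_eq_cvg.
  by have := gfx; rewrite fg.
have near_fg x : U x -> \forall y \near x, f y = g y.
  by move=> Ux; apply: filterS (open_nbhs_nbhs (conj oU Ux)) => y; exact: fg.
move=> [h1 h2].
have hg x : U x -> hasD g x ('d f x).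
  by move=> Ux; apply: near_eq_hasD (near_fg _ Ux) _; split; first exact: h1.
split=> [x /hg[]//|v]; apply: IH (h2 v) => x /hg[_ e].
by rewrite e.
Qed.

(** The differential may be given by a formula [df], so each closure property below is an induction
    on [k] fed by one derivative rule. *)
Lemma Ck_step V W k (U : set V) (f : V -> W) (df : V -> V -> W) : open U ->
  (forall x, U x -> hasD f x (df x)) ->
  (forall v, Ck k U (fun x => df x v)) -> Ck k.+1 U f.
Proof.
move=> oU h1 h2; split=> [x /h1[]//|v].
by apply: Ck_eq (h2 v) => // x /h1[_ e]; rewrite e.
Qed.

Lemma Ck_cst V W k (U : set V) (c : W) : open U -> Ck k U (fun=> c).
Proof.
move=> oU; elim: k c => [|k IH] c; first by move=> x _; apply: cst_continuous.
by apply: (Ck_step (df := fun _ _ => 0)) => // x _; exact: hasD_cst.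
Qed.

Lemma Ck_lin V W k (U : set V) (f : {linear V -> W}) : open U ->
  continuous f -> Ck k U f.
Proof.
move=> oU cf; case: k => [|k]; first by move=> x _; exact: cf.
apply: (Ck_step (df := fun _ => f)) => // [x _|v]; first exact: hasD_lin.
exact: Ck_cst.
Qed.

Lemma Ck_add V W k (U : set V) (f g : V -> W) : open U ->
  Ck k U f -> Ck k U g -> Ck k U (fun x => f x + g x).
Proof.
move=> oU; elim: k f g => [|k IH] f g hf hg.
  by move=> x Ux; apply: continuousD; [exact: hf|exact: hg].
apply: (Ck_step (df := fun x v => 'd f x v + 'd g x v)) => // [x Ux|v].
  by apply: hasDD; [exact: Ck_hasD hf Ux|exact: Ck_hasD hg Ux].
by apply: IH; [exact: hf.2|exact: hg.2].
Qed.

Lemma Ck_scale V W k (U : set V) (f : V -> R^o) (g : V -> W) : open U ->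
  Ck k U f -> Ck k U g -> Ck k U (fun x => f x *: g x).
Proof.
move=> oU; elim: k f g => [|k IH] f g hf hg.
  by move=> x Ux; apply: continuousZ; [exact: hf|exact: hg].
apply: (Ck_step (df := fun x v => f x *: 'd g x v + 'd f x v *: g x)) => //.
  by move=> x Ux; apply: hasD_scale; [exact: Ck_hasD hf Ux|exact: Ck_hasD hg Ux].
move=> v; apply: Ck_add => //; apply: IH.
- exact: Ck_pred.
- exact: hg.2.
- exact: hf.2.
- exact: Ck_pred.
Qed.

Lemma Ck_pair V W Z k (U : set V) (f : V -> W) (g : V -> Z) : open U ->
  Ck k U f -> Ck k U g -> Ck k U (fun x => (f x, g x)).
Proof.
move=> oU; elim: k f g => [|k IH] f g hf hg.
  by move=> x Ux; apply: cvg_pair; [exact: hf|exact: hg].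
apply: (Ck_step (df := fun x v => ('d f x v, 'd g x v))) => // [x Ux|v].
  by apply: hasD_pair; [exact: Ck_hasD hf Ux|exact: Ck_hasD hg Ux].
by apply: IH; [exact: hf.2|exact: hg.2].
Qed.

Lemma Ck_sum V W k (U : set V) (I : Type) (r : seq I) (f : I -> V -> W) :
  open U -> (forall i, Ck k U (f i)) -> Ck k U (fun x => \sum_(i <- r) f i x).
Proof.
move=> oU h; elim: r => [|i r IH].
  by apply: Ck_eq (Ck_cst k 0 oU) => // x _; rewrite big_nil.
by apply: Ck_eq (Ck_add oU (h i) IH) => // x _; rewrite big_cons.
Qed.

Lemma Ck_inv V k (U : set V) (f : V -> R^o) : open U ->
  (forall x, U x -> f x != 0) ->
  Ck k U f -> Ck k U (fun x => (f x)^-1 : R^o).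
Proof.
move=> oU f0; elim: k f f0 => [|k IH] f f0 hf.
  by move=> x Ux; apply: continuousV; [exact: f0|exact: hf].
apply: (Ck_step (df := fun x v =>
   (f x)^-1 *: ((f x)^-1 *: ((-1 : R^o) *: 'd f x v)) : R^o)) => // [x Ux|v].
  apply: (hasD_ext (hasD_comp (Ck_hasD hf Ux) (hasD_inv (f0 x Ux)))) => v /=.
  by rewrite /GRing.scale /= mulN1r !mulrN expr2 invfM mulrA mulNr.
have hi := IH _ f0 (Ck_pred hf).
apply: Ck_scale => //; apply: Ck_scale => //.
by apply: Ck_scale; [|exact: Ck_cst|exact: hf.2].
Qed.

Lemma Ck_lin_comp V W Z k (U : set V) (l : {linear W -> Z}) (h : V -> W) :
  open U -> continuous l -> Ck k U h -> Ck k U (fun x => l (h x)).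
Proof.
move=> oU cl; elim: k h => [|k IH] h hh.
  by move=> x Ux; apply: continuous_comp; [exact: hh|exact: cl].
apply: (Ck_step (df := fun x v => l ('d h x v))) => // [x Ux|w].
  apply: (hasD_comp (Ck_hasD hh Ux)); exact: hasD_lin.
by apply: IH; exact: hh.2.
Qed.

Definition is_basis V (I : finType) (e : I -> V) (l : I -> {linear V -> R^o}) :=
  (forall j, continuous (l j)) /\ forall v, v = \sum_j l j v *: e j.

Definition has_basis V := exists (I : finType) (e : I -> V) l, is_basis e l.

Lemma hasD_basis V W (I : finType) (e : I -> V) l (f : V -> W) x v : is_basis e l ->
  'd f x v = \sum_j l j v *: 'd f x (e j).
Proof.
move=> [_ b]; rewrite {1}(b v) linear_sum; apply: eq_bigr => j _.
by rewrite linearZ.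
Qed.

Lemma Ck_comp V W Z k (U : set V) (U' : set W) (f : V -> W) (g : W -> Z) :
  has_basis W -> open U -> open U' -> (forall x, U x -> U' (f x)) ->
  Ck k U f -> Ck k U' g -> Ck k U (g \o f).
Proof.
move=> [n [e [l b]]] oU oU' fU; elim: k g => [|k IH] g hf hg.
  by move=> x Ux; apply: continuous_comp; [exact: hf|apply: hg; exact: fU].
apply: (Ck_step (df := fun x v =>
   \sum_j l j ('d f x v) *: 'd g (f x) (e j))) => // [x Ux|v].
  apply: (hasD_ext (hasD_comp (Ck_hasD hf Ux) (Ck_hasD hg (fU x Ux)))) => v /=.
  exact: hasD_basis.
apply: Ck_sum => // j; apply: Ck_scale => //; last first.
  by apply: IH (hg.2 _) => //; exact: Ck_pred.
apply: Ck_lin_comp => //; [exact: b.1|exact: hf.2].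
Qed.

Definition coordf n (i : 'I_n) (a : 'rV[R]_n) : R^o := a 0 i.

Lemma coordf_linear n (i : 'I_n) : linear (coordf i).
Proof. by move=> a u v; rewrite /coordf !mxE. Qed.
HB.instance Definition _ n (i : 'I_n) :=
  GRing.isLinear.Build R 'rV[R]_n R^o _ (coordf i) (@coordf_linear n i).

Lemma coordf_continuous n (i : 'I_n) : continuous (coordf i).
Proof. exact: coord_continuous. Qed.

Lemma rV_is_basis n :
  is_basis (fun j : 'I_n => delta_mx 0 j : 'rV[R]_n) (fun j => coordf j).
Proof.
split=> [j|v]; first exact: coordf_continuous.
exact: row_sum_delta.
Qed.

Lemma has_basis_rV n : has_basis 'rV[R]_n.
Proof. by exists 'I_n, (fun j => delta_mx 0 j), (fun j => coordf j); exact: rV_is_basis. Qed.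

Definition injl V W (v : V) : V * W := (v, 0).
Definition injr V W (w : W) : V * W := (0, w).
Definition prl V W (z : V * W) : V := z.1.
Definition prr V W (z : V * W) : W := z.2.

Lemma prl_linear V W : linear (@prl V W). Proof. by []. Qed.
Lemma prr_linear V W : linear (@prr V W). Proof. by []. Qed.
HB.instance Definition _ V W :=
  GRing.isLinear.Build R (V * W)%type V _ (@prl V W) (@prl_linear V W).
HB.instance Definition _ V W :=
  GRing.isLinear.Build R (V * W)%type W _ (@prr V W) (@prr_linear V W).

Lemma injl_linear V W : linear (@injl V W).
Proof.
by move=> a u v; apply: injective_projections; rewrite /= ?scaler0 ?addr0.
Qed.
Lemma injr_linear V W : linear (@injr V W).
Proof.
by move=> a u v; apply: injective_projections; rewrite /= ?scaler0 ?addr0.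
Qed.
HB.instance Definition _ V W :=
  GRing.isLinear.Build R V (V * W)%type _ (@injl V W) (@injl_linear V W).
HB.instance Definition _ V W :=
  GRing.isLinear.Build R W (V * W)%type _ (@injr V W) (@injr_linear V W).

Lemma has_basis_pair V W : has_basis V -> has_basis W -> has_basis (V * W)%type.
Proof.
move=> [k1 [e1 [l1 [c1 b1]]]] [k2 [e2 [l2 [c2 b2]]]].
exists (k1 + k2)%type.
exists (fun j => match j with inl i => (e1 i, 0) | inr i => (0, e2 i) end).
exists (fun j => match j with
  | inl i => (l1 i \o @prl V W : {linear _ -> _})
  | inr i => (l2 i \o @prr V W : {linear _ -> _}) end).
split=> [[i|i]|[v w]].
- by move=> x; apply: continuous_comp; [exact: cvg_fst|exact: c1].
- by move=> x; apply: continuous_comp; [exact: cvg_snd|exact: c2].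
rewrite big_sumType /=.
transitivity (@injl V W v + @injr V W w).
  by apply: injective_projections; rewrite /= ?addr0 ?add0r.
rewrite {1}(b1 v) {1}(b2 w) !linear_sum.
by congr (_ + _); apply: eq_bigr => i _; rewrite linearZ.
Qed.

End Smooth.

(** * Mean value theorem and symmetry of second derivatives *)

Section MeanValue.
Variable R : realType.
Implicit Types (V W Z : normedModType R).

Lemma near_norm V (x : V) (P : V -> Prop) :
  (\forall y \near x, P y) <->
  exists2 d : R, 0 < d & forall y, `|y - x| < d -> P y.
Proof.
split.
  move=> /nbhs_normP[d /= d0 h]; exists d => // y yx; apply: h.
  by rewrite /= distrC.
move=> [d d0 h]; apply/nbhs_normP; exists d => //= y /= yx; apply: h.
by rewrite distrC.
Qed.

Lemma hasD_eps V W (f : V -> W) x df : hasD f x df ->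
  forall e : R, 0 < e -> exists2 d : R, 0 < d &
    forall k, `|k| < d -> `|f (x + k) - f x - df k| <= e * `|k|.
Proof.
move=> [f1 f2] e e0.
have /eqaddoP/(_ _ e0)/near_norm[d d0 h] := diff_locally f1.
exists d => // k kd; have := h k; rewrite subr0 => /(_ kd) /=.
by rewrite -[X in `|X|]/(f (k + x) - (f x + 'd f x k)) f2 opprD addrA [k + x]addrC.
Qed.

Lemma hasD_of_eps V W (f : V -> W) x (df : {linear V -> W}) : continuous df ->
  (forall e : R, 0 < e -> exists2 d : R, 0 < d &
    forall k, `|k| < d -> `|f (x + k) - f x - df k| <= e * `|k|) ->
  hasD f x df.
Proof.
move=> dfc h.
have e : f \o shift x = cst (f x) + df +o_ 0 id.
  apply/eqaddoP => e e0; have [d d0 hd] := h e e0.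
  apply/near_norm; exists d => // k; rewrite subr0 => /hd.
  by rewrite -[X in _ -> `|X| <= _]/(f (k + x) - (f x + df k)) opprD addrA [k + x]addrC.
have dz := diff_unique dfc e.
split; last by move=> v; rewrite (congr1 (@^~ v) dz).
by apply/diff_locallyP; rewrite dz.
Qed.

Lemma hasD_line V (x v : V) (t : R^o) :
  hasD (fun s : R^o => x + s *: v) t (fun s : R^o => s *: v).
Proof.
apply: (hasD_ext (hasDD (hasD_cst x t) (hasD_scale (hasD_id t) (hasD_cst v t)))).
by move=> s; rewrite scaler0 !add0r.
Qed.

Lemma MVT_hasD (f : R^o -> R^o) (df : R -> R^o -> R^o) (b : R) : 0 < b ->
  (forall t, 0 <= t <= b -> hasD f t (df t)) ->
  exists2 c, 0 < c < b & f b - f 0 = df c 1 * b.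
Proof.
move=> b0 h.
have [||c cb e] := @MVT R f (fun t => df t 1) 0 b b0.
- move=> t; rewrite in_itv /= => /andP[t0 tb].
  have ht : hasD f t (df t) by apply: h; rewrite !ltW.
  split; first exact: (@diff_derivable _ _ _ f t 1 ht.1).
  exact: (@hasD_derive _ _ _ f t _ 1 ht).
- apply: continuous_in_subspaceT => t; rewrite inE /= in_itv /= => tb.
  exact: hasD_continuous (h t tb).
exists c; first by move: cb; rewrite in_itv.
by rewrite e subr0.
Qed.

(** The mean value theorem in the direction [v] turns the second difference into a first difference
    of ['d f _ v], which is then compared with its differential at [x], twice. *)
Lemma second_difference V (f : V -> R^o) U x v w : open U -> Ck 2 U f -> U x ->
  forall e : R, 0 < e -> exists2 d : R, 0 < d & forall h : R, 0 < h < d ->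
  `|f (x + h *: v + h *: w) - f (x + h *: v) - f (x + h *: w) + f x
    - h ^+ 2 * 'd (fun y => 'd f y v) x w| <= e * h ^+ 2.
Proof.
move=> oU hf Ux e e0.
pose D := fun y => 'd f y v.
have hD : hasD D x ('d D x) := Ck_hasD (hf.2 v : Ck 1 U D) Ux.
(* All displacements [t v + s w] with [0 <= t, s <= h] have norm at most [h * N]; the [+ 1] keeps
   [N] positive. Two remainders of size [e / (2 * N) * (h * N)], times [h], add up to
   [e * h ^+ 2]. *)
pose N := `|v| + `|w| + 1.
have N0 : 0 < N by rewrite /N ltr_wpDl // addr_ge0.
have e'0 : 0 < e / (2 * N) by rewrite divr_gt0 // mulr_gt0.
have [d1 d10 h1] := hasD_eps hD e'0.
have [d2 d20 h2] : exists2 d : R, 0 < d & forall y, `|y - x| < d -> U y.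
  by apply/near_norm; exact: open_near Ux _.
pose d := Num.min d1 d2 / N.
have d0 : 0 < d by rewrite divr_gt0 // lt_min d10.
exists d => // h /andP[h0 hd].
have hN1 : h * N < d1.
  by move: hd; rewrite ltr_pdivlMr // => /lt_le_trans; apply; rewrite ge_min lexx.
have hN2 : h * N < d2.
  by move: hd; rewrite ltr_pdivlMr // => /lt_le_trans; apply; rewrite ge_min lexx orbT.
have bnd t s : 0 <= t <= h -> 0 <= s <= h -> `|t *: v + s *: w| <= h * N.
  move=> /andP[t0 th] /andP[s0 sh]; apply: le_trans (ler_normD _ _) _.
  rewrite !normrZ !ger0_norm // /N mulrDr mulrDr.
  rewrite -[leLHS]addr0 lerD ?mulr1 ?(ltW h0) //.
  by rewrite lerD // ler_wpM2r.
have inU t s : 0 <= t <= h -> 0 <= s <= h -> U (x + t *: v + s *: w).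
  move=> ht hs; apply: h2; have -> : x + t *: v + s *: w - x = t *: v + s *: w
    by rewrite -[x + _ + _]addrA [LHS]addrC addKr.
  exact: le_lt_trans (bnd _ _ ht hs) hN2.
have h00 : (0 : R) <= 0 <= h by apply/andP; split => //; exact: ltW.
have hhh : 0 <= h <= h by apply/andP; split => //; exact: ltW.
pose phi := fun s : R^o => f (x + s *: v + h *: w) - f (x + s *: v) : R^o.
have [c /andP[c0 ch]] : exists2 c, 0 < c < h & phi h - phi 0 =
    (D (x + c *: v + h *: w) - D (x + c *: v)) * h.
  suff hphi t : 0 <= t <= h -> hasD phi t
      (fun s => s *: (D (x + t *: v + h *: w) - D (x + t *: v))).
    have [c ch E] := MVT_hasD h0 hphi.
    by exists c => //; rewrite E scale1r.
  move=> th.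
  have Ut := inU _ _ th hhh.
  have Ut0 : U (x + t *: v) by have := inU _ _ th h00; rewrite scale0r addr0.
  have l1 : hasD (fun s : R^o => x + s *: v + h *: w) t (fun s => s *: v).
    have := hasDD (hasD_line x v t) (hasD_cst (h *: w) t).
    by move=> /hasD_ext; apply => s; rewrite addr0.
  have := hasDB (hasD_comp l1 (Ck_hasD hf Ut))
     (hasD_comp (hasD_line x v t) (Ck_hasD hf Ut0)).
  by move=> /hasD_ext; apply => s; rewrite /= /D scalerBr; congr (_ - _); exact: linearZ.
rewrite /phi scale0r addr0 => E.
have -> : f (x + h *: v + h *: w) - f (x + h *: v) - f (x + h *: w) + f x =
  (D (x + c *: v + h *: w) - D (x + c *: v)) * h.
  by rewrite -E; ring.
have c0h : 0 <= c <= h by apply/andP; split; exact: ltW.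
have b1 := h1 (c *: v + h *: w) (le_lt_trans (bnd _ _ c0h hhh) hN1).
have b2 := h1 (c *: v).
have nb2 : `|c *: v| <= h * N.
  by have := bnd _ _ c0h h00; rewrite scale0r addr0.
have {}b2 := b2 (le_lt_trans nb2 hN1).
have -> : (D (x + c *: v + h *: w) - D (x + c *: v)) * h - h ^+ 2 * 'd D x w =
   h * ((D (x + (c *: v + h *: w)) - D x - 'd D x (c *: v + h *: w)) -
       (D (x + c *: v) - D x - 'd D x (c *: v))).
  have -> : 'd D x (c *: v + h *: w) = 'd D x (c *: v) + h * 'd D x w.
    by rewrite linearD; congr (_ + _); exact: linearZ.
  have -> : x + (c *: v + h *: w) = x + c *: v + h *: w by rewrite addrA.
  ring.
rewrite normrM (ger0_norm (ltW h0)).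
apply: (@le_trans _ _ (h * (e / (2 * N) * (h * N) + e / (2 * N) * (h * N)))).
  rewrite ler_wpM2l ?(ltW h0) //; apply: le_trans (ler_normB _ _) _.
  rewrite lerD //.
    by apply: le_trans b1 _; rewrite ler_wpM2l ?(ltW e'0) // bnd.
  by apply: le_trans b2 _; rewrite ler_wpM2l ?(ltW e'0).
rewrite le_eqVlt; apply/orP; left; apply/eqP; field.
by rewrite gt_eqF.
Qed.

(** Schwarz's theorem: the second difference is symmetric in [v] and [w], and after division by
    [h ^+ 2] it is within [e / 2] of either iterated derivative. *)
Lemma diff2C V (f : V -> R^o) U x v w : open U -> Ck 2 U f -> U x ->
  'd (fun y => 'd f y v) x w = 'd (fun y => 'd f y w) x v.
Proof.
move=> oU hf Ux; apply/eqP; rewrite -subr_eq0 -normr_le0.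
apply/ler_addgt0Pr => e e0; rewrite add0r.
have e20 : 0 < e / 2 by rewrite divr_gt0.
have [d d0 h1] := second_difference v w oU hf Ux e20.
have [d' d'0 h2] := second_difference w v oU hf Ux e20.
pose h := Num.min d d' / 2.
have m0 : 0 < Num.min d d' by rewrite lt_min d0.
have h0 : 0 < h by rewrite divr_gt0.
have hm : h < Num.min d d' by rewrite ltr_pdivrMr // ltr_pMr // ltr1n.
move: (hm); rewrite lt_min => /andP[hd hd'].
have {}h1 := h1 h; have {}h2 := h2 h.
rewrite h0 hd in h1; rewrite h0 hd' in h2.
have {}h1 := h1 isT; have {}h2 := h2 isT.
set a := 'd _ x w in h1 *; set b := 'd _ x v in h2 *.
have h20 : 0 < h ^+ 2 by rewrite exprn_gt0.
rewrite -(ler_pM2l h20) -[X in X * `|_|](ger0_norm (ltW h20)) -normrM.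
set A := f _ - _ - _ + _ in h1; set B := f _ - _ - _ + _ in h2.
have AB : A = B by rewrite /A /B [x + h *: w + h *: v]addrAC; ring.
have -> : h ^+ 2 * (a - b) = (B - h ^+ 2 * b) - (A - h ^+ 2 * a).
  by rewrite AB; ring.
apply: le_trans (ler_normB _ _) _.
by apply: le_trans (lerD h2 h1) _; rewrite -mulrDl -splitr mulrC.
Qed.

End MeanValue.

(** * The inverse function theorem *)

Section InverseFunction.
Variable R : realType.

HB.instance Definition _ n := Complete.on 'rV[R]_n.

Lemma rV_norm_le n (x : 'rV[R]_n) (c : R) : 0 <= c ->
  (forall i, `|x 0 i| <= c) -> `|x| <= c.
Proof.
move=> c0 h; rewrite /Num.norm /= mx_normrE; apply/bigmax_leP; split => // -[i j] _.
by rewrite ord1.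
Qed.

Lemma coord_norm_le n (x : 'rV[R]_n) i : `|x 0 i| <= `|x|.
Proof.
rewrite [leRHS]/Num.norm /= mx_normrE; apply/bigmax_geP; right.
by exists (0, i).
Qed.

(** The sup norm lets the scalar mean value theorem act on one coordinate at a time, along a segment
    that stays in the ball by convexity. *)
Lemma lipschitz_of_diff n (h : 'rV[R]_n -> 'rV[R]_n)
    (c : R) a (r : R) : 0 <= c ->
  (forall x, `|x - a| < r -> differentiable h x) ->
  (forall x u, `|x - a| < r -> `|'d h x u| <= c * `|u|) ->
  forall x y, `|x - a| < r -> `|y - a| < r -> `|h x - h y| <= c * `|x - y|.
Proof.
move=> c0 dh bh x y xr yr.
apply: rV_norm_le => [|i]; first by rewrite mulr_ge0.
have seg (t : R) : 0 <= t <= 1 -> `|y + t *: (x - y) - a| < r.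
  move=> /andP[t0 t1].
  have -> : y + t *: (x - y) - a = (1 - t) *: (y - a) + t *: (x - a).
    by apply/rowP => j; rewrite !mxE; ring.
  apply: le_lt_trans (ler_normD _ _) _.
  rewrite !normrZ !ger0_norm ?subr_ge0 //.
  (* Strictness comes from the summand with factor [t], so [t = 0] is treated apart. *)
  have [->|tn0] := eqVneq t 0; first by rewrite subr0 mul1r mul0r addr0.
  have tp : 0 < t by rewrite lt_neqAle eq_sym tn0.
  have -> : r = (1 - t) * r + t * r by ring.
  by rewrite ler_ltD // ?ltr_pM2l // ler_wpM2l ?subr_ge0 // ltW.
pose psi := fun t : R^o => h (y + t *: (x - y)) 0 i : R^o.
have hpsi t : 0 <= t <= 1 ->
    hasD psi t (fun s => coordf i ('d h (y + t *: (x - y)) (s *: (x - y)))).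
  move=> tt; apply: (hasD_comp (f := fun t : R^o => h (y + t *: (x - y))) (g := coordf i)).
    apply: (hasD_comp (hasD_line y (x - y) t) (g := h)).
    by split => //; apply: dh; exact: seg.
  by apply: hasD_lin; exact: coordf_continuous.
have [t /andP[t0 t1]] := MVT_hasD ltr01 hpsi.
rewrite /psi scale1r scale0r addr0 subrKC mulr1 /coordf !mxE => ->.
apply: le_trans (coord_norm_le _ _) _; apply: bh; apply: seg.
by rewrite !ltW.
Qed.

(** The map [h = id - f] is a 1/2-contraction near [a], and a fixed point of [y + h] solves
    [f x = y]. A right inverse differentiable at the single point [f a] is what the later uses call
    for: curves of horizontal vectors, and openness of submersions. *)
Lemma inverse_function n (U : set 'rV[R]_n) (f : 'rV[R]_n -> 'rV[R]_n) a :
  open U -> U a -> Ck 1 U f -> (forall u, 'd f a u = u) ->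
  exists g : 'rV[R]_n -> 'rV[R]_n,
    [/\ \forall y \near f a, U (g y) /\ f (g y) = y, g (f a) = a
      & hasD g (f a) id].
Proof.
move=> oU Ua hf dfa.
pose h x := x - f x.
have hh x : U x -> hasD h x (fun u => u - 'd f x u).
  by move=> Ux; apply: hasDB; [exact: hasD_id|exact: Ck_hasD hf Ux].
(* A bound [c] on each of the [n] basis directions sums to at most 1/2; [n.+1] keeps the quotient
   meaningful for [n = 0]. *)
pose c : R := (2 * n.+1%:R)^-1.
have c0 : 0 < c by rewrite invr_gt0 mulr_gt0.
have [r r0 hr] : exists2 r : R, 0 < r & forall x, `|x - a| < r ->
    U x /\ forall j : 'I_n, `|delta_mx 0 j - 'd f x (delta_mx 0 j)| < c.
  have dn : \forall x \near a,
      forall j : 'I_n, `|delta_mx 0 j - 'd f x (delta_mx 0 j)| < c.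
    have dn1 (j : 'I_n) :
        \forall x \near a, `|delta_mx 0 j - 'd f x (delta_mx 0 j)| < c.
      have l := hf.2 (delta_mx 0 j) a Ua.
      have {}l := eq_ind _ (fun z => 'd f x (delta_mx 0 j) @[x --> a] --> z) l
        _ (dfa (delta_mx 0 j)).
      by move/cvgrPdist_lt : l; apply.
    exact: (filter_forall _ dn1).
  apply/near_norm; near=> x; split; last by near: x.
  by near: x; exact: open_near Ua _.
have bh x u : `|x - a| < r -> `|u - 'd f x u| <= 2^-1 * `|u|.
  move=> /hr[Ux hj].
  have -> : u - 'd f x u = \sum_j u 0 j *: (delta_mx 0 j - 'd f x (delta_mx 0 j)).
    under eq_bigr do rewrite scalerBr.
    rewrite sumrB -row_sum_delta; congr (_ - _).
    exact: (hasD_basis f x u (rV_is_basis R n)).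
  apply: le_trans (ler_norm_sum _ _ _) _.
  apply: (@le_trans _ _ (\sum_(j < n) `|u| * c)).
    apply: ler_sum => j _; rewrite normrZ ler_pM // ?coord_norm_le //.
    exact: ltW (hj j).
  have cn : c * n%:R <= 2^-1.
    rewrite /c invfM -[_ * _ * _]mulrA ler_piMr ?invr_ge0 //.
    by rewrite mulrC ler_pdivrMr // mul1r ler_nat.
  rewrite sumr_const card_ord.
  have -> : `|u| * c *+ n = (c * n%:R) * `|u| by ring.
  exact: ler_wpM2r.
have hL x y : `|x - a| < r -> `|y - a| < r -> `|h x - h y| <= 2^-1 * `|x - y|.
  have i20 : (0 : R) <= 2^-1 by rewrite invr_ge0.
  apply: (lipschitz_of_diff i20) => [z /hr[/hh[]]//|z u zr].
  by have [_ ->] := hh z (hr z zr).1; exact: bh.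
have aa : `|a - a| < r by rewrite subrr normr0.
have hxa x : h x - h a = (x - a) - (f x - f a) by rewrite /h; apply/rowP => j; rewrite !mxE; ring.
have r2 : r / 2 < r by rewrite ltr_pdivrMr // ltr_pMr // ltr1n.
have r20 : 0 < r / 2 by rewrite divr_gt0.
(* Closed, as the fixed point theorem requires, and inside the open ball of radius [r] where the
   contraction estimate holds. *)
pose K : set 'rV[R]_n := closed_ball a (r / 2).
have KE x : K x <-> `|x - a| <= r / 2.
  by rewrite /K closed_ballE // /closed_ball_ /= distrC.
have Kr x : K x -> `|x - a| < r by move=> /KE /le_lt_trans; apply.
(* On [K] the displacement is less than [r / 4] from [y] plus at most [r / 4] from the contraction,
   so [K] is mapped into itself. *)
have fixd y : `|y - f a| < r / 4 -> exists2 x, K x & f x = y.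
  move=> yr.
  have TK : {homo (fun x => y + h x) : x / K x >-> K x}.
    move=> x Kx; apply/KE.
    have -> : y + h x - a = (y - f a) + (h x - h a).
      by rewrite /h; apply/rowP => j; rewrite !mxE; ring.
    apply: le_trans (ler_normD _ _) _.
    have := hL _ _ (Kr _ Kx) aa; move/KE: Kx => Kx hl.
    by lra.
  have [|||x Kx] := @banach_fixed_point R 'rV[R]_n K (mkfun_fun TK).
  - exists (2^-1)%:nng; split => /=; first by rewrite invf_lt1 // ltr1n.
    move=> [x z] [/= Kx Kz]; rewrite /= opprD addrACA subrr add0r.
    exact: hL (Kr _ Kx) (Kr _ Kz).
  - exact: closed_ball_closed.
  - by exists a; apply/KE; rewrite subrr normr0 ltW.
  move=> /= xe; exists x => //; move: xe; rewrite /mkfun /h.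
  by move=> /eqP; rewrite addrCA -subr_eq0 opprD addrA subrr sub0r oppr_eq0 subr_eq0 => /eqP.
pose g y := xget a [set x | K x /\ f x = y].
have gP y : `|y - f a| < r / 4 -> K (g y) /\ f (g y) = y.
  move=> /fixd[x Kx fx]; rewrite /g; case: xgetP => [x' -> //|/(_ x) []].
  by split.
(* The second bound is by absorption: [|g y - a|] is at most [|y - f a|] plus half of itself. *)
have gb y : `|y - f a| < r / 4 ->
    `|g y - a - (y - f a)| <= `|h (g y) - h a| /\ `|g y - a| <= 2 * `|y - f a|.
  move=> /gP[Kg fg]; rewrite hxa fg; split => //.
  have hl := hL _ _ (Kr _ Kg) aa.
  have tri : `|g y - a| <= `|y - f a| + `|h (g y) - h a|.
    have e : g y - a = (y - f a) + (h (g y) - h a).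
      by rewrite hxa fg [RHS]addrC subrK.
    by rewrite {1}e; exact: ler_normD.
  by lra.
have r40 : 0 < r / 4 by rewrite divr_gt0.
have ga : g (f a) = a.
  have [|_] := gb (f a); first by rewrite subrr normr0.
  by rewrite subrr normr0 mulr0 normr_le0 subr_eq0 => /eqP.
exists g; split; [|exact: ga|].
  apply/near_norm; exists (r / 4) => // y /gP[Kg fg]; split => //.
  by have [] := hr _ (Kr _ Kg).
apply: (@hasD_of_eps _ _ _ g (f a) idfun) => [x A|e e0]; first by [].
have e20 : 0 < e / 2 by rewrite divr_gt0.
(* The differential of [h] at [a] is zero, so the remainder of [g] is at most [e / 2] times
   [|g y - a|], and the latter is at most [2 |k|]. *)
have [d d0 hd] := hasD_eps (hh a Ua) e20.
exists (Num.min (r / 4) (d / 2)); first by rewrite lt_min r40 divr_gt0.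
move=> k; rewrite lt_min => /andP[k1 k2].
have ek : f a + k - f a = k by rewrite addrC addKr.
have [|b1 b2] := gb (f a + k); first by rewrite ek.
rewrite ek in b1 b2.
rewrite ga /=; apply: le_trans b1 _.
have := hd (g (f a + k) - a); rewrite subrKC dfa subrr subr0.
have b3 : `|g (f a + k) - a| < d by apply: le_lt_trans b2 _; lra.
move=> /(_ b3) /le_trans; apply.
have -> : e * `|k| = e / 2 * (2 * `|k|) by field.
by rewrite ler_wpM2l // ltW.
Unshelve. all: by end_near. Qed.

End InverseFunction.

(** * Smooth maps on open sets *)

Section SmoothOn.
Variable R : realType.
Implicit Types (V W Z : normedModType R).

Lemma smooth_hasD V W (U : set V) (f : V -> W) x :
  smooth_on U f -> U x -> hasD f x ('d f x).
Proof. by move=> h; exact: Ck_hasD (h 1%N). Qed.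

Lemma smooth_subset V W (U U' : set V) (f : V -> W) :
  U' `<=` U -> smooth_on U f -> smooth_on U' f.
Proof. by move=> s h k; exact: Ck_subset s (h k). Qed.

Lemma smooth_eq V W (U : set V) (f g : V -> W) : open U ->
  (forall x, U x -> f x = g x) -> smooth_on U f -> smooth_on U g.
Proof. by move=> oU e h k; exact: Ck_eq oU e (h k). Qed.

Lemma smooth_diff V W (U : set V) (f : V -> W) v :
  smooth_on U f -> smooth_on U (fun x => 'd f x v).
Proof. by move=> h k; exact: (h k.+1).2. Qed.

Lemma smooth_cst V W (U : set V) (c : W) : open U -> smooth_on U (fun=> c).
Proof. by move=> oU k; exact: Ck_cst. Qed.

Lemma smooth_lin V W (U : set V) (f : {linear V -> W}) : open U ->
  continuous f -> smooth_on U f.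
Proof. by move=> oU cf k; exact: Ck_lin. Qed.

Lemma smooth_add V W (U : set V) (f g : V -> W) : open U ->
  smooth_on U f -> smooth_on U g -> smooth_on U (fun x => f x + g x).
Proof. by move=> oU hf hg k; exact: Ck_add oU (hf k) (hg k). Qed.

Lemma smooth_scale V W (U : set V) (f : V -> R^o) (g : V -> W) : open U ->
  smooth_on U f -> smooth_on U g -> smooth_on U (fun x => f x *: g x).
Proof. by move=> oU hf hg k; exact: Ck_scale oU (hf k) (hg k). Qed.

Lemma smooth_mul V (U : set V) (f g : V -> R^o) : open U ->
  smooth_on U f -> smooth_on U g -> smooth_on U (fun x => f x * g x : R^o).
Proof. exact: (@smooth_scale V R^o). Qed.

Lemma smooth_pair V W Z (U : set V) (f : V -> W) (g : V -> Z) : open U ->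
  smooth_on U f -> smooth_on U g -> smooth_on U (fun x => (f x, g x)).
Proof. by move=> oU hf hg k; exact: Ck_pair oU (hf k) (hg k). Qed.

Lemma smooth_sum V W (U : set V) (I : Type) (r : seq I) (f : I -> V -> W) :
  open U -> (forall i, smooth_on U (f i)) ->
  smooth_on U (fun x => \sum_(i <- r) f i x).
Proof. by move=> oU h k; apply: Ck_sum => // i; exact: h. Qed.

Lemma smooth_prod V (U : set V) (I : Type) (r : seq I) (f : I -> V -> R^o) :
  open U -> (forall i, smooth_on U (f i)) ->
  smooth_on U (fun x => \prod_(i <- r) f i x : R^o).
Proof.
move=> oU h; elim: r => [|i r IH].
  by apply: smooth_eq (smooth_cst (1 : R^o) oU) => // x _; rewrite big_nil.
by apply: smooth_eq (smooth_mul oU (h i) IH) => // x _; rewrite big_cons.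
Qed.

Lemma smooth_inv V (U : set V) (f : V -> R^o) : open U ->
  (forall x, U x -> f x != 0) ->
  smooth_on U f -> smooth_on U (fun x => (f x)^-1 : R^o).
Proof. by move=> oU f0 hf k; exact: Ck_inv oU f0 (hf k). Qed.

Lemma smooth_comp V W Z (U : set V) (U' : set W) (f : V -> W) (g : W -> Z) :
  has_basis W -> open U -> open U' -> (forall x, U x -> U' (f x)) ->
  smooth_on U f -> smooth_on U' g -> smooth_on U (g \o f).
Proof. by move=> b oU oU' fU hf hg k; exact: Ck_comp b oU oU' fU (hf k) (hg k). Qed.

Lemma smooth_lin_comp V W Z (U : set V) (l : {linear W -> Z}) (h : V -> W) :
  open U -> continuous l -> smooth_on U h -> smooth_on U (fun x => l (h x)).
Proof. by move=> oU cl hh k; exact: Ck_lin_comp. Qed.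

Lemma smooth_coord V n (U : set V) (f : V -> 'rV[R]_n) i : open U ->
  smooth_on U f -> smooth_on U (fun x => f x 0 i : R^o).
Proof.
by move=> oU hf; apply: (smooth_lin_comp (l := coordf i)) => //; exact: coordf_continuous.
Qed.

Lemma smooth_rV V n (U : set V) (f : V -> 'rV[R]_n) : open U ->
  (forall i, smooth_on U (fun x => f x 0 i : R^o)) -> smooth_on U f.
Proof.
move=> oU h.
apply: (@smooth_eq _ _ _ (fun x => \sum_i (f x 0 i : R^o) *: (delta_mx 0 i : 'rV[R]_n))) => //.
  by move=> x _; rewrite -row_sum_delta.
apply: smooth_sum => // i; apply: smooth_scale => //; exact: smooth_cst.
Qed.

Lemma linear_continuous V W (f : {linear V -> W}) : has_basis V -> continuous f.
Proof.
move=> [I [e [l [lc b]]]] x.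
have -> : (f : V -> W) = fun v => \sum_i l i v *: f (e i).
  apply/funext => v; rewrite {1}(b v) linear_sum.
  by apply: eq_bigr => i _; rewrite linearZ.
apply: (hasD_continuous (df := fun v => \sum_i l i v *: f (e i))).
apply: hasD_sum => i.
apply: (hasD_ext (hasD_scale (hasD_lin x (lc i)) (hasD_cst (f (e i)) x))).
by move=> v; rewrite scaler0 add0r.
Qed.

Lemma linear_expand n W (f : 'rV[R]_n -> W) : linear f ->
  forall x, f x = \sum_i x 0 i *: f (delta_mx 0 i).
Proof.
move=> lf x.
pose fM := GRing.isLinear.Build _ _ _ _ f lf.
pose fL : {linear 'rV[R]_n -> W} := HB.pack f fM.
rewrite {1}[x]row_sum_delta -[f]/(fL : _ -> _) linear_sum.
by apply: eq_bigr => i _; rewrite linearZ.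
Qed.
End SmoothOn.

Lemma linear_mulr (R : realType) (V : lmodType R) (c : R)
  (phi : {linear V -> R^o}) : linear (fun e => c * phi e : R^o).
Proof.
by move=> a x y; rewrite linearP mulrDr /GRing.scale /= mulrCA.
Qed.

Lemma near1_gt0 (R : realType) : \forall t \near (1 : R^o), 0 < (t : R).
Proof.
apply/near_norm; exists 1 => // t; rewrite ltr_norml => /andP[h _].
by move: h; rewrite ltrBrDr addNr.
Qed.

Lemma sqr_scale (R : realType) (l b : R) : l ^+ 2 *: (b : R^o) = l * (l * b).
Proof. by rewrite mulrA -expr2. Qed.

Section LinearE.
Variables (R : pzRingType) (V W : lmodType R) (phi : V -> W).
Hypothesis lphi : linear phi.

(** These rules take a proof of [linear] as argument, because the slots of the tensors below are not
    packed as linear structures. *)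
Lemma linear_zeroE : phi 0 = 0.
Proof. by have := lphi (-1) 0 0; rewrite scaler0 addr0 scaleN1r addNr. Qed.

Lemma linear_addE a b : phi (a + b) = phi a + phi b.
Proof. by have := lphi 1 a b; rewrite !scale1r. Qed.

Lemma linear_scaleE k a : phi (k *: a) = k *: phi a.
Proof. by have := lphi k a 0; rewrite linear_zeroE !addr0. Qed.

Lemma linear_subE a b : phi (a - b) = phi a - phi b.
Proof. by rewrite linear_addE -scaleN1r linear_scaleE scaleN1r. Qed.
End LinearE.

Lemma comp_linear (R : pzRingType) (U V W : lmodType R) (f : V -> W) (g : U -> V) :
  linear f -> linear g -> linear (fun x => f (g x)).
Proof. by move=> lf lg a x y; rewrite lg lf. Qed.

(** * Fundamental and Cartan tensors of one fiber *)

Section Gram.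
Variables (R : realType) (n : nat).
Implicit Types (f : 'rV[R]_n -> R^o) (U : set 'rV[R]_n).

Lemma derive1_line (F : 'rV[R]_n -> R^o) a b :
  derive1 (fun t : R => F (a + t *: b)) 0 = 'D_b F a.
Proof.
rewrite /derive1 /derive; set d := (fun _ : R => _); set d' := (fun _ : R => _).
suff -> : d = d' by []; apply/funext => h; rewrite /d /d' /=.
by rewrite addr0 scale0r addr0 [h *: b + a]addrC.
Qed.

(** The fundamental tensor in terms of Frechet differentials instead of iterated one-variable
    derivatives, so that the preceding calculus applies; [fund_gram] is the comparison. *)
Definition gram f v e h : R := 2^-1 * 'd (fun w => 'd f w h) v e.
(* Twice the Cartan tensor of [f]. *)
Definition dgram f v b e h : R := 'd (fun w => gram f w e h : R^o) v b.

Variables (f : 'rV[R]_n -> R^o) (U : set 'rV[R]_n).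
Hypotheses (oU : open U) (sf : smooth_on U f).

Lemma gramC v e h : U v -> gram f v e h = gram f v h e.
Proof. by move=> Uv; congr (_ * _); exact: (diff2C h e oU (sf 2) Uv). Qed.

Lemma gram_linearl v h : linear (fun e => gram f v e h : R^o).
Proof. exact: (linear_mulr 2^-1 ('d (fun w => 'd f w h) v)). Qed.

Lemma gram_linearr v e : U v -> linear (fun h => gram f v e h : R^o).
Proof. by move=> Uv a x y; rewrite gramC // gram_linearl -!(gramC e _ Uv). Qed.

Lemma gram_smooth e h : smooth_on U (fun w => gram f w e h : R^o).
Proof.
apply: smooth_mul => //; first exact: smooth_cst.
exact: smooth_diff (smooth_diff h sf).
Qed.

Lemma dgram_linear1 v e h : linear (fun b => dgram f v b e h : R^o).
Proof. by move=> a x y; exact: linearP. Qed.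

Lemma dgramC23 v b e h : U v -> dgram f v b e h = dgram f v b h e.
Proof.
move=> Uv; rewrite /dgram.
have E : \forall w \near v, gram f w h e = gram f w e h.
  by apply: (open_near oU Uv) => w Uw; exact: gramC.
exact: ((near_eq_hasD E (smooth_hasD (gram_smooth h e) Uv)).2 b).
Qed.

Lemma dgramE v b e h : U v ->
  dgram f v b e h = 2^-1 * 'd (fun w => 'd (fun w' => 'd f w' h) w e) v b.
Proof.
move=> Uv.
exact: ((hasDZ (2^-1) (smooth_hasD (smooth_diff e (smooth_diff h sf)) Uv)).2 b).
Qed.

Lemma dgramC12 v b e h : U v -> dgram f v b e h = dgram f v e b h.
Proof.
move=> Uv; rewrite !dgramE //; congr (_ * _).
exact: (diff2C e b oU (smooth_diff h sf 2) Uv).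
Qed.

Lemma fund_gram v e h : U v ->
  2^-1 * derive1 (fun s : R => derive1 (fun t : R =>
    f (v + s *: e + t *: h) : R^o) 0 : R^o) 0 = gram f v e h.
Proof.
move=> Uv; rewrite /gram; congr (_ * _).
under [X in derive1 X]eq_fun do rewrite derive1_line.
rewrite (derive1_line (fun w => 'D_h f w)).
have := hasD_derive e (smooth_hasD (smooth_diff h sf) Uv).
rewrite /= => <-.
apply: near_eq_derive; apply: (open_near oU Uv) => w Uw; apply: deriveE;
 exact: (smooth_hasD sf Uw).1.
Qed.

Lemma cartan_dgram v b e h : U v ->
  4^-1 * derive1 (fun r : R => derive1 (fun s : R => derive1 (fun t : R =>
    f (v + r *: b + s *: e + t *: h) : R^o) 0 : R^o) 0 : R^o) 0
  = 2^-1 * dgram f v b e h.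
Proof.
move=> Uv.
rewrite (dgramE _ _ _ Uv) mulrA; congr (_ * _).
  by rewrite -invfM -natrM.
under [X in derive1 X]eq_fun => r.
  under [X in derive1 X]eq_fun do rewrite derive1_line.
  rewrite (derive1_line (fun w => 'D_h f w)).
over.
rewrite (derive1_line (fun w => 'D_e (fun w => 'D_h f w) w)).
rewrite -(hasD_derive b (smooth_hasD (smooth_diff e (smooth_diff h sf)) Uv)).
apply: near_eq_derive; apply: (open_near oU Uv) => w Uw.
rewrite -(hasD_derive e (smooth_hasD (smooth_diff h sf) Uw)).
apply: near_eq_derive; apply: (open_near oU Uw) => w' Uw'.
by apply: deriveE; exact: (smooth_hasD sf Uw').1.
Qed.

Lemma gram_expand v a b : U v -> gram f v a b =
  \sum_i \sum_j a 0 i * (b 0 j * gram f v (delta_mx 0 i) (delta_mx 0 j)).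
Proof.
move=> Uv; rewrite (linear_expand (gram_linearl v b)); apply: eq_bigr => i _.
rewrite (linear_expand (gram_linearr _ Uv)) scaler_sumr; exact: eq_bigr.
Qed.

Lemma dgram_expand v c a b : U v -> dgram f v c a b =
  \sum_i \sum_j a 0 i * (b 0 j * dgram f v c (delta_mx 0 i) (delta_mx 0 j)).
Proof.
move=> Uv.
have l1 z : linear (fun a => dgram f v c a z : R^o).
  by move=> k x y; rewrite !(dgramC12 c _ _ Uv) dgram_linear1.
have l2 z : linear (fun b => dgram f v c z b : R^o).
  by move=> k x y; rewrite !(dgramC23 c z _ Uv) l1.
rewrite (linear_expand (l1 b)); apply: eq_bigr => i _.
rewrite (linear_expand (l2 _)) scaler_sumr; exact: eq_bigr.
Qed.

(** Product rule with base point and both arguments moving. Smoothness of [gram] is available for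
    fixed arguments, hence the expansion over the standard basis. *)
Lemma hasD_gram (V : normedModType R) (c a b dc da db : V -> 'rV[R]_n) x :
  U (c x) -> hasD c x dc -> hasD a x da -> hasD b x db ->
  hasD (fun t => gram f (c t) (a t) (b t) : R^o) x (fun s =>
    dgram f (c x) (dc s) (a x) (b x) + gram f (c x) (da s) (b x)
    + gram f (c x) (a x) (db s)).
Proof.
move=> Ucx hc ha hb.
have Uc : \forall t \near x, U (c t).
  by apply: (hasD_continuous hc); exact: open_nbhs_nbhs.
pose F t := \sum_i \sum_j coordf i (a t) *: (coordf j (b t) *:
  (gram f (c t) (delta_mx 0 i) (delta_mx 0 j) : R^o)).
have hF : \forall t \near x, F t = gram f (c t) (a t) (b t).
  by apply: filterS Uc => t Ut; rewrite gram_expand.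
apply: (near_eq_hasD hF).
have hcoord (u du : V -> 'rV[R]_n) i : hasD u x du ->
    hasD (fun t => coordf i (u t)) x (fun s => coordf i (du s)).
  move=> hu; apply: (hasD_comp hu (g := coordf i)).
  exact: (hasD_lin _ (@coordf_continuous R n i)).
have hG i j := hasD_comp hc
  (smooth_hasD (gram_smooth (delta_mx 0 i) (delta_mx 0 j)) Ucx).
apply: hasD_ext.
  apply: hasD_sum => i; apply: hasD_sum => j.
  exact: (hasD_scale (hcoord _ _ i ha) (hasD_scale (hcoord _ _ j hb) (hG i j))).
move=> s /=; rewrite (dgram_expand _ _ _ Ucx) 2!(gram_expand _ _ Ucx).
rewrite -!big_split; apply: eq_bigr => i _; rewrite -!big_split.
apply: eq_bigr => j _; rewrite /= /GRing.scale /= /coordf /dgram; ring.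
Qed.

Hypothesis coneU : forall v (l : R), 0 < l -> U v -> U (l *: v).
Hypothesis homf : forall v (l : R), 0 < l -> U v -> f (l *: v) = l ^+ 2 * f v.

Lemma hasD_scalel (v : 'rV[R]_n) (l : R^o) :
  hasD (fun t : R^o => t *: v) l (fun t : R^o => t *: v).
Proof.
apply: (hasD_ext (hasD_scale (hasD_id l) (hasD_cst v l))) => s.
by rewrite scaler0 add0r.
Qed.

(** Differentiating [f (l w) = l^2 f w] in [w] and cancelling one factor [l]. *)
Lemma diff_hom v h (l : R) : 0 < l -> U v -> 'd f (l *: v) h = l * 'd f v h.
Proof.
move=> l0 Uv.
have Ul := coneU l0 Uv.
have h1 := hasD_comp (hasDZ l (hasD_id v)) (smooth_hasD sf Ul).
have h2 := hasDZ (l ^+ 2) (smooth_hasD sf Uv).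
have E : \forall w \near v, (l ^+ 2 *: f w) = (f \o (fun w => l *: w)) w.
  by apply: (open_near oU Uv) => w Uw /=; rewrite homf.
have e := hasD_unique h1 (near_eq_hasD E h2) h.
have e2 : 'd f (l *: v) (l *: h) = l * 'd f (l *: v) h by exact: linearZ.
have l1 : l != 0 by rewrite gt_eqF.
apply: (mulfI l1); apply: etrans (esym e2) (etrans e _).
exact: sqr_scale.
Qed.

(** Euler's relation for the 1-homogeneous function ['d f _ h], obtained by differentiating along
    the ray through [v] at parameter 1. *)
Lemma euler1 v h : U v -> gram f v v h = 2^-1 * 'd f v h.
Proof.
move=> Uv; rewrite /gram; congr (_ * _).
have U1 : U ((1 : R) *: v) by rewrite scale1r.
have h1 := hasD_comp (hasD_scalel v 1) (smooth_hasD (smooth_diff h sf) U1).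
have h2 : hasD (fun t : R^o => t *: ('d f v h : R^o)) 1 (fun t => t *: ('d f v h : R^o)).
  apply: (hasD_ext (hasD_scale (hasD_id _) (hasD_cst _ _))) => s.
  by rewrite scaler0 add0r.
have E : \forall t \near (1 : R^o), t *: ('d f v h : R^o) =
    ((fun w => 'd f w h) \o (fun t => t *: v)) t.
  by apply: filterS (near1_gt0 R) => t t0; exact: (esym (diff_hom h t0 Uv)).
have e := hasD_unique h1 (near_eq_hasD E h2) 1.
have s1 : (1 : R) *: v = v by exact: scale1r.
have e2 := etrans e (scale1r ('d f v h : R^o)).
by move: e2; rewrite /comp s1.
Qed.

Lemma gram_hom v e h (l : R) : 0 < l -> U v -> gram f (l *: v) e h = gram f v e h.
Proof.
move=> l0 Uv.
suff E0 : 'd (fun w => 'd f w h) (l *: v) e = 'd (fun w => 'd f w h) v e.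
  exact: (congr1 (fun z : R => 2^-1 * z) E0).
have Ul := coneU l0 Uv.
have h1 := hasD_comp (hasDZ l (hasD_id v)) (smooth_hasD (smooth_diff h sf) Ul).
have h2 := hasDZ l (smooth_hasD (smooth_diff h sf) Uv).
have E : \forall w \near v, (l *: ('d f w h : R^o)) = ((fun w => 'd f w h) \o (fun w => l *: w)) w.
  by apply: (open_near oU Uv) => w Uw; exact: (esym (diff_hom h l0 Uw)).
have e1 := hasD_unique h1 (near_eq_hasD E h2) e.
have e2 : 'd (fun w => 'd f w h) (l *: v) (l *: e) =
    l * 'd (fun w => 'd f w h) (l *: v) e by exact: linearZ.
have l1 : l != 0 by rewrite gt_eqF.
by apply: (mulfI l1); exact: etrans (esym e2) e1.
Qed.

(** The fundamental tensor is constant along the ray through [v], so its derivative in the direction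
    [v] vanishes. This is what removes Cartan terms whenever [v] is inserted. *)
Lemma dgram_hom v e h : U v -> dgram f v v e h = 0.
Proof.
move=> Uv.
have U1 : U ((1 : R) *: v) by rewrite scale1r.
have h1 := hasD_comp (hasD_scalel v 1) (smooth_hasD (gram_smooth e h) U1).
have E : \forall t \near (1 : R^o), (fun=> gram f v e h : R^o) t =
    ((fun w => gram f w e h) \o (fun t => t *: v)) t.
  by apply: filterS (near1_gt0 R) => t t0; exact: (esym (gram_hom e h t0 Uv)).
have e1 := hasD_unique h1 (near_eq_hasD E (hasD_cst _ _)) 1.
have s1 : (1 : R) *: v = v by exact: scale1r.
by move: e1; rewrite /comp s1.
Qed.
End Gram.

(** * Matrix form of the projection onto the complement of a kernel *)

Section HorizontalProjection.
Variables (F : fieldType) (n m : nat).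
Implicit Types (G : 'M[F]_n) (D : 'M[F]_(n, m)).

(** The dual metric evaluated on covectors pulled back along [D]. *)
Definition hgram G D : 'M[F]_m := D^T *m invmx G *m D.

(* Row vectors: [e *m hproj G D] is the [G]-orthogonal projection of [e] onto
   the orthogonal complement of the kernel of [e |-> e *m D]. *)
Definition hproj G D : 'M[F]_n := D *m invmx (hgram G D) *m D^T *m invmx G.

Lemma unitmx_inj k (A : 'M[F]_k) :
  (forall u : 'rV[F]_k, u *m A = 0 -> u = 0) -> A \in unitmx.
Proof.
move=> h; rewrite -row_free_unit; apply/row_freeP.
have k0 : kermx A = 0.
  by apply/row_matrixP => i; rewrite row0; apply: h; rewrite -row_mul mulmx_ker row0.
by apply/row_freeP; rewrite -kermx_eq0 k0.
Qed.

(** If [u] is in the kernel of the Gram matrix, the vector dual to the pulled-back covector [u] lies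
    in the kernel of [D] and is orthogonal to it. Nondegeneracy makes it zero, and surjectivity of
    [D] then makes [u] zero. *)
Lemma hgram_unit G D : G \in unitmx ->
  (forall u : 'rV[F]_m, exists v : 'rV_n, v *m D = u) ->
  (forall w : 'rV[F]_n, w *m D = 0 ->
     (forall u : 'rV_n, u *m D = 0 -> w *m G *m u^T = 0) -> w = 0) ->
  hgram G D \in unitmx.
Proof.
move=> Gu Ds nd; apply: unitmx_inj => u; rewrite /hgram !mulmxA => hu.
have x0 : u *m D^T *m invmx G = 0.
  apply: nd => // w wD; rewrite mulmxKV //.
  by rewrite -mulmxA -trmx_mul wD trmx0 mulmx0.
have uD : u *m D^T = 0 by rewrite -[LHS](mulmxKV Gu) x0 mul0mx.
apply/rowP => i; rewrite mxE.
have [v hv] := Ds (delta_mx 0 i).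
have : (u *m D^T *m v^T) 0 0 = 0 by rewrite uD mul0mx mxE.
rewrite -mulmxA -trmx_mul hv trmx_delta -colE mxE.
by [].
Qed.

Lemma hproj_D G D : hgram G D \in unitmx -> hproj G D *m D = D.
Proof.
by move=> Ku; rewrite /hproj -!mulmxA [D^T *m (_ *m _)]mulmxA mulVmx // mulmx1.
Qed.

Lemma hproj_hor G D (w : 'rV[F]_n) : G \in unitmx -> w *m D = 0 ->
  hproj G D *m G *m w^T = 0.
Proof.
move=> Gu wD; rewrite /hproj mulmxKV // -!mulmxA -trmx_mul wD trmx0.
by rewrite !mulmx0.
Qed.

Lemma hproj_idem G D : hgram G D \in unitmx ->
  hproj G D *m hproj G D = hproj G D.
Proof.
by move=> Ku; rewrite {2}/hproj !mulmxA hproj_D.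
Qed.
End HorizontalProjection.

(** * Smooth families of matrices *)

Section SmoothMatrix.
Variables (R : realType) (V : normedModType R) (U : set V).
Hypothesis oU : open U.

Definition smooth_mx n m (M : V -> 'M[R]_(n, m)) :=
  forall i j, smooth_on U (fun x => M x i j : R^o).

Lemma smooth_mx_cst n m (M : 'M[R]_(n, m)) : smooth_mx (fun=> M).
Proof. by move=> i j; exact: smooth_cst. Qed.

Lemma smooth_mulmx n m p (M : V -> 'M[R]_(n, m)) (N : V -> 'M[R]_(m, p)) :
  smooth_mx M -> smooth_mx N -> smooth_mx (fun x => M x *m N x).
Proof.
move=> hM hN i j.
apply: (@smooth_eq _ _ _ _ (fun x => \sum_k (M x i k * N x k j : R^o))) => //.
  by move=> x _; rewrite mxE.
by apply: smooth_sum => // k; apply: smooth_mul.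
Qed.

Lemma smooth_trmx n m (M : V -> 'M[R]_(n, m)) :
  smooth_mx M -> smooth_mx (fun x => (M x)^T).
Proof.
move=> hM i j; apply: smooth_eq (hM j i) => // x _.
by rewrite mxE.
Qed.

Lemma smooth_det n (M : V -> 'M[R]_n) :
  smooth_mx M -> smooth_on U (fun x => \det (M x) : R^o).
Proof.
move=> hM; apply: smooth_sum => // s.
apply: smooth_mul => //; first exact: smooth_cst.
by apply: smooth_prod => // i; exact: hM.
Qed.

(** Cramer's rule reduces the inverse to determinants. *)
Lemma smooth_invmx n (M : V -> 'M[R]_n) : (forall x, U x -> M x \in unitmx) ->
  smooth_mx M -> smooth_mx (fun x => invmx (M x)).
Proof.
move=> Mu hM i j.
apply: (@smooth_eq _ _ _ _ (fun x => (\det (M x))^-1 *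
   ((-1) ^+ (j + i) * \det (row' j (col' i (M x)))) : R^o)) => //.
  by move=> x Ux; rewrite /invmx Mu // !mxE.
apply: smooth_mul => //.
  apply: smooth_inv => // [x Ux|]; last exact: smooth_det.
  by have := Mu x Ux; rewrite unitmxE unitfE.
apply: smooth_mul => //; first exact: smooth_cst.
apply: smooth_det => k l; apply: smooth_eq (hM (lift j k) (lift i l)) => // x _.
by rewrite !mxE.
Qed.

Lemma smooth_hproj n m (G : V -> 'M[R]_n) (D : V -> 'M[R]_(n, m)) :
  (forall x, U x -> G x \in unitmx) ->
  (forall x, U x -> hgram (G x) (D x) \in unitmx) ->
  smooth_mx G -> smooth_mx D -> smooth_mx (fun x => hproj (G x) (D x)).
Proof.
move=> Gu Ku sG sD.
have sGi := smooth_invmx Gu sG; have sDt := smooth_trmx sD.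
have sK := smooth_mulmx (smooth_mulmx sDt sGi) sD.
exact: (smooth_mulmx (smooth_mulmx (smooth_mulmx sD (smooth_invmx Ku sK)) sDt) sGi).
Qed.

Lemma smooth_mx_rV n (f : V -> 'rV[R]_n) : smooth_mx f -> smooth_on U f.
Proof. by move=> hf; apply: smooth_rV => // i; exact: hf. Qed.

End SmoothMatrix.

Section HasDRow.
Variables (R : realType).

Lemma hasD_rV (V : normedModType R) n (f df : V -> 'rV[R]_n) x :
  (forall i, hasD (fun y => f y 0 i : R^o) x (fun v => df v 0 i : R^o)) ->
  hasD f x df.
Proof.
move=> h.
have e (g : V -> 'rV[R]_n) :
    g = fun y => \sum_i (g y 0 i : R^o) *: (delta_mx 0 i : 'rV[R]_n).
  by apply/funext => y; exact: row_sum_delta.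
rewrite (e f) (e df); apply: hasD_sum => i.
apply: (hasD_ext (hasD_scale (h i) (hasD_cst (delta_mx 0 i : 'rV[R]_n) x))) => v.
by rewrite scaler0 add0r.
Qed.

Lemma hasD_mulmxr (V : normedModType R) n m (M : 'M[R]_(n, m))
    (f df : V -> 'rV[R]_n) x : hasD f x df ->
  hasD (fun y => f y *m M) x (fun v => df v *m M).
Proof.
move=> hf.
have c : continuous (mulmxr M : {linear 'rV[R]_n -> 'rV[R]_m}).
  by apply: linear_continuous; exact: has_basis_rV.
exact: (hasD_comp hf (hasD_lin (f x) c)).
Qed.

Lemma smooth_mulmxr (V : normedModType R) n m (M : 'M[R]_(n, m)) (U : set V)
    (f : V -> 'rV[R]_n) : open U -> smooth_on U f ->
  smooth_on U (fun y => f y *m M).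
Proof.
move=> oU hf; apply: (smooth_lin_comp (l := mulmxr M)) => //.
by apply: linear_continuous; exact: has_basis_rV.
Qed.
End HasDRow.

(** * Isometry on the horizontal vectors of one fiber *)

Section Fiber.
Variables (R : realType) (n m : nat).
Variables (f : 'rV[R]_n -> R^o) (U : set 'rV[R]_n).
Variables (ft : 'rV[R]_m -> R^o) (Ut : set 'rV[R]_m) (D : 'M[R]_(n, m)).
Hypotheses (oU : open U) (sf : smooth_on U f).
Hypothesis nondeg : forall v, U v ->
  forall e, (forall h, gram f v e h = 0) -> e = 0.
Hypothesis vnondeg : forall v, U v -> forall w, w *m D = 0 ->
  (forall u, u *m D = 0 -> gram f v w u = 0) -> w = 0.
Hypothesis Dsurj : forall u : 'rV[R]_m, exists v, v *m D = u.

Definition gmx (v : 'rV[R]_n) : 'M[R]_n :=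
  \matrix_(i, j) gram f v (delta_mx 0 i) (delta_mx 0 j).
Definition hmx v := hproj (gmx v) D.

Lemma gram_gmx v a b : U v -> gram f v a b = (a *m gmx v *m b^T) 0 0.
Proof.
move=> Uv; rewrite (gram_expand oU sf _ _ Uv) mxE.
under [RHS]eq_bigr do rewrite !mxE mulr_suml.
rewrite exchange_big; apply: eq_bigr => i _; apply: eq_bigr => j _.
by rewrite mxE -mulrA [_ * b 0 i]mulrC.
Qed.

Lemma gmx_unit v : U v -> gmx v \in unitmx.
Proof.
move=> Uv; apply: unitmx_inj => u u0; apply: (nondeg Uv) => h.
by rewrite gram_gmx // u0 mul0mx mxE.
Qed.

Lemma hgram_gmx_unit v : U v -> hgram (gmx v) D \in unitmx.
Proof.
move=> Uv; apply: hgram_unit => //; first exact: gmx_unit.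
move=> w wD h; apply: (vnondeg Uv) => // u uD.
by rewrite gram_gmx // h // mxE.
Qed.

Lemma hmx_D v : U v -> hmx v *m D = D.
Proof. by move=> Uv; apply: hproj_D; exact: hgram_gmx_unit. Qed.

Lemma hmx_hor v e w : U v -> w *m D = 0 -> gram f v (e *m hmx v) w = 0.
Proof.
move=> Uv wD; rewrite gram_gmx // -[e *m _ *m _]mulmxA -mulmxA.
by rewrite hproj_hor ?mulmx0 ?mxE //; exact: gmx_unit.
Qed.

Lemma hmx_id v x : U v -> (forall w, w *m D = 0 -> gram f v x w = 0) ->
  x *m hmx v = x.
Proof.
move=> Uv hx; apply/eqP; rewrite -subr_eq0; apply/eqP.
apply: (vnondeg Uv) => [|u uD].
  by rewrite mulmxBl -mulmxA hmx_D // subrr.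
by rewrite (linear_subE (gram_linearl f v u)) hmx_hor // hx // subrr.
Qed.

Lemma gmx_smooth : smooth_mx U gmx.
Proof.
move=> i j; apply: smooth_eq (gram_smooth oU sf (delta_mx 0 i) (delta_mx 0 j)) => //.
by move=> v _; rewrite mxE.
Qed.

Lemma hmx_smooth : smooth_mx U hmx.
Proof.
apply: smooth_hproj => //.
- exact: gmx_unit.
- exact: hgram_gmx_unit.
- exact: gmx_smooth.
- exact: smooth_mx_cst.
Qed.

Hypothesis coneU : forall v (l : R), 0 < l -> U v -> U (l *: v).
Hypothesis homf : forall v (l : R), 0 < l -> U v -> f (l *: v) = l ^+ 2 * f v.

Definition hor v := U v /\ forall w, w *m D = 0 -> gram f v v w = 0.

(* By Euler, the Legendre transform [l w] (half the differential of [f] at [w])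
   is [gram f w w], so [w] is horizontal iff [l w] kills the kernel of [D].
   Hence [Phi], whose differential at [v] is the identity, carries horizontal
   vectors to the kernel of [P], which contains the line [v + t y]; the curve is
   the preimage of that line. *)
Lemma horizontal_curve v y : hor v ->
  (forall w, w *m D = 0 -> gram f v y w = 0) ->
  exists g : R^o -> 'rV[R]_n, [/\ g 0 = v, \forall t \near (0 : R^o), hor (g t) &
    hasD g 0 (fun t : R^o => t *: y)].
Proof.
move=> [Uv hv] hy.
pose l w : 'rV[R]_n := \row_j (2^-1 * 'd f w (delta_mx 0 j)).
pose P := 1%:M - hmx v.
have HP : hmx v *m P = 0.
  by rewrite /P mulmxBr mulmx1 hproj_idem ?subrr //; exact: hgram_gmx_unit.
have PP : P *m P = P by rewrite {1}/P mulmxBl mul1mx HP subr0.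
have lE u w : U u -> l u *m w^T = (gram f u u w)%:M.
  move=> Uu; apply/rowP => i; rewrite !ord1 !mxE eqxx mulr1n.
  rewrite (euler1 oU sf coneU homf w Uu).
  rewrite (linear_expand (f := fun w => 'd f u w : R^o)); last first.
    by move=> a x z; exact: linearP.
  rewrite mulr_sumr; apply: eq_bigr => j _.
  by rewrite !mxE /GRing.scale /= -mulrA [_ * w 0 j]mulrC.
have lv : l v *m invmx (gmx v) = v.
  rewrite -[RHS](mulmxK (gmx_unit Uv)); congr (_ *m _).
  apply/rowP => j; rewrite !mxE -(euler1 oU sf coneU homf _ Uv).
  rewrite (linear_expand (gram_linearl f v _)).
  by apply: eq_bigr => i _; rewrite mxE.
pose Phi w := l w *m (invmx (gmx v) *m P) + w *m hmx v.
have sl : smooth_on U l.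
  apply: smooth_rV => // j.
  apply: (@smooth_eq _ _ _ _ (fun w => 2^-1 * 'd f w (delta_mx 0 j) : R^o)) => //.
    by move=> w _; rewrite mxE.
  by apply: smooth_mul => //; [exact: smooth_cst|exact: smooth_diff].
have idc : continuous (idfun : {linear 'rV[R]_n -> 'rV[R]_n}) by move=> z A.
have sPhi : smooth_on U Phi.
  exact: (smooth_add oU (smooth_mulmxr (invmx (gmx v) *m P) oU sl)
    (smooth_mulmxr (hmx v) oU (smooth_lin oU idc))).
have hl : hasD l v (fun u => u *m gmx v).
  apply: (@hasD_rV _ _ _ l (fun u => u *m gmx v) v) => j.
  have h1 := hasDZ (2^-1) (smooth_hasD (smooth_diff (delta_mx 0 j) sf) Uv).
  have e1 : (fun w => l w 0 j : R^o) = (fun w => 2^-1 *: ('d f w (delta_mx 0 j) : R^o)).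
    by apply/funext => w; rewrite mxE.
  rewrite e1; apply: (hasD_ext h1) => u.
  rewrite -[LHS]/(gram f v u (delta_mx 0 j)) (linear_expand (gram_linearl f v _)).
  by rewrite mxE; apply: eq_bigr => i _; rewrite mxE.
have hPhi : hasD Phi v id.
  have h2 := hasDD (hasD_mulmxr (invmx (gmx v) *m P) hl)
                   (hasD_mulmxr (hmx v) (hasD_id v)).
  apply: (hasD_ext h2) => u.
  rewrite mulmxA mulmxK ?gmx_unit // /P mulmxBr mulmx1.
  by rewrite subrK.
have Phiv : Phi v = v.
  by rewrite /Phi mulmxA lv /P mulmxBr mulmx1 subrK.
have [g [gn g0 hg]] := inverse_function oU Uv (sPhi 1%N) hPhi.2.
rewrite Phiv in gn g0 hg.
exists (fun t => g (v + t *: y)); split.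
- by rewrite scale0r addr0.
- have hline := hasD_continuous (hasD_line v y 0).
  have gn' : \forall z \near v + (0 : R^o) *: y, U (g z) /\ Phi (g z) = z.
    by rewrite scale0r addr0.
  have gn2 : \forall t \near (0 : R^o),
    U (g (v + t *: y)) /\ Phi (g (v + t *: y)) = v + t *: y := hline _ gn'.
  apply: filterS gn2 => t [Ug Pg]; split => // w wD.
  have vP : v *m P = 0 by rewrite /P mulmxBr mulmx1 hmx_id // subrr.
  have yP : y *m P = 0 by rewrite /P mulmxBr mulmx1 hmx_id // subrr.
  (* Applied to [Phi u], this says that [l u] times the inverse Gram matrix at [v] is fixed by
     [hmx v]; it is therefore horizontal at [v], and [l u] kills the kernel of [D]. *)
  have : Phi (g (v + t *: y)) *m P = 0.
    by rewrite Pg mulmxDl -scalemxAl vP yP scaler0 addr0.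
  set u := g _; rewrite /Phi mulmxDl -[_ *m hmx v *m P]mulmxA HP mulmx0 addr0.
  rewrite mulmxA -[_ *m P *m P]mulmxA PP {1}/P mulmxBr mulmx1.
  move=> /eqP; rewrite subr_eq0 => /eqP E.
  have := hmx_hor (l u *m invmx (gmx v)) Uv wD; rewrite -E gram_gmx //.
  by rewrite mulmxKV ?gmx_unit // lE // mxE eqxx mulr1n.
- have hg' : hasD g (v + (0 : R^o) *: y) id by rewrite scale0r addr0.
  exact: (hasD_comp (hasD_line v y 0) hg').
Qed.

Hypotheses (oUt : open Ut) (sft : smooth_on Ut ft).
Hypothesis iso : forall v, hor v -> Ut (v *m D) /\ f v = ft (v *m D).

(** For horizontal [z], the identity [f = ft o D] is differentiated along a horizontal curve. For
    [z] in the kernel of [D] both sides vanish, the left one by Euler's relation and horizontality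
    of [v]. *)
Lemma diff_iso v z : hor v -> 'd f v z = 'd ft (v *m D) (z *m D).
Proof.
move=> hv; have [Uv vv] := hv.
have [Utv _] := iso hv.
have hor_case x : (forall w, w *m D = 0 -> gram f v x w = 0) ->
    'd f v x = 'd ft (v *m D) (x *m D).
  move=> hx; have [g [g0 gn hg]] := horizontal_curve hv hx.
  have Ug0 : U (g 0) by rewrite g0.
  have Utg0 : Ut (g 0 *m D) by rewrite g0.
  have h1 := hasD_comp hg (smooth_hasD sf Ug0).
  have h2 := hasD_comp (hasD_mulmxr D hg) (smooth_hasD sft Utg0).
  have E : \forall t \near (0 : R^o), (f \o g) t = (ft \o (fun t => g t *m D)) t.
    by apply: filterS gn => t /iso[].
  have := hasD_unique (near_eq_hasD E h1) h2 1.
  by rewrite /comp !scale1r g0.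
have zv : (z - z *m hmx v) *m D = 0 by rewrite mulmxBl -mulmxA hmx_D // subrr.
have hz := hor_case (z *m hmx v) (fun w wD => hmx_hor z Uv wD).
have vz : 'd f v (z - z *m hmx v) = 0.
  have := vv _ zv; rewrite (euler1 oU sf coneU homf _ Uv) => /eqP.
  by rewrite mulf_eq0 invr_eq0 pnatr_eq0 /= => /eqP.
have e : z = z *m hmx v + (z - z *m hmx v) by rewrite addrC subrK.
have e2 : z *m hmx v *m D = z *m D by rewrite -mulmxA hmx_D.
rewrite e2 in hz; rewrite {1}e.
by apply: etrans (linearD _ _ _) _; rewrite vz addr0.
Qed.

(** [diff_iso] holds at every horizontal vector and for every [z], so it can be differentiated once
    more along a horizontal curve. Only the velocity [x] of the curve has to be horizontal. *)
Lemma gram_iso v x z : hor v -> (forall w, w *m D = 0 -> gram f v x w = 0) ->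
  gram f v x z = gram ft (v *m D) (x *m D) (z *m D).
Proof.
move=> hv hx; have [Utv _] := iso hv.
have [g [g0 gn hg]] := horizontal_curve hv hx.
have Ug0 : U (g 0) by rewrite g0; exact: hv.1.
have Utg0 : Ut (g 0 *m D) by rewrite g0.
have h1 := hasD_comp hg (smooth_hasD (smooth_diff z sf) Ug0).
have h2 := hasD_comp (hasD_mulmxr D hg) (smooth_hasD (smooth_diff (z *m D) sft) Utg0).
have E : \forall t \near (0 : R^o), ((fun w => 'd f w z) \o g) t =
    ((fun w => 'd ft w (z *m D)) \o (fun t => g t *m D)) t.
  by apply: filterS gn => t; exact: diff_iso.
have := hasD_unique (near_eq_hasD E h1) h2 1.
rewrite /comp !scale1r g0 => e.
exact: (congr1 (fun z : R => 2^-1 * z) e).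
Qed.

(** [gram_iso] needs a horizontal first argument, so [y] is projected anew along the curve. The
    projection [D] of the moving [y] is constant, hence its derivative is vertical and drops out
    against the horizontal [z]. *)
Lemma dgram_iso v x y z : hor v ->
  (forall w, w *m D = 0 -> gram f v x w = 0) ->
  (forall w, w *m D = 0 -> gram f v y w = 0) ->
  (forall w, w *m D = 0 -> gram f v z w = 0) ->
  dgram f v x y z = dgram ft (v *m D) (x *m D) (y *m D) (z *m D).
Proof.
move=> hv hx hy hz; have [Utv _] := iso hv; have Uv := hv.1.
have [g [g0 gn hg]] := horizontal_curve hv hx.
have Ug0 : U (g 0) by rewrite g0.
have Utg0 : Ut (g 0 *m D) by rewrite g0.
have sP : smooth_on U (fun w => y *m hmx w).
  apply: smooth_mx_rV => //; apply: smooth_mulmx => //; last exact: hmx_smooth.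
  exact: smooth_mx_cst.
pose dY := 'd (fun w => y *m hmx w) (g 0) \o (fun t : R^o => t *: x).
have hY : hasD ((fun w => y *m hmx w) \o g) 0 dY :=
  hasD_comp hg (smooth_hasD sP Ug0).
have dYD : dY 1 *m D = 0.
  have h3 := hasD_mulmxr D hY.
  have E : \forall t \near (0 : R^o), (fun=> y *m D) t =
      ((fun w => y *m hmx w) \o g) t *m D.
    by apply: filterS gn => t [Ut' _] /=; rewrite -mulmxA hmx_D.
  exact: (hasD_unique h3 (near_eq_hasD E (hasD_cst _ _)) 1).
have h1 := hasD_gram oU sf Ug0 hg hY (hasD_cst z _).
have h2 := hasD_gram (c := fun t => g t *m D) oUt sft Utg0 (hasD_mulmxr D hg)
  (hasD_cst (y *m D) _) (hasD_cst (z *m D) _).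
have E : \forall t \near (0 : R^o),
    gram f (g t) (((fun w => y *m hmx w) \o g) t) z =
    gram ft (g t *m D) (y *m D) (z *m D).
  apply: filterS gn => t gt /=; rewrite gram_iso //; last first.
    by move=> w; apply: hmx_hor; exact: gt.1.
  by rewrite -mulmxA hmx_D //; exact: gt.1.
have := hasD_unique (near_eq_hasD E h1) h2 1.
rewrite /comp !scale1r g0 hmx_id //.
rewrite (linear_zeroE (gram_linearr oU sf y Uv)).
rewrite (linear_zeroE (gram_linearl ft (v *m D) (z *m D))).
rewrite (linear_zeroE (gram_linearr oUt sft (y *m D) Utv)) !addr0 => <-.
by rewrite -[LHS]addr0 (gramC oU sf _ _ Uv) hz.
Qed.
End Fiber.

(** * Tangent vectors in charts *)

Section Charts.
Variable R : realType.

Lemma smooth_map_id n (M : manifold R n) : smooth_map (id : M -> M).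
Proof.
split; first by move=> x A.
by move=> c c' hc hc'; exact: compatible.
Qed.

Definition rep n m (M : manifold R n) (B : manifold R m) (c : chart R n M)
  (c' : chart R m B) (phi : M -> B) : 'rV[R]_n -> 'rV[R]_m :=
  cfun c' \o phi \o cinv c.

Section OneManifold.
Variables (n : nat) (M : manifold R n).
Implicit Types (c : chart R n M) (U : set M) (q : M).

Lemma ccodP c q : cdom c q -> ccod c (cfun c q).
Proof. by move=> qc; exists q. Qed.

Lemma ccod_inv c x : ccod c x -> cdom c (cinv c x) /\ cfun c (cinv c x) = x.
Proof. by move=> [q qc <-]; rewrite cfunK. Qed.

Lemma chart_open c U : open U -> open [set x | ccod c x /\ U (cinv c x)].
Proof.
move=> oU; rewrite openE => x [cx Ux]; apply: filterI.
  by apply: open_nbhs_nbhs; split => //; exact: cimg_open.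
by apply: (cinv_cont cx); exact: open_nbhs_nbhs.
Qed.

Lemma near_chart c q (P : M -> Prop) : cdom c q -> (\forall q' \near q, P q') ->
  \forall x \near cfun c q, P (cinv c x).
Proof.
move=> qc hP; apply: (cinv_cont (ccodP qc)).
by rewrite cfunK.
Qed.

Lemma near_ccod c q : cdom c q -> \forall x \near cfun c q, ccod c x.
Proof.
by move=> qc; apply: open_nbhs_nbhs; split; [exact: cimg_open|exact: ccodP].
Qed.

Lemma near_cdom c q : cdom c q -> \forall q' \near q, cdom c q'.
Proof. by move=> qc; apply: open_nbhs_nbhs; split => //; exact: cdom_open. Qed.

Lemma near_pull c q (P : 'rV[R]_n -> Prop) : cdom c q ->
  (\forall x \near cfun c q, P x) -> \forall q' \near q, P (cfun c q').
Proof. by move=> qc; exact: (cfun_cont qc). Qed.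
End OneManifold.

Lemma rep_open n m (M : manifold R n) (B : manifold R m)
    (c : chart R n M) (c' : chart R m B) (phi : M -> B) :
  continuous phi -> open [set x | ccod c x /\ cdom c' (phi (cinv c x))].
Proof.
move=> cphi; have o : open (phi @^-1` cdom c').
  by apply: open_comp; [move=> q _; exact: cphi|exact: cdom_open].
exact: (chart_open o).
Qed.

Lemma rep_hasD n m (M : manifold R n) (B : manifold R m)
    (c : chart R n M) (c' : chart R m B) (phi : M -> B) q :
  smooth_map phi -> atlas c -> atlas c' -> cdom c q -> cdom c' (phi q) ->
  hasD (rep c c' phi) (cfun c q) ('d (rep c c' phi) (cfun c q)).
Proof.
move=> [_ sphi] hc hc' qc qc'; apply: (smooth_hasD (sphi _ _ hc hc')).
by split; [exact: ccodP|rewrite cfunK].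
Qed.

(** Both [tcoord] and [tvec] are differentials of representatives of the identity, and [dmap] is one
    of [phi]. Every rule for changing coordinates of tangent vectors is thus an instance of this
    chain rule. *)
Lemma rep_comp n m k (M : manifold R n) (B : manifold R m) (N : manifold R k)
    (c : chart R n M) (c' : chart R m B) (c'' : chart R k N)
    (phi : M -> B) (psi : B -> N) q v :
  smooth_map phi -> smooth_map psi -> atlas c -> atlas c' -> atlas c'' ->
  cdom c q -> cdom c' (phi q) -> cdom c'' (psi (phi q)) ->
  'd (rep c c'' (psi \o phi)) (cfun c q) v =
  'd (rep c' c'' psi) (cfun c' (phi q)) ('d (rep c c' phi) (cfun c q) v).
Proof.
move=> sphi spsi hc hc' hc'' qc qc' qc''.
have h1 := rep_hasD sphi hc hc' qc qc'.
have e : rep c c' phi (cfun c q) = cfun c' (phi q) by rewrite /rep /= cfunK.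
have h2 := rep_hasD spsi hc' hc'' qc' qc''.
rewrite -e in h2.
have E : \forall x \near cfun c q,
    (rep c' c'' psi \o rep c c' phi) x = rep c c'' (psi \o phi) x.
  have : \forall q' \near q, cdom c' (phi q').
    by apply: (sphi.1 q); exact: near_cdom.
  move=> /(near_chart qc); apply: filterS => x hx.
  by rewrite /rep /= cfunK.
have [_ h] := near_eq_hasD E (hasD_comp h1 h2).
by rewrite -e; exact: h.
Qed.

Lemma rep_id n (M : manifold R n) (c : chart R n M) q v :
  cdom c q -> 'd (rep c c id) (cfun c q) v = v.
Proof.
move=> qc.
have E : \forall x \near cfun c q, id x = rep c c id x.
  by apply: filterS (near_ccod qc) => x /ccod_inv[_]; rewrite /rep /= => ->.
by have [_ ->] := near_eq_hasD E (hasD_id _).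
Qed.

Section Coordinates.
Variables (n : nat) (M : manifold R n).
Implicit Types (c : chart R n M) (U : set M) (q : M).

Let atl q : atlas (chart_at q) := chart_at_atlas q.
Let dom q : cdom (chart_at q) q := chart_at_dom q.
Let sid := smooth_map_id M.

Lemma tcoord_trans c c' q v : atlas c -> atlas c' -> cdom c q -> cdom c' q ->
  tcoord c' q v = 'd (rep c c' id) (cfun c q) (tcoord c q v).
Proof.
move=> hc hc' qc qc'.
exact: (rep_comp v sid sid (atl q) hc hc' (dom q) qc qc').
Qed.

Lemma tcoordK c q v : atlas c -> cdom c q -> tvec c q (tcoord c q v) = v.
Proof.
move=> hc qc.
have e := rep_comp v sid sid (atl q) hc (atl q) (dom q) qc (dom q).
exact: etrans (esym e) (rep_id v (dom q)).
Qed.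

Lemma tvecK c q v : atlas c -> cdom c q -> tcoord c q (tvec c q v) = v.
Proof.
move=> hc qc.
have e := rep_comp v sid sid hc (atl q) hc qc (dom q) qc.
exact: etrans (esym e) (rep_id v qc).
Qed.

Lemma tcoord_at q v : tcoord (chart_at q) q v = v.
Proof. exact: (rep_id v (dom q)). Qed.

Lemma tvec_at q v : tvec (chart_at q) q v = v.
Proof. exact: (rep_id v (dom q)). Qed.

Lemma tcoord_linear c q : linear (tcoord c q).
Proof. by move=> a u v; exact: linearP. Qed.

Lemma tvec_linear c q : linear (tvec c q).
Proof. by move=> a u v; exact: linearP. Qed.

(** Compatibility of charts carries smoothness from the one chart [c] to the whole atlas, since [U]
    lies in its domain. *)
Lemma smooth_fun_chart c U (f : M -> R) : atlas c -> open U -> U `<=` cdom c ->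
  smooth_on [set x | ccod c x /\ U (cinv c x)] (f \o cinv c : _ -> R^o) ->
  smooth_fun U f.
Proof.
move=> hc oU Uc sf c' hc'.
have o' := chart_open (c := c') oU; have o := chart_open (c := c) oU.
have st : smooth_on [set x | ccod c' x /\ U (cinv c' x)] (rep c' c id).
  by apply: smooth_subset (compatible hc' hc) => x [? /Uc]; split.
apply: (@smooth_eq _ _ _ _ ((f \o cinv c : _ -> R^o) \o rep c' c id)) => //.
  by move=> x [cx /Uc Ux]; rewrite /rep /= cfunK.
apply: smooth_comp st sf => //; first exact: has_basis_rV.
move=> x [cx Ux]; have qc := Uc _ Ux.
by rewrite /rep; split => /=; [exact: ccodP|rewrite cfunK].
Qed.

Definition coord_field c (X : vfield M) (x : 'rV[R]_n) :=
  tcoord c (cinv c x) (X (cinv c x)).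

(** As for functions, but the Jacobian of the chart change acts on components that move with the
    point, hence the sum over the standard basis. *)
Lemma smooth_vfield_chart c U (X : vfield M) : atlas c -> open U -> U `<=` cdom c ->
  smooth_on [set x | ccod c x /\ U (cinv c x)] (coord_field c X) ->
  smooth_vfield U X.
Proof.
move=> hc oU Uc sX c' hc'.
have o' := chart_open (c := c') oU; have o := chart_open (c := c) oU.
have st : smooth_on [set x | ccod c' x /\ U (cinv c' x)] (rep c' c id).
  by apply: smooth_subset (compatible hc' hc) => x [? /Uc]; split.
have maps x : [set x | ccod c' x /\ U (cinv c' x)] x ->
    [set x | ccod c x /\ U (cinv c x)] (rep c' c id x).
  move=> [cx Ux]; have qc := Uc _ Ux.
  by rewrite /rep; split => /=; [exact: ccodP|rewrite cfunK].
have oW : open [set x | ccod c x /\ cdom c' (cinv c x)].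
  by apply: chart_open; exact: cdom_open.
have st2 : smooth_on [set x | ccod c x /\ cdom c' (cinv c x)] (rep c c' id).
  exact: compatible.
apply: (@smooth_eq _ _ _ _ (fun x => \sum_j
   (coord_field c X (rep c' c id x) 0 j : R^o) *:
   ((fun y => 'd (rep c c' id) y (delta_mx 0 j)) \o rep c' c id) x)) => //.
  move=> x [cx Ux]; have qc := Uc _ Ux.
  have [qc' e] := ccod_inv cx.
  rewrite (tcoord_trans _ hc hc' qc qc').
  apply: etrans _ (esym (hasD_basis (rep c c' id) _ _ (rV_is_basis R n))).
  have -> : coord_field c X (rep c' c id x) = tcoord c (cinv c' x) (X (cinv c' x)).
    by rewrite /coord_field /rep /comp cfunK.
  exact: eq_bigr.
apply: smooth_sum => // j; apply: smooth_scale => //.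
  apply: smooth_coord => //; apply: (smooth_comp _ o' o maps st sX).
  exact: has_basis_rV.
apply: (smooth_comp _ o' oW _ st (smooth_diff _ st2)).
  exact: has_basis_rV.
move=> x [cx Ux]; have qc := Uc _ Ux; have [qc' e] := ccod_inv cx.
by rewrite /rep; split => /=; [exact: ccodP|rewrite cfunK].
Qed.

Lemma smooth_vfield_subset U U' (X : vfield M) : U' `<=` U ->
  smooth_vfield U X -> smooth_vfield U' X.
Proof.
by move=> s sX c hc; apply: smooth_subset (sX c hc) => x [? /s]; split.
Qed.

Lemma coord_field_at p (X : vfield M) :
  coord_field (chart_at p) X (cfun (chart_at p) p) = X p.
Proof. by rewrite /coord_field cfunK ?tcoord_at. Qed.

Lemma extend_at (p : M) e : extend p e p = e.
Proof. exact: tvec_at. Qed.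

Lemma coord_field_extend (p : M) e x : ccod (chart_at p) x ->
  coord_field (chart_at p) (extend p e) x = e.
Proof. by move=> /ccod_inv[xc _]; rewrite /coord_field /extend tvecK. Qed.

Lemma smooth_extend (p : M) e : smooth_vfield (cdom (chart_at p)) (extend p e).
Proof.
have od := @cdom_open _ _ _ (chart_at p).
apply: (smooth_vfield_chart (atl p) od) => //.
apply: (@smooth_eq _ _ _ _ (fun=> e)) => [|x [cx _]|].
- exact: chart_open.
- by rewrite coord_field_extend.
- by apply: smooth_cst; exact: chart_open.
Qed.
End Coordinates.

Lemma dmap_coord n m (M : manifold R n) (B : manifold R m)
    (c : chart R n M) (c' : chart R m B) (phi : M -> B) q v :
  smooth_map phi -> atlas c -> atlas c' -> cdom c q -> cdom c' (phi q) ->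
  tcoord c' (phi q) (dmap phi q v) =
  'd (rep c c' phi) (cfun c q) (tcoord c q v).
Proof.
move=> sphi hc hc' qc qc'.
have e1 := rep_comp v sphi (smooth_map_id B) (chart_at_atlas q)
  (chart_at_atlas (phi q)) hc' (chart_at_dom q) (chart_at_dom (phi q)) qc'.
have e2 := rep_comp v (smooth_map_id M) sphi (chart_at_atlas q) hc hc'
  (chart_at_dom q) qc qc'.
exact: etrans (esym e1) e2.
Qed.

Lemma dmap_linear n m (M : manifold R n) (B : manifold R m) (phi : M -> B) q :
  linear (dmap phi q).
Proof. by move=> a u v; exact: linearP. Qed.
End Charts.

(** * Anisotropic connections in charts *)

Section Connections.
Variables (R : realType) (n : nat) (M : manifold R n).
Implicit Types (U : set M) (E H X : vfield M).

Lemma smooth_vfield0 U : open U -> smooth_vfield U (fun=> 0 : 'rV[R]_n).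
Proof.
move=> oU c hc.
apply: (@smooth_eq _ _ _ _ (fun=> 0)) => [|x _|]; first exact: chart_open.
  by rewrite (linear_zeroE (tcoord_linear c (cinv c x))).
by apply: smooth_cst; exact: chart_open.
Qed.

Lemma smooth_vfieldD U X X' : open U -> smooth_vfield U X -> smooth_vfield U X' ->
  smooth_vfield U (fun q => X q + X' q).
Proof.
move=> oU sX sX' c hc; have o := chart_open (c := c) oU.
apply: (smooth_eq o _ (smooth_add o (sX c hc) (sX' c hc))) => x _.
by rewrite (linear_addE (tcoord_linear c (cinv c x))).
Qed.

Lemma smooth_vfieldZ U (f : M -> R) X : open U -> smooth_fun U f ->
  smooth_vfield U X -> smooth_vfield U (fun q => f q *: X q).
Proof.
move=> oU sf sX c hc; have o := chart_open (c := c) oU.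
apply: (smooth_eq o _ (smooth_scale o (sf c hc) (sX c hc))) => x _.
by rewrite (linear_scaleE (tcoord_linear c (cinv c x))).
Qed.

Lemma smooth_vfield_sum U (I : Type) (r : seq I) (X : I -> vfield M) : open U ->
  (forall i, smooth_vfield U (X i)) ->
  smooth_vfield U (fun q => \sum_(i <- r) X i q).
Proof.
move=> oU sX; elim: r => [|i r IH].
  have -> : (fun q => \sum_(i <- [::]) X i q) = fun=> 0.
    by apply/funext => q; rewrite big_nil.
  exact: smooth_vfield0.
have -> : (fun q => \sum_(i <- i :: r) X i q) =
    fun q => X i q + (fun q => \sum_(i <- r) X i q) q.
  by apply/funext => q; rewrite big_cons.
exact: smooth_vfieldD.
Qed.

Lemma coord_smooth_fun p U X i : open U -> U `<=` cdom (chart_at p) ->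
  smooth_vfield U X ->
  smooth_fun U (fun q => tcoord (chart_at p) q (X q) 0 i).
Proof.
move=> oU Up sX; apply: (smooth_fun_chart (chart_at_atlas p) oU Up).
apply: (@smooth_coord _ _ _ _ (coord_field (chart_at p) X)).
  exact: chart_open.
exact: (sX _ (chart_at_atlas p)).
Qed.

Lemma field_expand p X q : cdom (chart_at p) q ->
  X q = \sum_i tcoord (chart_at p) q (X q) 0 i *: extend p (delta_mx 0 i) q.
Proof.
move=> qp; rewrite -[LHS](tcoordK _ (chart_at_atlas p) qp).
exact: (linear_expand (tvec_linear (chart_at p) q)).
Qed.

Definition indic U (q : M) : R := if `[< U q >] then 1 else 0.

Lemma indic_in U q : U q -> indic U q = 1.
Proof. by move=> Uq; rewrite /indic asboolT. Qed.

Lemma indic_out U q : ~ U q -> indic U q = 0.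
Proof. by move=> Uq; rewrite /indic asboolF. Qed.

Lemma smooth_indic U : open U -> smooth_fun U (indic U).
Proof.
move=> oU c hc; have o := chart_open (c := c) oU.
apply: (smooth_eq o _ (smooth_cst (1 : R^o) o)) => x [_ Ux].
by rewrite /= indic_in.
Qed.

Lemma dfun_indic U p e : open U -> U p -> dfun (indic U) p e = 0.
Proof.
move=> oU Up; have pc := chart_at_dom p.
have E : \forall x \near cfun (chart_at p) p,
    (fun=> 1 : R^o) x = (indic U \o cinv (chart_at p)) x.
  have := near_chart pc (open_near oU Up (fun q Uq => Uq)).
  by apply: filterS => x Ux; rewrite /= indic_in.
exact: ((near_eq_hasD E (hasD_cst _ _)).2 e).
Qed.

Lemma indic_eq U X X' : (forall q, U q -> X q = X' q) ->
  (fun q => indic U q *: X q) = (fun q => indic U q *: X' q).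
Proof.
move=> e; apply/funext => q; have [Uq|Uq] := pselect (U q); first by rewrite e.
by rewrite indic_out // !scale0r.
Qed.

Variables (A : M -> set 'rV[R]_n) (nabla : connection M).
Hypothesis hconn : aniso_connection A nabla.

(* Fields that agree on a neighbourhood agree everywhere after multiplication
   by its indicator, which is a locally smooth function. *)
Lemma nabla_local_r U E H H' p v : open U -> U p -> A p v ->
  smooth_vfield U E -> smooth_vfield U H -> smooth_vfield U H' ->
  (forall q, U q -> H q = H' q) -> nabla E H p v = nabla E H' p v.
Proof.
move=> oU Up Av sE sH sH' e.
have h X : smooth_vfield U X ->
    nabla E (fun q => indic U q *: X q) p v = nabla E X p v.
  move=> sX; rewrite (ac_leibniz hconn oU Up Av (smooth_indic oU) sE sX).
  by rewrite dfun_indic // scale0r add0r indic_in // scale1r.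
by rewrite -(h H) // -(h H') // (indic_eq e).
Qed.

Lemma nabla_local_l U E E' H p v : open U -> U p -> A p v ->
  smooth_vfield U E -> smooth_vfield U E' -> smooth_vfield U H ->
  (forall q, U q -> E q = E' q) -> nabla E H p v = nabla E' H p v.
Proof.
move=> oU Up Av sE sE' sH e.
have h X : smooth_vfield U X ->
    nabla (fun q => indic U q *: X q) H p v = nabla X H p v.
  move=> sX; rewrite (ac_mull hconn oU Up Av (smooth_indic oU) sX sH).
  by rewrite indic_in // scale1r.
by rewrite -(h E) // -(h E') // (indic_eq e).
Qed.

Lemma nabla0r U E p v : open U -> U p -> A p v -> smooth_vfield U E ->
  nabla E (fun=> 0) p v = 0.
Proof.
move=> oU Up Av sE; have s0 := smooth_vfield0 oU.
have := ac_addr hconn oU Up Av sE s0 s0.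
under [fun q => _ + _]eq_fun do rewrite addr0.
move=> /eqP; rewrite -subr_eq0 opprD addrA subrr sub0r oppr_eq0.
by move=> /eqP.
Qed.

Lemma nabla_sumr U E p v (I : Type) (r : seq I) (f : I -> M -> R)
    (X : I -> vfield M) : open U -> U p -> A p v -> smooth_vfield U E ->
  (forall i, smooth_fun U (f i)) -> (forall i, smooth_vfield U (X i)) ->
  nabla E (fun q => \sum_(i <- r) f i q *: X i q) p v =
  \sum_(i <- r) (dfun (f i) p (E p) *: X i p + f i p *: nabla E (X i) p v).
Proof.
move=> oU Up Av sE sf sX.
have sfX i := smooth_vfieldZ oU (sf i) (sX i).
elim: r => [|i r IH].
  have -> : (fun q => \sum_(i <- [::]) f i q *: X i q) = fun=> 0.
    by apply/funext => q; rewrite big_nil.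
  by rewrite big_nil; exact: nabla0r oU Up Av sE.
have -> : (fun q => \sum_(i <- i :: r) f i q *: X i q) =
    fun q => (fun q => f i q *: X i q) q + (fun q => \sum_(i <- r) f i q *: X i q) q.
  by apply/funext => q; rewrite big_cons.
rewrite (ac_addr hconn oU Up Av sE (sfX i) (smooth_vfield_sum r oU sfX)) IH.
by rewrite (ac_leibniz hconn oU Up Av (sf i) sE (sX i)) big_cons.
Qed.

Lemma nabla_suml U H p v (I : Type) (r : seq I) (f : I -> M -> R)
    (X : I -> vfield M) : open U -> U p -> A p v -> smooth_vfield U H ->
  (forall i, smooth_fun U (f i)) -> (forall i, smooth_vfield U (X i)) ->
  nabla (fun q => \sum_(i <- r) f i q *: X i q) H p v =
  \sum_(i <- r) f i p *: nabla (X i) H p v.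
Proof.
move=> oU Up Av sH sf sX.
have sfX i := smooth_vfieldZ oU (sf i) (sX i).
elim: r => [|i r IH].
  have -> : (fun q => \sum_(i <- [::]) f i q *: X i q) = fun=> 0.
    by apply/funext => q; rewrite big_nil.
  have s0 := smooth_vfield0 oU.
  have := ac_addl hconn oU Up Av s0 s0 sH.
  under [fun q => _ + _]eq_fun do rewrite addr0.
  rewrite big_nil => /eqP; rewrite -subr_eq0 opprD addrA subrr sub0r oppr_eq0.
  by move=> /eqP.
have -> : (fun q => \sum_(i <- i :: r) f i q *: X i q) =
    fun q => (fun q => f i q *: X i q) q + (fun q => \sum_(i <- r) f i q *: X i q) q.
  by apply/funext => q; rewrite big_cons.
rewrite (ac_addl hconn oU Up Av (sfX i) (smooth_vfield_sum r oU sfX) sH) IH.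
by rewrite (ac_mull hconn oU Up Av (sf i) (sX i) sH) big_cons.
Qed.

(** The Christoffel symbols in [chart_at p] at the direction [v], contracted with [e] and [h]. *)
Definition christoffel p v (e h : 'rV[R]_n) : 'rV[R]_n :=
  \sum_i h 0 i *: (\sum_j e 0 j *:
    nabla (extend p (delta_mx 0 j)) (extend p (delta_mx 0 i)) p v).

Lemma christoffel_linearr p v e : linear (christoffel p v e).
Proof.
move=> a x y; rewrite /christoffel scaler_sumr -big_split; apply: eq_bigr => i _ /=.
by rewrite !mxE scalerDl scalerA.
Qed.

(** By locality both fields may be replaced by their expansions in the coordinate fields of
    [chart_at p], to which linearity and the Leibniz rule apply. *)
Lemma nablaE U E H p v : open U -> U p -> A p v ->
  smooth_vfield U E -> smooth_vfield U H ->
  nabla E H p v =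
    'd (coord_field (chart_at p) H) (cfun (chart_at p) p) (E p)
    + christoffel p v (E p) (H p).
Proof.
move=> oU Up Av sE sH.
have pc := chart_at_dom p; have oc := @cdom_open _ _ _ (chart_at p).
pose U' := U `&` cdom (chart_at p).
have oU' : open U' by exact: openI.
have U'p : U' p by split.
have U'c : U' `<=` cdom (chart_at p) by move=> q [].
have U'U : U' `<=` U by move=> q [].
have {}sE := smooth_vfield_subset U'U sE.
have {}sH := smooth_vfield_subset U'U sH.
pose d i := extend p (delta_mx 0 i) : vfield M.
have sd i : smooth_vfield U' (d i).
  by apply: smooth_vfield_subset U'c _; exact: smooth_extend.
have sco X i : smooth_vfield U' X ->
    smooth_fun U' (fun q => tcoord (chart_at p) q (X q) 0 i).
  exact: coord_smooth_fun.
pose X' X q := \sum_i tcoord (chart_at p) q (X q) 0 i *: d i q.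
have sX' X : smooth_vfield U' X -> smooth_vfield U' (X' X).
  move=> sX; apply: smooth_vfield_sum => // i; apply: smooth_vfieldZ => //.
  exact: sco.
have XX' X q : U' q -> X q = X' X q.
  by move=> Uq; apply: field_expand; exact: U'c.
rewrite (nabla_local_r oU' U'p Av sE sH (sX' _ sH) (XX' H)).
rewrite (nabla_sumr _ oU' U'p Av sE (fun i => sco H i sH) sd) big_split /=.
congr (_ + _).
  rewrite [RHS]row_sum_delta; apply: eq_bigr => i _.
  rewrite /d extend_at; congr (_ *: _).
  have hH : hasD (coord_field (chart_at p) H) (cfun (chart_at p) p)
      ('d (coord_field (chart_at p) H) (cfun (chart_at p) p)).
    apply: (smooth_hasD (sH _ (chart_at_atlas p))).
    by split; [exact: ccodP|rewrite cfunK].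
  exact: ((hasD_comp hH (hasD_lin _ (@coordf_continuous R n i))).2 (E p)).
apply: eq_bigr => i _; rewrite tcoord_at; congr (_ *: _).
rewrite (nabla_local_l oU' U'p Av sE (sX' _ sE) (sd i) (XX' E)).
rewrite (nabla_suml _ oU' U'p Av (sd i) (fun i => sco E i sE) sd).
by apply: eq_bigr => j _; rewrite tcoord_at.
Qed.

Lemma nabla_extend p v e h : A p v ->
  nabla (extend p e) (extend p h) p v = christoffel p v e h.
Proof.
move=> Av; have pc := chart_at_dom p; have oc := @cdom_open _ _ _ (chart_at p).
rewrite (nablaE oc pc Av (smooth_extend (M := M) p e) (smooth_extend (M := M) p h)).
rewrite !extend_at -[RHS]add0r; congr (_ + _).
have E : \forall x \near cfun (chart_at p) p,
    (fun=> h) x = coord_field (chart_at p) (extend p h) x.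
  by apply: filterS (near_ccod pc) => x cx; rewrite coord_field_extend.
exact: ((near_eq_hasD E (hasD_cst _ _)).2 e).
Qed.

(** Coordinate fields have zero bracket, so vanishing torsion becomes symmetry. *)
Lemma christoffelC p v e h : A p v ->
  (forall (U : set M) (E H : vfield M) p v, open U -> U p -> A p v ->
    smooth_vfield U E -> smooth_vfield U H ->
    nabla E H p v - nabla H E p v = bracket E H p) ->
  christoffel p v e h = christoffel p v h e.
Proof.
move=> Av tor; have pc := chart_at_dom p; have oc := @cdom_open _ _ _ (chart_at p).
rewrite -!nabla_extend //; apply/eqP; rewrite -subr_eq0; apply/eqP.
rewrite (tor _ _ _ _ _ oc pc Av (smooth_extend (M := M) p e) (smooth_extend (M := M) p h)).
have E k : \forall x \near cfun (chart_at p) p,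
    (fun=> k) x = coord_field (chart_at p) (extend p k) x.
  by apply: filterS (near_ccod pc) => x cx; rewrite coord_field_extend.
have d0 k u : 'd (coord_field (chart_at p) (extend p k)) (cfun (chart_at p) p) u = 0.
  exact: ((near_eq_hasD (E k) (hasD_cst _ _)).2 u).
exact: (etrans (f_equal2 (fun x y => x - y) (d0 _ _) (d0 _ _)) (subrr _)).
Qed.
End Connections.

Lemma second_derivative_congr (R : realType) (f1 f2 : R -> R -> R^o) :
  (forall s t, f1 s t = f2 s t) ->
  2^-1 * derive1 (fun s : R => derive1 (fun t : R => f1 s t) 0 : R^o) 0 =
  2^-1 * derive1 (fun s : R => derive1 (fun t : R => f2 s t) 0 : R^o) 0.
Proof.
move=> e; have -> // : f1 = f2.
by apply/funext => s; apply/funext => t.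
Qed.

(** * Metrics in the induced charts of the tangent bundle *)

Section MetricCharts.
Variables (R : realType) (n : nat) (M : manifold R n).
Variables (A : M -> set 'rV[R]_n) (L : M -> 'rV[R]_n -> R).
Hypothesis pf : pseudo_finsler A L.

Definition Lchart (c : chart R n M) (z : 'rV[R]_n * 'rV[R]_n) : R^o :=
  L (cinv c z.1) (tvec c (cinv c z.1) z.2).

(** Only the fiber directions [(0, e)] and [(0, h)] are differentiated, but the result is a smooth
    function of base point and fiber vector jointly. *)
Definition gramc (c : chart R n M) e h (z : 'rV[R]_n * 'rV[R]_n) : R^o :=
  2^-1 * 'd (fun z => 'd (Lchart c) z (0, h)) z (0, e).

Variable c : chart R n M.
Hypothesis hc : atlas c.

Let oO : open (tchart c A) := pf_open pf hc.
Let sL : smooth_on (tchart c A) (Lchart c) := pf_smooth pf hc.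

Lemma gramc_smooth e h : smooth_on (tchart c A) (gramc c e h).
Proof.
apply: smooth_mul => //; first exact: smooth_cst.
exact: smooth_diff (smooth_diff _ sL).
Qed.

Lemma hasD_pairr (x w : 'rV[R]_n) :
  hasD (fun w : 'rV[R]_n => (x, w)) w (fun u => (0, u)).
Proof. exact: (hasD_pair (hasD_cst x w) (hasD_id w)). Qed.

Lemma hasD_pairl (x w : 'rV[R]_n) :
  hasD (fun x : 'rV[R]_n => (x, w)) x (fun u => (u, 0)).
Proof. exact: (hasD_pair (hasD_id x) (hasD_cst w x)). Qed.

Lemma smooth_idrV (U : set 'rV[R]_n) : open U -> smooth_on U (fun w => w).
Proof.
move=> oU; have idc : continuous (idfun : {linear 'rV[R]_n -> 'rV[R]_n}) by move=> z B.
exact: (smooth_lin oU idc).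
Qed.

Lemma has_basis_pair_rV : has_basis ('rV[R]_n * 'rV[R]_n)%type.
Proof. by apply: has_basis_pair; exact: has_basis_rV. Qed.

Lemma fiber_chart_open x : open [set w | tchart c A (x, w)].
Proof.
have -> : [set w | tchart c A (x, w)] = (fun w => (x, w)) @^-1` tchart c A by [].
apply: open_comp => // w _; exact: hasD_continuous (hasD_pairr x w).
Qed.

Lemma fiber_chart_smooth x :
  smooth_on [set w | tchart c A (x, w)] (fun w => Lchart c (x, w)).
Proof.
have o := fiber_chart_open (x := x).
apply: (smooth_comp has_basis_pair_rV o oO (f := fun w => (x, w)) _ _ sL) => //.
by apply: smooth_pair => //; [exact: smooth_cst|exact: smooth_idrV].
Qed.

Lemma gram_chart x w e h : tchart c A (x, w) ->
  gram (fun w => Lchart c (x, w)) w e h = gramc c e h (x, w).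
Proof.
move=> Ow; have o := fiber_chart_open (x := x).
have d1 w' u : tchart c A (x, w') ->
    'd (fun w => Lchart c (x, w)) w' u = 'd (Lchart c) (x, w') (0, u).
  move=> Ow'.
  exact: ((hasD_comp (hasD_pairr x w') (smooth_hasD sL Ow')).2 u).
have E : \forall w' \near w, 'd (Lchart c) (x, w') (0, h) =
    'd (fun w => Lchart c (x, w)) w' h.
  by apply: (open_near o Ow) => w' Ow'; exact: (esym (d1 w' h Ow')).
have h1 := hasD_comp (hasD_pairr x w) (smooth_hasD (smooth_diff (0, h) sL) Ow).
have [_ h2] := near_eq_hasD E h1.
exact: (congr1 (fun z : R => 2^-1 * z) (h2 e)).
Qed.

Lemma tchart_in q v : cdom c q -> tchart c A (cfun c q, v) <-> A q (tvec c q v).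
Proof.
move=> qc; rewrite /tchart /= cfunK //; split=> [[]//|h]; split => //.
exact: ccodP.
Qed.

Lemma fund_chart q v e h : cdom c q -> A q (tvec c q v) ->
  fund L q (tvec c q v) (tvec c q e) (tvec c q h) =
  gramc c e h (cfun c q, v).
Proof.
move=> qc Av; have Ov := (tchart_in v qc).2 Av.
rewrite -(gram_chart _ _ Ov).
rewrite -(fund_gram (fiber_chart_open (x := cfun c q)) (fiber_chart_smooth (cfun c q)) _ _ Ov).
apply: (second_derivative_congr (f1 := fun s t : R =>
  L q (tvec c q v + s *: tvec c q e + t *: tvec c q h))) => s t.
rewrite /Lchart /= cfunK // !(linear_addE (tvec_linear c q)).
by rewrite !(linear_scaleE (tvec_linear c q)).
Qed.

Lemma fund_chart_expand q v e h : cdom c q -> A q (tvec c q v) ->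
  fund L q (tvec c q v) (tvec c q e) (tvec c q h) =
  \sum_i \sum_j e 0 i * (h 0 j *
    gramc c (delta_mx 0 i) (delta_mx 0 j) (cfun c q, v)).
Proof.
move=> qc Av; have Ov := (tchart_in v qc).2 Av.
rewrite fund_chart // -(gram_chart _ _ Ov).
rewrite (gram_expand (fiber_chart_open (x := cfun c q)) (fiber_chart_smooth (cfun c q)) _ _ Ov).
by apply: eq_bigr => i _; apply: eq_bigr => j _; rewrite (gram_chart _ _ Ov).
Qed.

(** Provides the differentiability of [g_V(E, H)] as a function on the manifold, which the metric
    identity, a formula for its differential, does not state by itself. *)
Lemma fund_field_smooth U (V E H : vfield M) : open U -> U `<=` cdom c ->
  smooth_vfield U V -> (forall q, U q -> A q (V q)) ->
  smooth_vfield U E -> smooth_vfield U H ->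
  smooth_on [set x | ccod c x /\ U (cinv c x)]
    (fun x => fund L (cinv c x) (V (cinv c x)) (E (cinv c x)) (H (cinv c x)) : R^o).
Proof.
move=> oU Uc sV AV sE sH; have o := chart_open (c := c) oU.
have sz : smooth_on [set x | ccod c x /\ U (cinv c x)] (fun x => (x, coord_field c V x)).
  by apply: smooth_pair => //; [exact: smooth_idrV|exact: sV].
have mz x : [set x | ccod c x /\ U (cinv c x)] x ->
    tchart c A (x, coord_field c V x).
  move=> [cx Ux]; split => //=; rewrite tcoordK //; [exact: AV|exact: Uc].
apply: (@smooth_eq _ _ _ _ (fun x => \sum_i \sum_j coord_field c E x 0 i *
   (coord_field c H x 0 j * (gramc c (delta_mx 0 i) (delta_mx 0 j) \o
      (fun x => (x, coord_field c V x))) x) : R^o)) => //.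
  move=> x [cx Ux]; have [qc e] := ccod_inv cx.
  have tK X : tvec c (cinv c x) (coord_field c X x) = X (cinv c x) by rewrite tcoordK.
  have AVx : A (cinv c x) (tvec c (cinv c x) (coord_field c V x)).
    by rewrite tK; exact: AV.
  have := fund_chart_expand (coord_field c E x) (coord_field c H x) qc AVx.
  by rewrite (tK V) (tK E) (tK H) e => ->.
apply: smooth_sum => // i; apply: smooth_sum => // j.
apply: smooth_mul => //; first by apply: smooth_coord => //; exact: sE.
apply: smooth_mul => //; first by apply: smooth_coord => //; exact: sH.
exact: (smooth_comp has_basis_pair_rV o oO mz sz (gramc_smooth _ _)).
Qed.
End MetricCharts.

Section MetricFiber.
Variables (R : realType) (n : nat) (M : manifold R n).
Variables (A : M -> set 'rV[R]_n) (L : M -> 'rV[R]_n -> R).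
Hypothesis pf : pseudo_finsler A L.

Lemma fiber_open p : open (A p).
Proof.
have := fiber_chart_open pf (chart_at_atlas p) (x := cfun (chart_at p) p).
congr open; apply/funext => w; apply/propext.
by rewrite -[X in _ <-> A p X](tvec_at p w); exact: (tchart_in _ _ (chart_at_dom p)).
Qed.

Lemma fiber_smooth p : smooth_on (A p) (L p : _ -> R^o).
Proof.
have := fiber_chart_smooth pf (chart_at_atlas p) (cfun (chart_at p) p).
congr smooth_on; apply/funext => w.
  apply/propext.
  by rewrite -[X in _ <-> A p X](tvec_at p w); exact: (tchart_in _ _ (chart_at_dom p)).
by rewrite /Lchart /= cfunK ?tvec_at //; exact: chart_at_dom.
Qed.

Lemma fundE p v e h : A p v -> fund L p v e h = gram (L p) v e h.
Proof. exact: (fund_gram (fiber_open (p := p)) (fiber_smooth p)). Qed.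

Lemma cartanE p v b e h : A p v ->
  cartan L p v b e h = 2^-1 * dgram (L p) v b e h.
Proof. exact: (cartan_dgram (fiber_open (p := p)) (fiber_smooth p)). Qed.

Lemma near_extend_admissible p v : A p v ->
  \forall q \near p, A q (extend p v q).
Proof.
move=> Av; have pc := chart_at_dom p.
have Ov : tchart (chart_at p) A (cfun (chart_at p) p, v).
  by apply/(tchart_in _ _ pc); rewrite tvec_at.
have E : \forall x \near cfun (chart_at p) p, tchart (chart_at p) A (x, v).
  have hl := hasD_continuous (hasD_pairl (cfun (chart_at p) p) v).
  apply: hl; exact: open_nbhs_nbhs (conj (pf_open pf (chart_at_atlas p)) Ov).
near=> q.
have qc : cdom (chart_at p) q by near: q; exact: near_cdom.
by apply/(tchart_in A v qc); near: q; exact: near_pull pc E.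
Unshelve. all: by end_near. Qed.
End MetricFiber.

(** * Horizontal projections of a submersion *)

Section SubmersionGeometry.
Variables (R : realType) (n m : nat) (M : manifold R n) (B : manifold R m).
Variables (A : M -> set 'rV[R]_n) (L : M -> 'rV[R]_n -> R).
Variables (At : B -> set 'rV[R]_m) (Lt : B -> 'rV[R]_m -> R).
Variable sigma : M -> B.
Hypothesis hsub : finsler_submersion A L At Lt sigma.
Hypothesis hnondeg : vertical_nondeg A L sigma.

Let pf := fs_total hsub.
Let pft := fs_base hsub.
Let ssig := fs_smooth hsub.

Definition dmx q : 'M[R]_(n, m) := lin1_mx (dmap sigma q).

Lemma dmapE q v : dmap sigma q v = v *m dmx q.
Proof. exact: (esym (mul_rV_lin1 _ v)). Qed.

Lemma ghor_gram q v x : A q v -> ghorizontal L sigma q v x <->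
  forall w, w *m dmx q = 0 -> gram (L q) v x w = 0.
Proof.
move=> Av; split=> h w.
  by rewrite -dmapE => /h; rewrite (fundE pf).
by rewrite /vertical dmapE => /h; rewrite (fundE pf).
Qed.

Lemma horizontal_hor q v : horizontal A L sigma q v <-> hor (L q) (A q) (dmx q) v.
Proof. by split=> -[Av h]; split => //; apply/(ghor_gram _ Av). Qed.

Lemma fiber_nondeg q v : A q v -> forall e, (forall h, gram (L q) v e h = 0) -> e = 0.
Proof.
move=> Av e he; apply: (pf_nondeg pf Av) => h.
by rewrite (fundE pf).
Qed.

Lemma fiber_vnondeg q v : A q v -> forall w, w *m dmx q = 0 ->
  (forall u, u *m dmx q = 0 -> gram (L q) v w u = 0) -> w = 0.
Proof.
move=> Av w wD hw; apply: (hnondeg Av); first by rewrite /vertical dmapE.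
by move=> u; rewrite /vertical dmapE => /hw; rewrite (fundE pf).
Qed.

Lemma fiber_surj q (u : 'rV[R]_m) : exists v, v *m dmx q = u.
Proof. by have [v <-] := fs_dsurj hsub q u; exists v; rewrite dmapE. Qed.

Let fo q := @fiber_open _ _ _ _ _ pf q.
Let fs q := @fiber_smooth _ _ _ _ _ pf q.

(** Two candidates for the vertical part differ by a vertical vector orthogonal to all vertical
    ones, which is zero by nondegeneracy. The chosen value in [vpart] is thereby determined. *)
Lemma hpart_uniq q v e h : A q v -> vertical sigma q (e - h) ->
  ghorizontal L sigma q v h -> hpart L sigma q v e = h.
Proof.
move=> Av ve hh; rewrite /hpart /vpart.
case: xgetP => [w _ [vw hw]|/(_ (e - h)) []]; last first.
  split; first exact: ve.
  by rewrite opprB addrC subrK; exact: hh.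
apply/eqP; rewrite -subr_eq0; apply/eqP; apply: (fiber_vnondeg Av).
  rewrite -dmapE.
  have -> : e - w - h = (e - h) - w by rewrite addrAC.
  by rewrite (linear_subE (dmap_linear sigma q)) ve vw subrr.
move=> u uD; rewrite (linear_subE (gram_linearl (L q) v u)).
by rewrite (ghor_gram _ Av).1 // ((ghor_gram _ Av).1 hh) // subrr.
Qed.

Lemma hpartE q v e : A q v -> hpart L sigma q v e = e *m hmx (L q) (dmx q) v.
Proof.
move=> Av; apply: hpart_uniq => //.
  rewrite /vertical dmapE mulmxBl -mulmxA.
  rewrite (hmx_D (@fo q) (@fs q) (@fiber_nondeg q) (@fiber_vnondeg q) (@fiber_surj q) Av).
  exact: subrr.
apply/(ghor_gram _ Av) => w wD.
exact: (hmx_hor (@fo q) (@fs q) (@fiber_nondeg q) e Av wD).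
Qed.

Lemma vpartE q v e : vpart L sigma q v e = e - hpart L sigma q v e.
Proof. by rewrite /hpart opprB addrC subrK. Qed.

Lemma dmap_hpart q v e : A q v -> dmap sigma q (hpart L sigma q v e) = dmap sigma q e.
Proof.
move=> Av; rewrite hpartE // !dmapE -mulmxA.
by rewrite (hmx_D (@fo q) (@fs q) (@fiber_nondeg q) (@fiber_vnondeg q) (@fiber_surj q) Av).
Qed.

Lemma vertical_vpart q v e : A q v -> vertical sigma q (vpart L sigma q v e).
Proof.
move=> Av; rewrite /vertical vpartE (linear_subE (dmap_linear sigma q)).
by rewrite dmap_hpart // subrr.
Qed.

Lemma ghor_hpart q v e : A q v -> ghorizontal L sigma q v (hpart L sigma q v e).
Proof.
move=> Av; rewrite hpartE //; apply/(ghor_gram _ Av) => w wD.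
exact: (hmx_hor (@fo q) (@fs q) (@fiber_nondeg q) e Av wD).
Qed.

Lemma hpart_hor q v x : A q v -> ghorizontal L sigma q v x ->
  hpart L sigma q v x = x.
Proof.
move=> Av hx; apply: hpart_uniq => //.
by rewrite /vertical subrr (linear_zeroE (dmap_linear sigma q)).
Qed.

Lemma hlift_hor q v u : A q v -> ghorizontal L sigma q v (hlift L sigma q v u) /\
  dmap sigma q (hlift L sigma q v u) = u.
Proof.
move=> Av; rewrite /hlift; case: xgetP => [x _ //|].
have [e he] := fs_dsurj hsub q u.
move=> /(_ (hpart L sigma q v e)) []; split; first exact: ghor_hpart.
by rewrite dmap_hpart.
Qed.

Let coneA q := @pf_cone _ _ _ _ _ pf q.
Let homA q := @pf_homog _ _ _ _ _ pf q.

Lemma fiber_iso q v : hor (L q) (A q) (dmx q) v ->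
  At (sigma q) (v *m dmx q) /\ L q v = Lt (sigma q) (v *m dmx q).
Proof. by move=> /horizontal_hor /(fs_isometry hsub); rewrite dmapE. Qed.

Lemma fund_iso q v x z : horizontal A L sigma q v -> ghorizontal L sigma q v x ->
  fund L q v x z =
  fund Lt (sigma q) (dmap sigma q v) (dmap sigma q x) (dmap sigma q z).
Proof.
move=> hv hx; have Av := hv.1; have [Atv _] := fs_isometry hsub hv.
rewrite (fundE pf) // (fundE pft) // !dmapE.
apply: (gram_iso (@fo q) (@fs q) (@fiber_nondeg q) (@fiber_vnondeg q) (@fiber_surj q)
  (@coneA q) (@homA q) (@fiber_smooth _ _ _ _ _ pft (sigma q)) (@fiber_iso q)).
- exact/horizontal_hor.
- exact/(ghor_gram _ Av).
Qed.

Lemma cartan_iso q v x y z : horizontal A L sigma q v ->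
  ghorizontal L sigma q v x -> ghorizontal L sigma q v y ->
  ghorizontal L sigma q v z ->
  cartan L q v x y z = cartan Lt (sigma q) (dmap sigma q v)
    (dmap sigma q x) (dmap sigma q y) (dmap sigma q z).
Proof.
move=> hv hx hy hz; have Av := hv.1; have [Atv _] := fs_isometry hsub hv.
rewrite (cartanE pf) // (cartanE pft) // !dmapE; congr (_ * _).
apply: (dgram_iso (@fo q) (@fs q) (@fiber_nondeg q) (@fiber_vnondeg q) (@fiber_surj q)
  (@coneA q) (@homA q) (@fiber_open _ _ _ _ _ pft (sigma q))
  (@fiber_smooth _ _ _ _ _ pft (sigma q)) (@fiber_iso q)).
- exact/horizontal_hor.
- exact/(ghor_gram _ Av).
- exact/(ghor_gram _ Av).
- exact/(ghor_gram _ Av).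
Qed.

Section InCharts.
Variables (c : chart R n M) (c' : chart R m B).
Hypotheses (hc : atlas c) (hc' : atlas c').

Definition gramc_mx (z : 'rV[R]_n * 'rV[R]_n) : 'M[R]_n :=
  \matrix_(i, j) gramc L c (delta_mx 0 i) (delta_mx 0 j) z.

Definition repmx (x : 'rV[R]_n) : 'M[R]_(n, m) := lin1_mx ('d (rep c c' sigma) x).

Lemma fund_chart_mx q v e h : cdom c q -> A q (tvec c q v) ->
  fund L q (tvec c q v) (tvec c q e) (tvec c q h) =
  (e *m gramc_mx (cfun c q, v) *m h^T) 0 0.
Proof.
move=> qc Av; rewrite (fund_chart_expand pf hc) // mxE.
under [RHS]eq_bigr do rewrite !mxE mulr_suml.
rewrite exchange_big; apply: eq_bigr => i _; apply: eq_bigr => j _.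
by rewrite ?mxE -[RHS]mulrA; congr (_ * _); exact: mulrC.
Qed.

Lemma dmap_chart q v : cdom c q -> cdom c' (sigma q) ->
  tcoord c' (sigma q) (dmap sigma q v) = tcoord c q v *m repmx (cfun c q).
Proof.
move=> qc qc'; rewrite (dmap_coord v ssig hc hc' qc qc').
exact: (esym (mul_rV_lin1 _ _)).
Qed.

Lemma vertical_chart q w : cdom c q -> cdom c' (sigma q) ->
  vertical sigma q w <-> tcoord c q w *m repmx (cfun c q) = 0.
Proof.
move=> qc qc'; rewrite -dmap_chart //; split=> [->|h].
  exact: (linear_zeroE (tcoord_linear c' (sigma q))).
rewrite /vertical -[LHS](tcoordK _ hc' qc') h.
exact: (linear_zeroE (tvec_linear c' (sigma q))).
Qed.

Lemma gramc_mx_unit q v : cdom c q -> A q (tvec c q v) ->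
  gramc_mx (cfun c q, v) \in unitmx.
Proof.
move=> qc Av; apply: unitmx_inj => u u0.
rewrite -[LHS](tvecK _ hc qc).
have -> : tvec c q u = 0.
  apply: (pf_nondeg pf Av) => h.
  by rewrite -[h](tcoordK _ hc qc) fund_chart_mx // u0 mul0mx mxE.
exact: (linear_zeroE (tcoord_linear c q)).
Qed.

Lemma hgram_chart_unit q v : cdom c q -> cdom c' (sigma q) -> A q (tvec c q v) ->
  hgram (gramc_mx (cfun c q, v)) (repmx (cfun c q)) \in unitmx.
Proof.
move=> qc qc' Av; apply: hgram_unit; first exact: gramc_mx_unit.
  move=> u; have [e he] := fs_dsurj hsub q (tvec c' (sigma q) u).
  by exists (tcoord c q e); rewrite -dmap_chart // he tvecK.
move=> w wJ hw; rewrite -[LHS](tvecK _ hc qc).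
have -> : tvec c q w = 0.
  apply: (hnondeg Av); first by apply/vertical_chart; rewrite ?tvecK.
  move=> u /(vertical_chart _ qc qc') /hw hu.
  by rewrite -[u](tcoordK _ hc qc) fund_chart_mx // hu mxE.
exact: (linear_zeroE (tcoord_linear c q)).
Qed.

Lemma hpart_chart q v e : cdom c q -> cdom c' (sigma q) -> A q (tvec c q v) ->
  hpart L sigma q (tvec c q v) (tvec c q e) =
  tvec c q (e *m hproj (gramc_mx (cfun c q, v)) (repmx (cfun c q))).
Proof.
move=> qc qc' Av; apply: hpart_uniq => //.
  apply/(vertical_chart _ qc qc').
  rewrite -(linear_subE (tvec_linear c q)) tvecK // mulmxBl -mulmxA.
  by rewrite hproj_D ?subrr //; exact: hgram_chart_unit.
move=> w /(vertical_chart _ qc qc') wJ.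
rewrite -[w](tcoordK _ hc qc) fund_chart_mx //.
rewrite -[e *m _ *m _]mulmxA -mulmxA hproj_hor ?mulmx0 ?mxE //.
exact: gramc_mx_unit.
Qed.

(** Extends a horizontal vector to a smooth field that is horizontal along [V]: the projection is
    rational in the chart expressions of the metric and of the differential of [sigma]. *)
Lemma smooth_hpart U (V : vfield M) e : open U -> U `<=` cdom c ->
  (forall q, U q -> cdom c' (sigma q)) -> smooth_vfield U V ->
  (forall q, U q -> A q (V q)) ->
  smooth_vfield U (fun q => hpart L sigma q (V q) (tvec c q e)).
Proof.
move=> oU Uc Uc' sV UA; have o := chart_open (c := c) oU.
have VK q : U q -> tvec c q (tcoord c q (V q)) = V q.
  by move=> Uq; rewrite tcoordK //; exact: Uc.
have UA' q : U q -> A q (tvec c q (tcoord c q (V q))).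
  by move=> Uq; rewrite VK //; exact: UA.
have cV x : ccod c x -> (x, coord_field c V x) =
    (cfun c (cinv c x), tcoord c (cinv c x) (V (cinv c x))).
  by move=> cx; have [_ ->] := ccod_inv cx.
apply: (smooth_vfield_chart hc oU Uc).
apply: (@smooth_eq _ _ _ _ (fun x =>
    e *m hproj (gramc_mx (x, coord_field c V x)) (repmx x))) => //.
  move=> x [cx Ux]; have [qc ex] := ccod_inv cx.
  rewrite /coord_field -[V (cinv c x) in RHS]VK //.
  rewrite hpart_chart // ?ex ?tvecK //; first exact: Uc'.
  exact: UA'.
apply: smooth_mx_rV => //; apply: smooth_mulmx => //; first exact: smooth_mx_cst.
apply: smooth_hproj => //.
- move=> x [cx Ux]; rewrite cV //; have [qc _] := ccod_inv cx.
  by apply: gramc_mx_unit => //; exact: UA'.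
- move=> x [cx Ux]; rewrite cV //; have [qc ex] := ccod_inv cx.
  rewrite -[in repmx _]ex.
  by apply: hgram_chart_unit => //; [exact: Uc'|exact: UA'].
- move=> i j; apply: (@smooth_eq _ _ _ _ (gramc L c (delta_mx 0 i) (delta_mx 0 j) \o
    (fun x => (x, coord_field c V x)))) => //; first by move=> x _; rewrite /= mxE.
  have sz : smooth_on [set x | ccod c x /\ U (cinv c x)]
      (fun x : 'rV[R]_n => (x, coord_field c V x)).
    by apply: smooth_pair => //; [exact: smooth_idrV|exact: sV].
  apply: (smooth_comp (@has_basis_pair_rV R n) o (pf_open pf hc) _ sz (gramc_smooth pf hc _ _)).
  by move=> x [cx Ux]; split => //=; exact: UA'.
- move=> i j.
  have sr : smooth_on [set x | ccod c x /\ U (cinv c x)] (rep c c' sigma).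
    by apply: smooth_subset (ssig.2 _ _ hc hc') => x [cx /Uc']; split.
  apply: (@smooth_eq _ _ _ _ (fun x => 'd (rep c c' sigma) x (delta_mx 0 i) 0 j)) => //.
    by move=> x _; rewrite /repmx /lin1_mx mxE.
  by apply: smooth_coord => //; exact: smooth_diff.
Qed.
End InCharts.

Lemma near_open_set (T : topologicalType) (p : T) (P : T -> Prop) :
  (\forall q \near p, P q) ->
  exists U : set T, [/\ open U, U p & forall q, U q -> P q].
Proof.
move=> hP; exists (interior P); split; [exact: open_interior|exact: hP|].
by move=> q; exact: interior_subset.
Qed.

Lemma sigma_nbhs p (P : B -> Prop) : (\forall b \near sigma p, P b) ->
  \forall q \near p, P (sigma q).
Proof. exact: ssig.1. Qed.

(** The neighbourhood on which the extension built into [nabla_aniso] is admissible and the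
    projections along it are smooth. *)
Lemma hpart_extend_smooth p v : A p v -> exists U : set M, [/\ open U, U p,
  U `<=` cdom (chart_at p), (forall q, U q -> A q (extend p v q)) &
  forall e, smooth_vfield U
    (fun q => hpart L sigma q (extend p v q) (extend p e q))].
Proof.
move=> Av.
have [U [oU Up hU]] : exists U : set M, [/\ open U, U p & forall q, U q ->
    [/\ cdom (chart_at p) q, cdom (chart_at (sigma p)) (sigma q) &
      A q (extend p v q)]].
  apply: near_open_set; near=> q; split; near: q.
  - exact: near_cdom (chart_at_dom p).
  - by apply: sigma_nbhs; exact: near_cdom (chart_at_dom _).
  - exact: near_extend_admissible pf _ _ Av.
have Uc : U `<=` cdom (chart_at p) by move=> q /hU[].
have Uc' q : U q -> cdom (chart_at (sigma p)) (sigma q) by move=> /hU[].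
have UA q : U q -> A q (extend p v q) by move=> /hU[].
exists U; split => // e.
have sv := smooth_vfield_subset Uc (smooth_extend p v).
exact: (@smooth_hpart _ _ (chart_at_atlas p) (chart_at_atlas (sigma p))
  U (extend p v) e oU Uc Uc' sv UA).
Unshelve. all: by end_near. Qed.
End SubmersionGeometry.

(** * The pointwise algebra *)

Section TensorAlgebra.
Variables (R : realType) (V W : lmodType R).
Variables (g : V -> V -> R) (gt : W -> W -> R).
Variables (C : V -> V -> V -> R) (Ct : W -> W -> W -> R).
(* [S] stands for the difference of the connections of the total space and of
   the base, [hp] for the horizontal projection and [DV e] for [nabla_e V]. *)
Variables (D : V -> W) (S : V -> V -> W) (hp : V -> V) (v : V) (DV : V -> V).

Definition horiz x := forall w, D w = 0 -> g x w = 0.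

Hypothesis gC : forall x y, g x y = g y x.
Hypothesis gl : forall y, linear (g^~ y : V -> R^o).
Hypothesis gtC : forall x y, gt x y = gt y x.
Hypothesis gtl : forall y, linear (gt^~ y : W -> R^o).
Hypothesis gtnd : forall a, (forall u, gt a u = 0) -> a = 0.
Hypothesis C12 : forall x y z, C x y z = C y x z.
Hypothesis C23 : forall x y z, C x y z = C x z y.
Hypothesis Cl : forall x y, linear (C x y : V -> R^o).
Hypothesis Ctl : forall x y, linear (Ct x y : W -> R^o).
Hypothesis Cv : forall x y, C v x y = 0.
Hypothesis Ctv : forall x y, Ct (D v) x y = 0.
Hypothesis Dl : linear D.
Hypothesis Dsurj : forall u, exists x, D x = u.
Hypothesis hpD : forall e, D (hp e) = D e.
Hypothesis hp_hor : forall e, horiz (hp e).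
Hypothesis vnd : forall w, D w = 0 -> (forall u, D u = 0 -> g w u = 0) -> w = 0.
Hypothesis gi : forall x y, horiz x -> g x y = gt (D x) (D y).
Hypothesis Ci : forall x y z, horiz x -> horiz y -> horiz z ->
  C x y z = Ct (D x) (D y) (D z).
Hypothesis SC : forall x y, S x y = S y x.
Hypothesis hv : horiz v.
Hypothesis hG : forall e x y, horiz x -> horiz y ->
  gt (D x) (S e y) + gt (S e x) (D y) + 2 * C x y (DV e)
  - 2 * Ct (D x) (D y) (D (DV e) - S e v) = 0.
Hypothesis hW : forall e w, D w = 0 -> g (DV e) w = - gt (D v) (S e w).

(** The vertical part of [nabla_e V], the one part not determined by its projection to the base. *)
Let tau e := DV e - hp (DV e).

Lemma tau_vertical e : D (tau e) = 0.
Proof. by rewrite (linear_subE Dl) hpD subrr. Qed.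

Lemma g_tau e w : D w = 0 -> g (tau e) w = - gt (D v) (S e w).
Proof.
by move=> w0; rewrite (linear_subE (gl w)) hp_hor // subr0 hW.
Qed.

(** On the horizontal part of [nabla_e V] the two Cartan tensors agree, so that part cancels against
    the base term; the vertical part and [S e v] remain. *)
Lemma hG_tau e x y : horiz x -> horiz y ->
  gt (D x) (S e y) + gt (S e x) (D y) + 2 * C x y (tau e)
  + 2 * Ct (D x) (D y) (S e v) = 0.
Proof.
move=> hx hy; have := hG e hx hy.
have -> : C x y (tau e) = C x y (DV e) - Ct (D x) (D y) (D (DV e)).
  by rewrite (linear_subE (Cl x y)) (Ci hx hy (hp_hor _)) hpD.
rewrite (linear_subE (Ctl (D x) (D y))); lra.
Qed.

(** With [x := v] the Cartan terms vanish, and a skewness property of [S e] remains. *)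
Lemma gSv e y : horiz y -> gt (S e v) (D y) + gt (D v) (S e y) = 0.
Proof.
move=> hy; have := hG_tau e hv hy.
rewrite Cv Ctv; lra.
Qed.

Lemma gSvv e : gt (S e v) (D v) = 0.
Proof. by have := gSv e hv; rewrite [X in _ + X]gtC; lra. Qed.

Lemma eq0_hor a : (forall y, horiz y -> gt a (D y) = 0) -> a = 0.
Proof.
move=> h; apply: gtnd => u; have [e <-] := Dsurj u.
by rewrite -hpD; exact: h.
Qed.

(** In [gSv] at [e := v], the symmetry of [S] turns the second term into [gSvv]. *)
Lemma Svv : S v v = 0.
Proof.
apply: eq0_hor => y hy.
by have := gSv v hy; have := gSvv y; rewrite gtC (SC y v); lra.
Qed.

(** Paired with a vertical [w] it gives, by symmetry of [S], the expression of [gSvv] at [w]; the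
    vertical space is nondegenerate. *)
Lemma tauv : tau v = 0.
Proof.
apply: vnd => [|w w0]; first exact: tau_vertical.
by rewrite g_tau // SC gtC gSvv oppr0.
Qed.

(** The form [gt (S v x) (D y)] is skew in [x] and [y] by [hG_tau] at [e := v], whose Cartan terms
    are now gone. By [gSv] it equals [- gt (D v) (S x y)], which is symmetric. *)
Lemma Sv x : horiz x -> S v x = 0.
Proof.
move=> hx; apply: eq0_hor => y hy.
have := hG_tau v hx hy; rewrite tauv Svv.
rewrite (linear_zeroE (Cl x y)) (linear_zeroE (Ctl _ _)).
have := gSv x hy; have := gSv y hx; rewrite (SC y x) (SC x v) (SC y v).
by rewrite (gtC (D x)); lra.
Qed.

(* The combination of the three cyclic instances of [hG_tau] that isolates the
   Levi-Civita connection in Koszul's formula. *)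
Lemma gS x y z : horiz x -> horiz y -> horiz z ->
  gt (S x y) (D z) = C x y (tau z) - C y z (tau x) - C x z (tau y).
Proof.
move=> hx hy hz.
have := hG_tau x hy hz; have := hG_tau y hx hz; have := hG_tau z hx hy.
rewrite !(SC _ v) !Sv // !(linear_zeroE (Ctl _ _)).
rewrite (SC y x) (SC z x) (SC z y).
by rewrite (gtC (D x)) (gtC (D y)); lra.
Qed.

(** By [gSv] at the vertical vector [w] paired with [z], the values [- gt (D v) (S z w)] and
    [- gt (D z) (S v w)] are opposite. Here [a] will be [A_v z]. *)
Lemma tau_uniq a z : horiz z -> D a = 0 ->
  (forall w, D w = 0 -> g a w = - gt (D z) (S v w)) -> tau z = - a.
Proof.
move=> hz a0 ha; apply/eqP; rewrite -addr_eq0; apply/eqP; apply: vnd.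
  by rewrite (linear_addE Dl) tau_vertical a0 addr0.
move=> w w0; rewrite (linear_addE (gl w)) g_tau // ha //.
by have := gSv w hz; rewrite (SC z) (SC v) (gtC (D z)); lra.
Qed.

Lemma gS_tensor (a : V -> V) x y z : horiz x -> horiz y -> horiz z ->
  (forall z, horiz z -> D (a z) = 0) ->
  (forall z w, horiz z -> D w = 0 -> g (a z) w = - gt (D z) (S v w)) ->
  gt (S x y) (D z) = - C x y (a z) + C y z (a x) + C x z (a y).
Proof.
move=> hx hy hz a0 ha.
have e z' : horiz z' -> tau z' = - a z'.
  by move=> hz'; apply: tau_uniq => // [|w w0]; [exact: a0|exact: ha].
have CN x' y' z' : C x' y' (- z') = - C x' y' z'.
  by rewrite -[- z']sub0r (linear_subE (Cl x' y')) (linear_zeroE (Cl x' y')) sub0r.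
by rewrite gS // !e // !CN; ring.
Qed.
End TensorAlgebra.

(** * Second derivatives of chart representatives *)

Section SecondDerivative.
Variables (R : realType) (n : nat) (W : normedModType R).
Variables (s : 'rV[R]_n -> W) (U : set 'rV[R]_n) (x : 'rV[R]_n).
Hypotheses (oU : open U) (ss : smooth_on U s) (Ux : U x).

Definition hess e y := 'd (fun z => 'd s z y) x e.

Lemma diff_expand z y : 'd s z y = \sum_j (y 0 j : R^o) *: 'd s z (delta_mx 0 j).
Proof. exact: (hasD_basis s z y (rV_is_basis R n)). Qed.

Lemma hess_expand e y : hess e y = \sum_j (y 0 j : R^o) *: hess e (delta_mx 0 j).
Proof.
have h : hasD (fun z => \sum_j (y 0 j : R^o) *: 'd s z (delta_mx 0 j)) x
    (fun e => \sum_j (y 0 j : R^o) *: hess e (delta_mx 0 j)).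
  apply: hasD_sum => j; apply: hasDZ.
  exact: (smooth_hasD (smooth_diff _ ss) Ux).
have E : (fun z => 'd s z y) = fun z => \sum_j (y 0 j : R^o) *: 'd s z (delta_mx 0 j).
  by apply/funext => z; exact: diff_expand.
have h2 := smooth_hasD (smooth_diff y ss) Ux.
have h3 : hasD (fun z => 'd s z y) x
    (fun e => \sum_j (y 0 j : R^o) *: hess e (delta_mx 0 j)).
  exact: (eq_ind_r (fun f => hasD f x _) h E).
exact: (hasD_unique h2 h3 e).
Qed.

(** Product rule for a differential applied to a moving vector; the Hessian term is the
    chart-dependent part that [defect] later subtracts. *)
Lemma hasD_diff_apply (a da : 'rV[R]_n -> 'rV[R]_n) : hasD a x da ->
  hasD (fun z => 'd s z (a z)) x (fun e => hess e (a x) + 'd s x (da e)).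
Proof.
move=> ha.
have h : hasD (fun z => \sum_j coordf j (a z) *: 'd s z (delta_mx 0 j)) x
    (fun e => \sum_j (coordf j (a x) *: hess e (delta_mx 0 j)
       + coordf j (da e) *: 'd s x (delta_mx 0 j))).
  apply: hasD_sum => j; apply: hasD_scale.
    exact: (hasD_comp ha (hasD_lin _ (@coordf_continuous R n j))).
  exact: (smooth_hasD (smooth_diff _ ss) Ux).
have E : (fun z => \sum_j coordf j (a z) *: 'd s z (delta_mx 0 j)) =
    fun z => 'd s z (a z).
  by apply/funext => z; exact: (esym (diff_expand z (a z))).
have h3 := eq_ind _ (fun f => hasD f x _) h _ E.
apply: (hasD_ext h3) => e.
rewrite big_split; congr (_ + _); first exact: (esym (hess_expand e (a x))).
exact: (esym (diff_expand x (da e))).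
Qed.
End SecondDerivative.

Section SecondDerivativeRow.
Variables (R : realType) (n m : nat).
Variables (s : 'rV[R]_n -> 'rV[R]_m) (U : set 'rV[R]_n) (x : 'rV[R]_n).
Hypotheses (oU : open U) (ss : smooth_on U s) (Ux : U x).

Lemma hessC e y : hess s x e y = hess s x y e.
Proof.
have si i : smooth_on U (fun z => coordf i (s z)).
  exact: (smooth_lin_comp oU (@coordf_continuous R m i) ss).
have d1 i z w : U z -> coordf i ('d s z w) = 'd (fun z => coordf i (s z)) z w.
  move=> Uz; apply: esym.
  exact: ((hasD_comp (smooth_hasD ss Uz) (hasD_lin _ (@coordf_continuous R m i))).2 w).
have d2 i w u : coordf i (hess s x w u) =
    'd (fun z => 'd (fun z => coordf i (s z)) z u) x w.
  have h := hasD_comp (smooth_hasD (smooth_diff u ss) Ux)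
    (hasD_lin _ (@coordf_continuous R m i)).
  have E : \forall z \near x, (coordf i \o (fun z => 'd s z u)) z =
      'd (fun z => coordf i (s z)) z u.
    by apply: (open_near oU Ux) => z Uz; exact: d1.
  exact: esym ((near_eq_hasD E h).2 w).
apply/rowP => i.
apply: etrans (d2 i e y) (etrans _ (esym (d2 i y e))).
exact: (diff2C _ _ oU (si i 2) Ux).
Qed.
End SecondDerivativeRow.

Lemma bilinear_expand (R : realType) n m (b : 'rV[R]_n -> 'rV[R]_m -> R)
    (x : 'rV[R]_n) (y : 'rV[R]_m) :
  (forall z, linear (b^~ z : _ -> R^o)) -> (forall z, linear (b z : _ -> R^o)) ->
  \sum_i \sum_j x 0 i * (y 0 j * b (delta_mx 0 i) (delta_mx 0 j)) = b x y.
Proof.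
move=> l1 l2; rewrite (linear_expand (l1 y)); apply: eq_bigr => i _.
by rewrite (linear_expand (l2 _)) scaler_sumr.
Qed.

(** * Openness of submersions *)

Section OpenMap.
Variables (R : realType) (n m : nat) (M : manifold R n) (B : manifold R m).
Variable sigma : M -> B.
Hypothesis ssig : smooth_map sigma.
Hypothesis dsurj : forall p u, exists v, dmap sigma p v = u.

(** A linear right inverse [T] of the differential cuts out an [m]-dimensional affine slice through
    the point. On it the representative of [sigma] has the identity as differential, and the inverse
    function theorem applies. *)
Lemma submersion_open (U : set M) p : open U -> U p ->
  \forall b \near sigma p, (sigma @` U) b.
Proof.
move=> oU Up.
pose c := chart_at p; pose c' := chart_at (sigma p).
have pc : cdom c p := chart_at_dom p.
have pc' : cdom c' (sigma p) := chart_at_dom (sigma p).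
pose s := rep c c' sigma.
pose x0 := cfun c p.
have [t ht] := choice (fun i : 'I_m => dsurj p (delta_mx 0 i)).
pose T : 'M[R]_(m, n) := \matrix_i t i.
have DT (u : 'rV[R]_m) : 'd s x0 (u *m T) = u.
  rewrite mulmx_sum_row; under eq_bigr do rewrite rowK.
  rewrite [RHS]row_sum_delta.
  apply: etrans (linear_sum _ _ _ _) _; apply: eq_bigr => i _.
  by apply: etrans (linearZ _ _) _; congr (_ *: _); exact: ht.
pose S := [set x | ccod c x /\ (U `&` sigma @^-1` cdom c') (cinv c x)].
have oS : open S.
  apply: chart_open; apply: openI => //.
  by apply: open_comp; [move=> q _; exact: ssig.1|exact: cdom_open].
have ss : smooth_on S s.
  apply: smooth_subset (ssig.2 _ _ (chart_at_atlas p) (chart_at_atlas (sigma p))).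
  by move=> x [cx [_ Ux]]; split.
pose l y := x0 + y *m T.
have hl y : hasD l y (fun u => u *m T).
  apply: (hasD_ext (hasDD (hasD_cst x0 y) (hasD_mulmxr T (hasD_id y)))) => u.
  by rewrite add0r.
pose S' := l @^-1` S.
have oS' : open S'.
  by apply: open_comp => // y _; exact: hasD_continuous (hl y).
have sl : smooth_on S' l.
  apply: smooth_add => //; first exact: smooth_cst.
  by apply: smooth_mulmxr => //; exact: smooth_idrV.
have l0 : l 0 = x0 by rewrite /l mul0mx addr0.
have Sx0 : S x0.
  by split; [exact: ccodP|rewrite cfunK //; split].
have S'0 : S' 0 by rewrite /S' /= l0.
have sf : smooth_on S' (s \o l).
  by apply: (smooth_comp _ oS' oS _ sl ss) => //; exact: has_basis_rV.
have df u : 'd (s \o l) 0 u = u.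
  have Sl0 : S (l 0) by rewrite l0.
  have [_ ->] := hasD_comp (hl 0) (smooth_hasD ss Sl0).
  by rewrite /comp l0; exact: DT.
have [g [gn _ _]] := inverse_function oS' S'0 (sf 1%N) df.
have f0 : (s \o l) 0 = cfun c' (sigma p) by rewrite /comp l0 /s /rep /= cfunK.
rewrite f0 in gn.
near=> b.
have bc' : cdom c' b by near: b; exact: near_cdom.
have [[cx [Ux sx]] e] : S' (g (cfun c' b)) /\ (s \o l) (g (cfun c' b)) = cfun c' b.
  near: b; exact: near_pull gn.
exists (cinv c (l (g (cfun c' b)))) => //.
rewrite -[LHS](cfunK sx) -[RHS](cfunK bc'); congr (cinv c' _).
exact: e.
Unshelve. all: by end_near. Qed.
End OpenMap.

(** * Symmetry and linearity of the tensors of a metric *)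

Section MetricTensors.
Variables (R : realType) (n : nat) (M : manifold R n).
Variables (A : M -> set 'rV[R]_n) (L : M -> 'rV[R]_n -> R).
Hypothesis pf : pseudo_finsler A L.
Variables (p : M) (v : 'rV[R]_n).
Hypothesis Av : A p v.

Let o := @fiber_open _ _ _ _ _ pf p.
Let sm := @fiber_smooth _ _ _ _ _ pf p.

Lemma fundC e h : fund L p v e h = fund L p v h e.
Proof.
rewrite (fundE pf e h Av) (fundE pf h e Av).
exact: (gramC o sm e h Av).
Qed.

Lemma fund_linearl h : linear (fun e => fund L p v e h : R^o).
Proof. by move=> a x y; rewrite !(fundE pf) //; exact: gram_linearl. Qed.

Lemma fund_linearr e : linear (fund L p v e : _ -> R^o).
Proof. by move=> a x y; rewrite !(fundC e); exact: fund_linearl. Qed.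

Lemma cartanC12 b e h : cartan L p v b e h = cartan L p v e b h.
Proof.
rewrite (cartanE pf b e h Av) (cartanE pf e b h Av).
exact: (congr1 (fun z : R => 2^-1 * z) (dgramC12 o sm b e h Av)).
Qed.

Lemma cartanC23 b e h : cartan L p v b e h = cartan L p v b h e.
Proof.
rewrite (cartanE pf b e h Av) (cartanE pf b h e Av).
exact: (congr1 (fun z : R => 2^-1 * z) (dgramC23 o sm b e h Av)).
Qed.

Lemma cartan_linear1 e h : linear (fun b => cartan L p v b e h : R^o).
Proof.
move=> a x y; rewrite !(cartanE pf) // dgram_linear1 mulrDr.
by rewrite /GRing.scale /= mulrCA.
Qed.

Lemma cartan_linear2 b h : linear (fun e => cartan L p v b e h : R^o).
Proof. by move=> a x y; rewrite !(cartanC12 b); exact: cartan_linear1. Qed.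

Lemma cartan_linear3 b e : linear (cartan L p v b e : _ -> R^o).
Proof. by move=> a x y; rewrite !(cartanC23 b e); exact: cartan_linear2. Qed.

Lemma cartan_v0 e h : cartan L p v v e h = 0.
Proof.
rewrite (cartanE pf) //.
by rewrite (dgram_hom o sm (@pf_cone _ _ _ _ _ pf p) (@pf_homog _ _ _ _ _ pf p)) // mulr0.
Qed.

(** The linear form [cartan _ e h] is represented through the inverse Gram matrix, so the set from
    which [csharp] chooses is inhabited. *)
Lemma csharpP e h b : fund L p v b (csharp L p v e h) = cartan L p v b e h.
Proof.
rewrite /csharp; case: xgetP => [w _ /(_ b) //|].
have nd := fun v Av => @pf_nondeg _ _ _ _ _ pf p v Av.
have Gu : gmx (L p) v \in unitmx.
  apply: (gmx_unit o sm _ Av) => v' Av' e' he'.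
  by apply: (pf_nondeg pf Av') => h'; rewrite (fundE pf).
move=> /(_ ((\row_j cartan L p v (delta_mx 0 j) e h) *m invmx (gmx (L p) v))) [] b'.
rewrite fundC (fundE pf) // (gram_gmx o sm) // mulmxKV // mxE.
rewrite (linear_expand (cartan_linear1 e h)); apply: eq_bigr => j _.
by rewrite !mxE mulrC.
Qed.

Lemma fund_tvec_expand (c : chart R n M) a b :
  fund L p v (tvec c p a) (tvec c p b) =
  \sum_i \sum_j a 0 i * (b 0 j *
     fund L p v (tvec c p (delta_mx 0 i)) (tvec c p (delta_mx 0 j))).
Proof.
apply: esym.
apply: (bilinear_expand (b := fun a b => fund L p v (tvec c p a) (tvec c p b))).
  by move=> z k x y; rewrite (tvec_linear c p) fund_linearl.
by move=> z k x y; rewrite (tvec_linear c p) fund_linearr.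
Qed.
End MetricTensors.

Lemma product_rule_ring (R : comPzRingType) (f y db da g a b c : R) :
  f * (y * (a + b + 2 * c) + db * g) + da * (y * g) =
  da * (y * g) + f * (y * a) + (f * (db * g) + f * (y * b)) + 2 * (f * (y * c)).
Proof. by ring. Qed.

Lemma derive1_hasD (R : realType) n (f df : R^o -> 'rV[R]_n) :
  hasD f 0 df -> derive1 (f : R -> 'rV[R]_n) 0 = df 1.
Proof.
move=> h; apply: etrans (derive1E _ _) _.
exact: (@hasD_derive R R^o _ f 0 df 1 h).
Qed.

(** * The difference of the two connections *)

Section AtPoint.
Variables (R : realType) (n m : nat) (M : manifold R n) (B : manifold R m).
Variables (A : M -> set 'rV[R]_n) (L : M -> 'rV[R]_n -> R).
Variables (At : B -> set 'rV[R]_m) (Lt : B -> 'rV[R]_m -> R).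
Variable sigma : M -> B.
Hypothesis hsub : finsler_submersion A L At Lt sigma.
Hypothesis hnondeg : vertical_nondeg A L sigma.
Variables (nabla : connection M) (nablat : connection B).
Hypothesis hnabla : levi_civita_chern A L nabla.
Hypothesis hnablat : levi_civita_chern At Lt nablat.
Variable p : M.

Let pf := fs_total hsub.
Let pft := fs_base hsub.
Let ssig := fs_smooth hsub.
Let hcon := lcc_connection hnabla.
Let hcont := lcc_connection hnablat.
Local Notation c := (chart_at p).
Local Notation c' := (chart_at (sigma p)).
Let hc : atlas c := chart_at_atlas p.
Let hc' : atlas c' := chart_at_atlas (sigma p).
Let pc : cdom c p := chart_at_dom p.
Let pc' : cdom c' (sigma p) := chart_at_dom (sigma p).
Local Notation s := (rep c c' sigma).
Local Notation x0 := (cfun c p).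
Local Notation y0 := (cfun c' (sigma p)).
Local Notation D := (dmap sigma p).
Local Notation Ws := [set x | ccod c x /\ cdom c' (sigma (cinv c x))].

Let oW : open Ws := rep_open ssig.1.
Let ss : smooth_on Ws s := ssig.2 _ _ hc hc'.

Let Wx0 : Ws x0.
Proof. by split; [exact: ccodP|rewrite cfunK]. Qed.

Let sx0 : s x0 = y0.
Proof. by rewrite /rep /= cfunK. Qed.

(* The tensorial difference between the two connections: by [dmap_nabla],
   [defect v e y] is [D (nabla^v_E F) - nablat^(Dv)_Et Ft] for projectable
   extensions [E], [F] of [e], [y]. *)
Definition defect v e y : 'rV[R]_m :=
  D (christoffel nabla p v e y) - hess s x0 e y
  - christoffel nablat (sigma p) (D v) (D e) (D y).

(** Both connections are torsion free, and the Hessian is symmetric by Schwarz's theorem. *)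
Lemma defectC v e y : A p v -> At (sigma p) (D v) ->
  defect v e y = defect v y e.
Proof.
move=> Av Atv; rewrite /defect (hessC oW ss Wx0 e y).
rewrite (christoffelC hcon e y Av (lcc_torsion hnabla)).
by rewrite (christoffelC hcont (D e) (D y) Atv (lcc_torsion hnablat)).
Qed.

Lemma diff_image U (F : vfield M) : open U -> U p -> smooth_vfield U F ->
  hasD (fun x => 'd s x (coord_field c F x)) x0
    (fun e => hess s x0 e (F p) + D ('d (coord_field c F) x0 e)).
Proof.
move=> oU Up sF.
have hF : hasD (coord_field c F) x0 ('d (coord_field c F) x0).
  apply: (smooth_hasD (sF _ hc)).
  by split; [exact: ccodP|rewrite cfunK].
apply: (hasD_ext (hasD_diff_apply ss Wx0 hF)) => u.
by rewrite coord_field_at.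
Qed.

(** Here [F] need not be projectable: its image is only a vector field along [sigma], read in the
    chart. Horizontal projections of coordinate fields are of this kind. *)
Lemma dmap_nabla_image U (E F : vfield M) v : open U -> U p -> A p v ->
  smooth_vfield U E -> smooth_vfield U F ->
  D (nabla E F p v) = 'd (fun x => 'd s x (coord_field c F x)) x0 (E p)
    + christoffel nablat (sigma p) (D v) (D (E p)) (D (F p))
    + defect v (E p) (F p).
Proof.
move=> oU Up Av sE sF.
rewrite (nablaE hcon oU Up Av sE sF).
have [_ e] := diff_image oU Up sF.
have {}e := e (E p).
rewrite (linear_addE (dmap_linear sigma p)) /defect.
apply: esym; apply: etrans (f_equal2 +%R (f_equal2 +%R e (erefl _)) (erefl _)) _.
set h := hess _ _ _ _; set a := D ('d _ _ _); set b := christoffel nablat _ _ _ _.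
set d := D (christoffel _ _ _ _ _).
by apply/rowP => i; rewrite !mxE; ring.
Qed.

Lemma base_nbhd (U : set M) : open U -> U p -> exists Ub : set B,
  [/\ open Ub, Ub (sigma p), Ub `<=` cdom c' & Ub `<=` sigma @` U].
Proof.
move=> oU Up.
have h : \forall b \near sigma p, cdom c' b /\ (sigma @` U) b.
  have h1 := near_cdom pc'.
  have h2 : \forall b \near sigma p, (sigma @` U) b.
    by apply: (@submersion_open _ _ _ _ _ sigma ssig _ U p oU Up); exact: (fs_dsurj hsub).
  by near=> b; split; near: b.
have [Ub [oUb Ubp hUb]] := near_open_set h.
by exists Ub; split => // b /hUb[].
Unshelve. all: by end_near. Qed.

Lemma image_coord (F : vfield M) x : Ws x -> 'd s x (coord_field c F x) =
  tcoord c' (sigma (cinv c x)) (dmap sigma (cinv c x) (F (cinv c x))).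
Proof.
move=> [cx cx']; have [qc ex] := ccod_inv cx.
rewrite (dmap_coord _ ssig hc hc' qc cx').
by rewrite ex.
Qed.

Lemma projects_image (U : set M) (Ub : set B) (F : vfield M) (Ft : vfield B) e :
  open U -> U p -> open Ub -> Ub (sigma p) -> smooth_vfield Ub Ft ->
  (forall q, U q -> dmap sigma q (F q) = Ft (sigma q)) ->
  'd (fun x => 'd s x (coord_field c F x)) x0 e =
  'd (coord_field c' Ft) y0 (D e).
Proof.
move=> oU Up oUb Ubp sFt FFt.
have hFt : hasD (coord_field c' Ft) (s x0) ('d (coord_field c' Ft) y0).
  rewrite sx0; apply: (smooth_hasD (sFt _ hc')).
  by split; [exact: ccodP|rewrite cfunK].
have oS : open [set x | ccod c x /\ (U `&` sigma @^-1` cdom c') (cinv c x)].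
  apply: chart_open; apply: openI => //.
  by apply: open_comp; [move=> q _; exact: ssig.1|exact: cdom_open].
have Sx0 : [set x | ccod c x /\ (U `&` sigma @^-1` cdom c') (cinv c x)] x0.
  by split; [exact: ccodP|rewrite cfunK].
have E : \forall x \near x0,
    (coord_field c' Ft \o s) x = 'd s x (coord_field c F x).
  apply: (open_near oS Sx0) => x [cx [Ux cx']].
  rewrite (@image_coord F x) // FFt //.
  by rewrite /coord_field /rep /comp cfunK.
exact: ((near_eq_hasD E (hasD_comp (smooth_hasD ss Wx0) hFt)).2 e).
Qed.

Lemma dmap_nabla (U : set M) (Ub : set B) (E F : vfield M) (Et Ft : vfield B) v :
  open U -> U p -> open Ub -> Ub (sigma p) -> A p v -> At (sigma p) (D v) ->
  smooth_vfield U E -> smooth_vfield U F ->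
  smooth_vfield Ub Et -> smooth_vfield Ub Ft -> D (E p) = Et (sigma p) ->
  (forall q, U q -> dmap sigma q (F q) = Ft (sigma q)) ->
  D (nabla E F p v) = nablat Et Ft (sigma p) (D v) + defect v (E p) (F p).
Proof.
move=> oU Up oUb Ubp Av Atv sE sF sEt sFt eE FFt.
rewrite (dmap_nabla_image oU Up Av sE sF).
rewrite (nablaE hcont oUb Ubp Atv sEt sFt) -eE -FFt //; congr (_ + _ + _).
exact: (projects_image _ oU Up oUb Ubp sFt FFt).
Qed.

(** * Derivatives along a horizontal projectable field *)

Section HorizontalField.
Variables (U : set M) (V : vfield M) (Vt : vfield B).
Hypotheses (oU : open U) (Up : U p).
Hypothesis sV : smooth_vfield U V.
Hypothesis sVt : smooth_vfield (sigma @` U) Vt.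
Hypothesis VVt : forall q, U q -> dmap sigma q (V q) = Vt (sigma q).
Hypothesis hV : forall q, U q -> horizontal A L sigma q (V q).

Local Notation v := (V p).
Local Notation N F e := (nabla (extend p e) F p (V p)).
Local Notation S := (defect (V p)).
Local Notation g := (fund L p (V p)).
Local Notation gt := (fund Lt (sigma p) (dmap sigma p (V p))).
Local Notation C := (cartan L p (V p)).
Local Notation Ct := (cartan Lt (sigma p) (dmap sigma p (V p))).

Let Av : A p v := (hV Up).1.
Let Atv : At (sigma p) (D v) := (fs_isometry hsub (hV Up)).1.

(* Along [V], [sigma] is isometric on [g_V]-horizontal fields; both sides are differentiated in the direction [e]. *)
Lemma isometry_derivative_chart (F : vfield M) e y : smooth_vfield U F ->
  (forall q, U q -> ghorizontal L sigma q (V q) (F q)) ->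
  g (N F e) y + g (F p) (christoffel nabla p v e y) + 2 * C (F p) y (N V e)
  = gt ('d (fun x => 'd s x (coord_field c F x)) x0 e
        + christoffel nablat (sigma p) (D v) (D e) (D (F p))) (D y)
  + gt (D (F p)) (hess s x0 e y
        + christoffel nablat (sigma p) (D v) (D e) (D y))
  + 2 * Ct (D (F p)) (D y)
      (nablat (extend (sigma p) (D e)) Vt (sigma p) (D v)).
Proof.
move=> sF hF.
have [Ub [oUb Ubp Ubc UbU]] := base_nbhd oU Up.
pose U1 := U `&` cdom c `&` sigma @^-1` Ub.
have oU1 : open U1.
  apply: openI; first by apply: openI => //; exact: cdom_open.
  by apply: open_comp => // q _; exact: ssig.1.
have U1p : U1 p by do 2?split.
have U1U : U1 `<=` U by move=> q [[]].
have U1c : U1 `<=` cdom c by move=> q [[]].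
have sV1 := smooth_vfield_subset U1U sV.
have sF1 := smooth_vfield_subset U1U sF.
have sX1 k : smooth_vfield U1 (extend p k).
  exact: smooth_vfield_subset U1c (smooth_extend p k).
have AV1 q : U1 q -> A q (V q) by move=> /U1U /hV[].
have sVt1 : smooth_vfield Ub Vt by exact: smooth_vfield_subset UbU sVt.
have sXt k : smooth_vfield Ub (extend (sigma p) k).
  exact: smooth_vfield_subset Ubc (smooth_extend (sigma p) k).
have AtVt b : Ub b -> At b (Vt b).
  move=> /UbU[q Uq <-]; rewrite -VVt //.
  exact: (fs_isometry hsub (hV Uq)).1.
have VVtp : Vt (sigma p) = D v by rewrite VVt.
have lhs := lcc_metric hnabla oU1 U1p sV1 AV1 (sX1 e) sF1 (sX1 y).
rewrite !extend_at (nabla_extend hcon _ _ Av) in lhs.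
apply: etrans (esym lhs) _.
pose d j : 'rV[R]_m := delta_mx 0 j.
(* The metric identity of the base concerns vector fields on the base, whereas the image of [F] is
   only a field along [sigma]. Coordinate fields bridge this: [phi] holds the coefficients of the
   base metric along [Vt]. *)
pose phi j k z : R^o := fund Lt (cinv c' z) (Vt (cinv c' z))
  (extend (sigma p) (d j) (cinv c' z)) (extend (sigma p) (d k) (cinv c' z)).
have Sy0 : [set z | ccod c' z /\ Ub (cinv c' z)] y0.
  by split; [exact: ccodP|rewrite cfunK].
pose dphi j k u : R^o := gt (christoffel nablat (sigma p) (D v) u (d j)) (d k)
    + gt (d j) (christoffel nablat (sigma p) (D v) u (d k))
    + 2 * Ct (d j) (d k) (nablat (extend (sigma p) u) Vt (sigma p) (D v)).
have hphi j k : hasD (phi j k) (s x0) (dphi j k).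
  have sphi := fund_field_smooth pft hc' oUb Ubc sVt1 AtVt (sXt (d j)) (sXt (d k)).
  rewrite sx0; apply: (hasD_ext (smooth_hasD sphi Sy0)) => u.
  have := lcc_metric hnablat oUb Ubp sVt1 AtVt (sXt u) (sXt (d j)) (sXt (d k)).
  rewrite !extend_at VVtp !(nabla_extend hcont _ _ Atv).
  exact.
pose a x := 'd s x (coord_field c F x).
pose b x := 'd s x y.
have ha := diff_image oU Up sF.
have hb := smooth_hasD (smooth_diff y ss) Wx0.
have hco (u du : 'rV[R]_n -> 'rV[R]_m) j : hasD u x0 du ->
    hasD (fun x => coordf j (u x)) x0 (fun e => coordf j (du e)).
  by move=> hu; exact: (hasD_comp hu (hasD_lin _ (@coordf_continuous R m j))).
have hs := smooth_hasD ss Wx0.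
have E : \forall x \near x0,
    (fun x => \sum_j \sum_k coordf j (a x) *: (coordf k (b x) *: phi j k (s x))) x
    = fund L (cinv c x) (V (cinv c x)) (F (cinv c x)) (extend p y (cinv c x)).
  have oS1 := chart_open (c := c) oU1.
  have S1x0 : [set x | ccod c x /\ U1 (cinv c x)] x0.
    by split; [exact: ccodP|rewrite cfunK].
  apply: (open_near oS1 S1x0) => x [cx Ux].
  have [[Uq qc] Ubq] := Ux; have qc' := Ubc _ Ubq.
  have Wx : Ws x by split.
  rewrite (fund_iso hsub hnondeg _ (hV Uq) (hF _ Uq)).
  have eF : dmap sigma (cinv c x) (F (cinv c x)) = tvec c' (sigma (cinv c x)) (a x).
    by rewrite /a (@image_coord F x) // tcoordK.
  have ey : dmap sigma (cinv c x) (extend p y (cinv c x)) =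
      tvec c' (sigma (cinv c x)) (b x).
    have := image_coord (extend p y) Wx.
    rewrite coord_field_extend // /b => ->.
    by rewrite tcoordK.
  rewrite eF ey VVt // (fund_tvec_expand pft (AtVt _ Ubq)).
  apply: eq_bigr => j _; apply: eq_bigr => k _.
  have ephi : phi j k (s x) = fund Lt (sigma (cinv c x)) (Vt (sigma (cinv c x)))
      (extend (sigma p) (d j) (sigma (cinv c x)))
      (extend (sigma p) (d k) (sigma (cinv c x))).
    by rewrite /phi; have -> : cinv c' (s x) = sigma (cinv c x) := cfunK qc'.
  exact: (congr1 (fun z : R => a x 0 j * (b x 0 k * z)) ephi).
pose da u := hess s x0 u (F p) + D ('d (coord_field c F) x0 u).
have H : hasD (fun x => \sum_j \sum_k coordf j (a x) *:
     (coordf k (b x) *: phi j k (s x))) x0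
   (fun u => \sum_j \sum_k (coordf j (a x0) *: (coordf k (b x0) *: dphi j k ('d s x0 u)
       + coordf k ('d b x0 u) *: phi j k (s x0))
     + coordf j (da u) *: (coordf k (b x0) *: phi j k (s x0)))).
  apply: hasD_sum => j; apply: hasD_sum => k.
  exact: (hasD_scale (hco _ _ j ha) (hasD_scale (hco _ _ k hb)
    (hasD_comp hs (hphi j k)))).
have a0 : a x0 = D (F p) by rewrite /a coord_field_at.
have H1 := (near_eq_hasD E H).2 e.
pose Sum (t : 'rV[R]_m) z (da0 db0 de : 'rV[R]_m) : R := \sum_j \sum_k
   (t 0 j * (D y 0 k * dphi j k de + db0 0 k * phi j k z)
     + da0 0 j * (D y 0 k * phi j k z)).
have H2 : Sum (a x0) (s x0) (da e) (hess s x0 e y) (D e) =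
    Sum (D (F p)) y0 (da e) (hess s x0 e y) (D e).
  exact: (etrans (congr1 (fun t => Sum t (s x0) (da e) (hess s x0 e y) (D e)) a0)
    (congr1 (fun z => Sum (D (F p)) z (da e) (hess s x0 e y) (D e)) sx0)).
pose W := nablat (extend (sigma p) (D e)) Vt (sigma p) (D v).
pose G := christoffel nablat (sigma p) (D v) (D e).
suff H3 db da0 : Sum (D (F p)) y0 da0 db (D e) =
    gt (da0 + G (D (F p))) (D y) + gt (D (F p)) (db + G (D y))
    + 2 * Ct (D (F p)) (D y) W.
  apply: etrans H1 (etrans H2 (etrans (H3 _ _) _)).
  exact: (congr1 (fun z => gt (z + G (D (F p))) (D y) +
    gt (D (F p)) (hess s x0 e y + G (D y)) + 2 * Ct (D (F p)) (D y) W)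
    (esym (ha.2 e))).
have gtlin1 z := fund_linearl pft Atv z.
have gtlin2 z := fund_linearr pft Atv z.
have chl : linear G := christoffel_linearr nablat (sigma p) (D v) (D e).
have e1 := bilinear_expand (b := fun a b => gt (G a) b) (D (F p)) (D y)
  (fun z => comp_linear (gtlin1 z) chl) (fun z => gtlin2 (G z)).
have e2 := bilinear_expand (b := fun a b => gt a (G b)) (D (F p)) (D y)
  (fun z => gtlin1 (G z)) (fun z => comp_linear (gtlin2 z) chl).
have e3 := bilinear_expand (b := fun a b => Ct a b W) (D (F p)) (D y)
  (fun z => cartan_linear1 pft Atv z W) (fun z => cartan_linear2 pft Atv z W).
have e4 := bilinear_expand (b := gt) da0 (D y) gtlin1 gtlin2.
have e5 := bilinear_expand (b := gt) (D (F p)) db gtlin1 gtlin2.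
have p0 j k : phi j k y0 = gt (d j) (d k).
  have e0 : cinv c' y0 = sigma p := cfunK pc'.
  rewrite /phi e0 VVtp.
  exact: (f_equal2 (fund Lt (sigma p) (D v))
    (extend_at (sigma p) (d j)) (extend_at (sigma p) (d k))).
rewrite (linear_addE (gtlin1 (D y))) (linear_addE (gtlin2 (D (F p)))).
rewrite -e1 -e2 -e3 -e4 -e5 /Sum.
rewrite mulr_sumr -!big_split; apply: eq_bigr => j _.
rewrite mulr_sumr -!big_split; apply: eq_bigr => k _.
rewrite p0; exact: product_rule_ring.
Qed.

Hypothesis Uc : U `<=` cdom c.
Hypothesis Uc' : forall q, U q -> cdom c' (sigma q).

Let sX k : smooth_vfield U (extend p k) :=
  smooth_vfield_subset Uc (smooth_extend p k).

Lemma dmap_nablaV e : D (N V e) =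
  nablat (extend (sigma p) (D e)) Vt (sigma p) (D v) + S e v.
Proof.
have [Ub [oUb Ubp Ubc UbU]] := base_nbhd oU Up.
have sEt := smooth_vfield_subset Ubc (smooth_extend (sigma p) (D e)).
have sVt1 : smooth_vfield Ub Vt := smooth_vfield_subset UbU sVt.
have De : D (extend p e p) = extend (sigma p) (D e) (sigma p).
  by rewrite !extend_at.
have := dmap_nabla oU Up oUb Ubp Av Atv (sX e) sV sEt sVt1 De VVt.
by rewrite (extend_at p e).
Qed.

Lemma isometry_derivative_arith (a b k A' B' C' d : R) : a + b + 2 * k = A' + B' + 2 * C' ->
  B' = b - d -> a + d + 2 * k = A' + 2 * C'.
Proof. by move=> h e; lra. Qed.

(** The invariant form of the chart identity: the Hessian and Christoffel terms combine into [S],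
    and the derivative of [Vt] is rewritten by [dmap_nablaV]. *)
Lemma isometry_derivative (F : vfield M) e y : smooth_vfield U F ->
  (forall q, U q -> ghorizontal L sigma q (V q) (F q)) ->
  g (N F e) y + gt (D (F p)) (S e y) + 2 * C (F p) y (N V e)
  = gt (D (N F e) - S e (F p)) (D y)
  + 2 * Ct (D (F p)) (D y) (D (N V e) - S e v).
Proof.
move=> sF hF.
have e1 := dmap_nabla_image oU Up Av (sX e) sF.
rewrite (extend_at p e) in e1.
have e2 := dmap_nablaV e.
rewrite e1 addrK e2 addrK.
apply: (isometry_derivative_arith (isometry_derivative_chart e y sF hF)).
rewrite (fund_iso hsub hnondeg _ (hV Up) (hF _ Up)).
rewrite -(linear_subE (fund_linearr pft Atv (D (F p)))).
by congr (fund _ _ _ _ _); rewrite /defect; apply/rowP => i; rewrite !mxE; ring.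
Qed.

(** The vector [x] is extended by its horizontal projections along [V]. As [y] is horizontal too,
    [g (N F e) y] equals the pairing of the projections, so the unknown derivative of [F]
    cancels. *)
Lemma horizontal_identity e x y : ghorizontal L sigma p v x ->
  ghorizontal L sigma p v y ->
  gt (D x) (S e y) + gt (S e x) (D y) + 2 * C x y (N V e)
  - 2 * Ct (D x) (D y) (D (N V e) - S e v) = 0.
Proof.
move=> hx hy.
pose F q := hpart L sigma q (V q) (extend p x q).
have AV q : U q -> A q (V q) by move=> /hV[].
have sF : smooth_vfield U F.
  exact: (smooth_hpart hsub hnondeg hc hc' x oU Uc Uc' sV AV).
have hF q : U q -> ghorizontal L sigma q (V q) (F q).
  by move=> Uq; apply: (ghor_hpart hsub hnondeg); exact: AV.
have Fp : F p = x.
  by rewrite /F (extend_at p x) (hpart_hor hsub hnondeg Av hx).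
have := isometry_derivative e y sF hF; rewrite Fp.
rewrite (fundC pf Av) (fund_iso hsub hnondeg _ (hV Up) hy) (fundC pft Atv).
rewrite (linear_subE (fund_linearl pft Atv (D y))).
set a := gt (D (N F e)) (D y); set b := gt (D x) _; set k := C _ _ _.
set d := gt (S e x) _; set l := Ct _ _ _.
by clearbody a b k d l; lra.
Qed.

(** The case [F := V]: the Cartan terms vanish on [v], and so do all pairings with [D w = 0]. *)
Lemma vertical_identity e w : D w = 0 -> g (N V e) w = - gt (D v) (S e w).
Proof.
move=> w0.
have := isometry_derivative e w sV (fun q Uq => (hV Uq).2).
rewrite (cartan_v0 pf Av) (cartan_v0 pft Atv) w0.
rewrite (linear_zeroE (fund_linearr pft Atv _)).
set a := g _ _; set b := gt _ _.
by clearbody a b; lra.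
Qed.

(** * The projections at [v] and the tensor [A_v] *)

Local Notation H := (hpart L sigma p (V p)).
Local Notation P := (vpart L sigma p (V p)).

Let gl1 z := fund_linearl pf Av z.
Let gl2 z := fund_linearr pf Av z.

Lemma fund_hor x e : ghorizontal L sigma p v x -> g x (H e) = g x e.
Proof.
move=> hx; have := hx _ (vertical_vpart hsub hnondeg e Av).
rewrite vpartE (linear_subE (gl2 x)) => h.
exact: esym (subr0_eq h).
Qed.

Lemma fund_vert w e : vertical sigma p w -> g w (P e) = g w e.
Proof.
move=> w0; rewrite vpartE (linear_subE (gl2 w)).
have -> : g w (H e) = 0.
  by rewrite (fundC pf Av); apply: (ghor_hpart hsub hnondeg e Av).
by rewrite subr0.
Qed.

Lemma ghor_eq0 x : ghorizontal L sigma p v x ->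
  (forall z, ghorizontal L sigma p v z -> g x z = 0) -> x = 0.
Proof.
move=> hx h; apply: (pf_nondeg pf Av) => e.
by rewrite -(fund_hor e hx); apply: h; exact: (ghor_hpart hsub hnondeg).
Qed.

Lemma vpart_vert w : D w = 0 -> P w = w.
Proof.
move=> w0; rewrite vpartE (@hpart_uniq _ _ _ _ _ _ _ _ _ _ hsub hnondeg _ _ _ 0 Av).
- by rewrite subr0.
- by rewrite subr0.
- by move=> u _; rewrite (linear_zeroE (gl1 u)).
Qed.

Lemma vpart_hor x : ghorizontal L sigma p v x -> P x = 0.
Proof. by move=> hx; rewrite vpartE (hpart_hor hsub hnondeg Av hx) subrr. Qed.

Local Notation N1 e :=
  (nabla_aniso nabla p v v (fun q w => hpart L sigma q w (extend p e q))).
Local Notation N2 e :=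
  (nabla_aniso nabla p v v (fun q w => vpart L sigma q w (extend p e q))).
(** The fiber direction in which [nabla_aniso] corrects for the choice of extension of [v]. *)
Local Notation eta := (nabla_at nabla p v v (extend p v)).

Lemma near_curve : \forall t \near (0 : R^o), A p (v + t *: eta).
Proof.
have h := hasD_continuous (hasD_line v eta 0).
apply: h; rewrite scale0r addr0; apply: open_nbhs_nbhs; split => //.
exact: (@fiber_open _ _ _ _ _ pf p).
Qed.

Lemma hasD_hpart_curve e : exists dH,
  hasD (fun t : R^o => hpart L sigma p (v + t *: eta) e) 0 dH.
Proof.
have sP : smooth_on (A p) (fun w => e *m hmx (L p) (dmx sigma p) w).
  apply: smooth_mx_rV; first exact: (@fiber_open _ _ _ _ _ pf p).
  apply: smooth_mulmx; first exact: (@fiber_open _ _ _ _ _ pf p).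
    by apply: smooth_mx_cst; exact: (@fiber_open _ _ _ _ _ pf p).
  apply: (hmx_smooth (@fiber_open _ _ _ _ _ pf p) (fiber_smooth pf p)).
  - exact: fiber_nondeg hsub p.
  - exact: fiber_vnondeg hsub hnondeg p.
  - exact: fiber_surj hsub p.
have A0 : A p (v + (0 : R^o) *: eta) by rewrite scale0r addr0.
have h := hasD_comp (hasD_line v eta 0) (smooth_hasD sP A0).
exists ('d (fun w => e *m hmx (L p) (dmx sigma p) w) (v + (0 : R^o) *: eta)
   \o (fun t : R^o => t *: eta)).
apply: near_eq_hasD h; apply: filterS near_curve => t At'.
by rewrite /= (hpartE hsub hnondeg).
Qed.

Lemma smooth_vpart_field (U' : set M) e : open U' -> U' `<=` cdom c ->
  smooth_vfield U' (fun q => hpart L sigma q (extend p v q) (extend p e q)) ->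
  smooth_vfield U' (fun q => vpart L sigma q (extend p v q) (extend p e q)).
Proof.
move=> oU' U'c sH.
have -> : (fun q => vpart L sigma q (extend p v q) (extend p e q)) = fun q =>
   extend p e q + (fun q => (fun=> -1) q *: hpart L sigma q (extend p v q) (extend p e q)) q.
  by apply/funext => q; rewrite vpartE scaleN1r.
apply: smooth_vfieldD => //; first exact: smooth_vfield_subset U'c (smooth_extend p e).
apply: smooth_vfieldZ => // k hk; apply: smooth_cst; exact: chart_open.
Qed.

Lemma skew_arith (a1 a2 k a3 a4 : R) : 0 = a1 + a2 + 2 * k ->
  2 * k + a3 + a4 = 0 -> (a1 - a3) + (a2 - a4) = 0.
Proof. by lra. Qed.

(* The covariant derivative at [v] of [0 = g_w (e^bot_w) (u^top_w)]. *)
Lemma projections_skew e u : g (N1 e) (P u) + g (H e) (N2 u) = 0.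
Proof.
have [U4 [oU4 U4p U4c U4A sH]] := hpart_extend_smooth hsub hnondeg Av.
pose X q := hpart L sigma q (extend p v q) (extend p e q).
pose Y q := vpart L sigma q (extend p v q) (extend p u q).
have sY : smooth_vfield U4 Y := smooth_vpart_field oU4 U4c (sH u).
have sv := smooth_vfield_subset U4c (smooth_extend p v).
have m1 := lcc_metric hnabla oU4 U4p sv U4A sv (sH e) sY.
have XY0 q : U4 q -> fund L q (extend p v q) (X q) (Y q) = 0.
  move=> Uq; apply: (ghor_hpart hsub hnondeg _ (U4A _ Uq)).
  exact: (vertical_vpart hsub hnondeg _ (U4A _ Uq)).
have d0 k : dfun (fun q => fund L q (extend p v q) (X q) (Y q)) p k = 0.
  have E : \forall x \near x0, (fun=> 0 : R^o) x =
      ((fun q => fund L q (extend p v q) (X q) (Y q)) \o cinv c) x.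
    have := near_chart pc (open_near oU4 U4p XY0).
    by apply: filterS => x hx; exact: (esym hx).
  exact: ((near_eq_hasD E (hasD_cst _ _)).2 k).
have Yp : Y p = P u by rewrite /Y (extend_at p v) (extend_at p u).
have {}m1 := etrans (esym (d0 _)) m1.
rewrite Yp (extend_at p v) (extend_at p e) in m1.
have [dX hX] := hasD_hpart_curve e.
have [dX' hX'] := hasD_hpart_curve u.
have hY : hasD (fun t : R^o => vpart L sigma p (v + t *: eta) u) 0 (fun t => 0 - dX' t).
  have -> : (fun t : R^o => vpart L sigma p (v + t *: eta) u) =
     fun t => u - hpart L sigma p (v + t *: eta) u.
    by apply/funext => t; rewrite vpartE.
  exact: (hasDB (hasD_cst u 0) hX').
have A0 : A p (v + (0 : R^o) *: eta) by rewrite scale0r addr0.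
(* The same vanishing product, differentiated inside the fiber in the direction [eta]. Subtracting
   it from [m1] cancels the Cartan term and turns the derivatives along the extension into
   anisotropic ones. *)
have m2 := hasD_gram (c := fun t : R^o => v + t *: eta)
  (@fiber_open _ _ _ _ _ pf p) (fiber_smooth pf p) A0
  (hasD_line v eta 0) hX hY.
have E0 : \forall t \near (0 : R^o), (fun=> 0 : R^o) t =
    gram (L p) (v + t *: eta) (hpart L sigma p (v + t *: eta) e)
      (vpart L sigma p (v + t *: eta) u).
  apply: filterS near_curve => t At'; rewrite -(fundE pf _ _ At'); apply: esym.
  apply: (ghor_hpart hsub hnondeg _ At').
  exact: (vertical_vpart hsub hnondeg _ At').
have {}m2 := hasD_unique m2 (near_eq_hasD E0 (hasD_cst _ _)) 1.
rewrite !scale1r !scale0r !addr0 in m2.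
rewrite -!(fundE pf _ _ Av) in m2.
have ce : dgram (L p) v eta (H e) (P u) = 2 * C eta (H e) (P u).
  by rewrite (cartanE pf _ _ _ Av) mulrA mulfV ?mul1r // pnatr_eq0.
rewrite ce in m2.
have Ceq : C (H e) (P u) eta = C eta (H e) (P u).
  by rewrite (cartanC23 pf Av) (cartanC12 pf Av).
have e1 : N1 e = nabla (extend p v) X p v - dX 1.
  rewrite /nabla_aniso (extend_at p e); congr (_ - _); exact: derive1_hasD hX.
have e2 : N2 u = nabla (extend p v) Y p v - (0 - dX' 1).
  rewrite /nabla_aniso (extend_at p u); congr (_ - _); exact: derive1_hasD hY.
rewrite e1 e2 (linear_subE (gl1 (P u))) (linear_subE (gl2 (H e))).
rewrite Ceq in m1.
exact: skew_arith m1 m2.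
Qed.

(* [u^top_w] projects to the zero field. *)
Lemma dmap_N2 u : D u = 0 -> D (N2 u) = S v u.
Proof.
move=> u0.
have [U4 [oU4 U4p U4c U4A sH]] := hpart_extend_smooth hsub hnondeg Av.
pose Y q := vpart L sigma q (extend p v q) (extend p u q).
have sY : smooth_vfield U4 Y := smooth_vpart_field oU4 U4c (sH u).
have sv := smooth_vfield_subset U4c (smooth_extend p v).
have Yp : Y p = u by rewrite /Y (extend_at p v) (extend_at p u) vpart_vert.
have [Ub [oUb Ubp Ubc UbU]] := base_nbhd oU4 U4p.
have sEt := smooth_vfield_subset Ubc (smooth_extend (sigma p) (D v)).
have De : D (extend p v p) = extend (sigma p) (D v) (sigma p).
  by rewrite !extend_at.
have Y0 q : U4 q -> dmap sigma q (Y q) = 0.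
  by move=> Uq; exact: (vertical_vpart hsub hnondeg _ (U4A _ Uq)).
have := dmap_nabla oU4 U4p oUb Ubp Av Atv sv sY sEt (smooth_vfield0 oUb) De Y0.
rewrite (nabla0r hcont oUb Ubp Atv sEt) add0r (extend_at p v) Yp => DN.
have [dX' hX'] := hasD_hpart_curve u.
have hY : hasD (fun t : R^o => vpart L sigma p (v + t *: eta) u) 0 (fun t => 0 - dX' t).
  have -> : (fun t : R^o => vpart L sigma p (v + t *: eta) u) =
     fun t => u - hpart L sigma p (v + t *: eta) u.
    by apply/funext => t; rewrite vpartE.
  exact: (hasDB (hasD_cst u 0) hX').
have E0 : \forall t \near (0 : R^o), (fun=> 0) t =
    vpart L sigma p (v + t *: eta) u *m dmx sigma p.
  apply: filterS near_curve => t At'; rewrite -dmapE; apply: esym.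
  exact: (vertical_vpart hsub hnondeg _ At').
(* The curve of vertical parts stays in one vertical space, so the fiberwise correction is
   vertical. *)
have d0 : D (0 - dX' 1) = 0.
  rewrite dmapE.
  exact: (hasD_unique (hasD_mulmxr (dmx sigma p) hY)
    (near_eq_hasD E0 (hasD_cst _ _)) 1).
have e2 : N2 u = nabla (extend p v) Y p v - (0 - dX' 1).
  rewrite /nabla_aniso (extend_at p u); congr (_ - _); exact: derive1_hasD hY.
by rewrite e2 (linear_subE (dmap_linear sigma p)) DN d0 subr0.
Qed.

Local Notation a e := (Atensor L sigma nabla p (V p) (V p) e).

Lemma AtensorE e : a e = P (N1 e) + H (N2 e).
Proof. by rewrite /Atensor (hpart_hor hsub hnondeg Av (hV Up).2). Qed.

Lemma fund_N2 z e : ghorizontal L sigma p v z ->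
  g z (N2 e) = - g (N1 z) (P e).
Proof.
move=> hz; have := projections_skew z e.
rewrite (hpart_hor hsub hnondeg Av hz).
set b1 := g _ _; set b2 := g _ _.
by clearbody b1 b2; lra.
Qed.

(** The vertical part of [z] at [v] is zero, so [projections_skew] makes [N2 z] orthogonal to all
    horizontal vectors and its horizontal part vanishes. *)
Lemma Atensor_hor z : ghorizontal L sigma p v z -> a z = P (N1 z).
Proof.
move=> hz; rewrite AtensorE.
have -> : H (N2 z) = 0.
  apply: ghor_eq0; first exact: (ghor_hpart hsub hnondeg _ Av).
  move=> t ht; rewrite (fundC pf Av) (fund_hor _ ht) (fund_N2 _ ht).
  by rewrite (vpart_hor hz) (linear_zeroE (gl2 _)) oppr0.
by rewrite addr0.
Qed.

Lemma dmap_Atensor z : ghorizontal L sigma p v z -> D (a z) = 0.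
Proof.
move=> hz; rewrite (Atensor_hor hz).
exact: (vertical_vpart hsub hnondeg _ Av).
Qed.

(** The link between [A_v] and [S]: skewness moves the derivative from [z] onto the vertical
    projections of [w], whose derivative projects to [S v w]. *)
Lemma fund_Atensor_vert z w : ghorizontal L sigma p v z -> D w = 0 ->
  g (a z) w = - gt (D z) (S v w).
Proof.
move=> hz w0; rewrite (Atensor_hor hz).
rewrite (fundC pf Av) (fund_vert _ w0) (fundC pf Av).
rewrite -(dmap_N2 w0) -(fund_iso hsub hnondeg _ (hV Up) hz) (fund_N2 _ hz).
by rewrite opprK (vpart_vert w0).
Qed.

(** Only the component [H (N2 e)] meets the horizontal [z], and [projections_skew] converts it. The
    vector [e] is arbitrary because it will be a value of [csharp], which may have a vertical
    part. *)
Lemma Atensor_skew e z : ghorizontal L sigma p v z ->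
  g (a e) z = - g e (a z).
Proof.
move=> hz; rewrite (Atensor_hor hz) AtensorE (linear_addE (gl1 z)).
have vP u : vertical sigma p (P u) := vertical_vpart hsub hnondeg u Av.
have -> : g (P (N1 e)) z = 0 by rewrite (fundC pf Av); exact: hz.
rewrite add0r (fundC pf Av) (fund_hor _ hz) (fund_N2 _ hz).
apply: (congr1 (fun k : R => - k)).
have e1 : g (P e) (P (N1 z)) = g (P e) (N1 z) := fund_vert (N1 z) (vP e).
have e2 : g (P (N1 z)) (P e) = g (P (N1 z)) e := fund_vert e (vP (N1 z)).
have e3 : g (N1 z) (P e) = g (P e) (N1 z) := fundC pf Av _ _.
have e4 : g (P e) (P (N1 z)) = g (P (N1 z)) (P e) := fundC pf Av _ _.
have e5 : g (P (N1 z)) e = g e (P (N1 z)) := fundC pf Av _ _.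
rewrite e3 -e1 e4 e2; exact: e5.
Qed.

(** The summands match those of [gS_tensor] one by one: [Atensor_skew] gives the first, total
    symmetry of the Cartan tensor the other two. *)
Lemma fund_defect x y z : ghorizontal L sigma p v x ->
  ghorizontal L sigma p v y -> ghorizontal L sigma p v z ->
  gt (S x y) (D z) = g (a (csharp L p v x y) + csharp L p v (a x) y
    + csharp L p v x (a y)) z.
Proof.
move=> hx hy hz.
have vnd w : D w = 0 -> (forall u, D u = 0 -> g w u = 0) -> w = 0.
  exact: hnondeg Av w.
have csharpP_C e h b : g (csharp L p v e h) b = C e h b.
  rewrite (fundC pf Av) (csharpP pf Av).
  by rewrite (cartanC12 pf Av) (cartanC23 pf Av).
have := gS_tensor (g := g) (gt := gt) (C := C) (Ct := Ct) (D := D) (S := S)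
  (hp := H) (v := v) (DV := fun e => N V e) gl1 (fundC pft Atv)
  (@pf_nondeg _ _ _ _ _ pft _ _ Atv) (cartan_linear3 pf Av)
  (cartan_linear3 pft Atv) (cartan_v0 pf Av) (cartan_v0 pft Atv)
  (dmap_linear sigma p) (fs_dsurj hsub p)
  (fun e => dmap_hpart hsub hnondeg e Av)
  (fun e => ghor_hpart hsub hnondeg e Av) vnd
  (fun x y z => @cartan_iso _ _ _ _ _ _ _ _ _ _ hsub hnondeg p v x y z (hV Up))
  (fun x y => defectC x y Av Atv) (hV Up).2
  horizontal_identity vertical_identity hx hy hz dmap_Atensor
  fund_Atensor_vert.
have lin3 a1 a2 a3 : g (a1 + a2 + a3) z = g a1 z + g a2 z + g a3 z.
  by rewrite (linear_addE (gl1 z)) (linear_addE (gl1 z)).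
have e1 : g (a (csharp L p v x y)) z = - C x y (a z).
  rewrite (Atensor_skew _ hz); apply: (congr1 (fun k : R => - k)).
  exact: csharpP_C.
have e2 k : g (csharp L p v k y) z = C y z k.
  by rewrite csharpP_C (cartanC12 pf Av) (cartanC23 pf Av).
have e3 k : g (csharp L p v x k) z = C x z k.
  by rewrite csharpP_C (cartanC23 pf Av).
move=> h; apply: etrans h _; apply: esym; apply: etrans (lin3 _ _ _) _.
exact: (f_equal2 +%R (f_equal2 +%R e1 (e2 _)) (e3 _)).
Qed.

Lemma ghorD x y : ghorizontal L sigma p v x -> ghorizontal L sigma p v y ->
  ghorizontal L sigma p v (x + y).
Proof.
by move=> hx hy w w0; rewrite (linear_addE (gl1 w)) (hx _ w0) (hy _ w0) addr0.
Qed.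

Lemma ghorB x y : ghorizontal L sigma p v x -> ghorizontal L sigma p v y ->
  ghorizontal L sigma p v (x - y).
Proof.
by move=> hx hy w w0; rewrite (linear_subE (gl1 w)) (hx _ w0) (hy _ w0) subrr.
Qed.

(** Both sides are horizontal, so it suffices to pair them with horizontal [z], where the projection
    and the lift are computed on the base and the difference is the defect. *)
Lemma nabla_projection (X Y : vfield M) (Xt Yt : vfield B) :
  smooth_vfield U X -> smooth_vfield U Y ->
  smooth_vfield (sigma @` U) Xt -> smooth_vfield (sigma @` U) Yt ->
  D (X p) = Xt (sigma p) ->
  (forall q, U q -> dmap sigma q (Y q) = Yt (sigma q)) ->
  ghorizontal L sigma p v (X p) -> ghorizontal L sigma p v (Y p) ->
  H (nabla X Y p v) = hlift L sigma p v (nablat Xt Yt (sigma p) (Vt (sigma p)))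
    + Qtilde L sigma nabla p v (X p) (Y p).
Proof.
move=> sX' sY sXt sYt DX DY hx hy.
have [Ub [oUb Ubp Ubc UbU]] := base_nbhd oU Up.
have DN := dmap_nabla oU Up oUb Ubp Av Atv sX' sY
  (smooth_vfield_subset UbU sXt) (smooth_vfield_subset UbU sYt) DX DY.
rewrite -VVt // /Qtilde (hpart_hor hsub hnondeg Av hx) (hpart_hor hsub hnondeg Av hy).
set W := nablat _ _ _ _ in DN *; set Q := _ + csharp L p v (X p) _.
have [lh Dl] := hlift_hor hsub hnondeg W Av.
have hH u : ghorizontal L sigma p v (H u) := ghor_hpart hsub hnondeg u Av.
apply/subr0_eq; apply: ghor_eq0; first exact: ghorB (hH _) (ghorD lh (hH _)).
move=> z hz.
have e0 k l t : g (k - (l + t)) z = g k z - (g l z + g t z).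
  by rewrite (linear_subE (gl1 z)) (linear_addE (gl1 z)).
have e1 k : g (H k) z = gt (D k) (D z).
  rewrite (fund_iso hsub hnondeg z (hV Up) (hH k)).
  by rewrite (dmap_hpart hsub hnondeg k Av).
have e2 : g (hlift L sigma p v W) z = gt W (D z).
  by rewrite (fund_iso hsub hnondeg z (hV Up) lh) Dl.
have e3 k : g (H k) z = g k z.
  apply: etrans (fundC pf Av _ _) _; apply: etrans (fund_hor k hz) _.
  exact: (fundC pf Av).
have e5 : gt (S (X p) (Y p)) (D z) = g Q z := fund_defect hx hy hz.
clearbody Q.
apply: etrans (e0 _ _ _) _.
have e4 k : D k = W + S (X p) (Y p) ->
    g (H k) z - (gt W (D z) + gt (S (X p) (Y p)) (D z)) = 0.
  by move=> h; rewrite e1 h (linear_addE (fund_linearl pft Atv (D z))) subrr.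
apply: etrans _ (e4 _ DN).
apply: (congr1 (fun k : R => _ - k)).
apply: (f_equal2 +%R e2).
apply: etrans (e3 Q) _; exact: esym e5.
Qed.
End HorizontalField.
End AtPoint.

Theorem proposition4 (R : realType) (n m : nat)
    (M : manifold R n) (B : manifold R m)
    (A : M -> set 'rV[R]_n) (L : M -> 'rV[R]_n -> R)
    (At : B -> set 'rV[R]_m) (Lt : B -> 'rV[R]_m -> R)
    (sigma : M -> B)
    (hsub : finsler_submersion A L At Lt sigma)
    (hnondeg : vertical_nondeg A L sigma)
    (nabla : connection M) (nablat : connection B)
    (hnabla : levi_civita_chern A L nabla)
    (hnablat : levi_civita_chern At Lt nablat)
    (p : M) (U : set M) (hU : open U) (hp : U p)
    (V X Y : vfield M) (Vt Xt Yt : vfield B)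
    (hV : smooth_vfield U V) (hX : smooth_vfield U X) (hY : smooth_vfield U Y)
    (hVproj : projects sigma U V Vt)
    (hXproj : projects sigma U X Xt)
    (hYproj : projects sigma U Y Yt)
    (hVhor : forall q, U q -> horizontal A L sigma q (V q))
    (hXhor : forall q, U q -> ghorizontal L sigma q (V q) (X q))
    (hYhor : forall q, U q -> ghorizontal L sigma q (V q) (Y q)) :
  hpart L sigma p (V p) (nabla X Y p (V p))
  = hlift L sigma p (V p) (nablat Xt Yt (sigma p) (Vt (sigma p)))
    + Qtilde L sigma nabla p (V p) (X p) (Y p).
Proof.
(* Shrinking to the chart domains makes the coordinate extensions at [p] smooth on the whole
   neighbourhood, as the local results require. *)
pose U1 := U `&` cdom (chart_at p) `&` sigma @^-1` cdom (chart_at (sigma p)).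
have oU1 : open U1.
  apply: openI; first by apply: openI => //; exact: cdom_open.
  apply: open_comp; last exact: cdom_open.
  by move=> q _; exact: (fs_smooth hsub).1.
have U1p : U1 p by do 2?split => //; exact: chart_at_dom.
have U1U : U1 `<=` U by move=> q [[]].
have U1c : U1 `<=` cdom (chart_at p) by move=> q [[]].
have U1c' q : U1 q -> cdom (chart_at (sigma p)) (sigma q) by case.
have sU1 : sigma @` U1 `<=` sigma @` U by exact: image_subset.
apply: (nabla_projection hsub hnondeg hnabla hnablat oU1 U1p
  (smooth_vfield_subset U1U hV) (smooth_vfield_subset sU1 hVproj.1)
  (fun q Uq => hVproj.2 q (U1U q Uq)) (fun q Uq => hVhor q (U1U q Uq)) U1c U1c'
  (smooth_vfield_subset U1U hX) (smooth_vfield_subset U1U hY)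
  (smooth_vfield_subset sU1 hXproj.1) (smooth_vfield_subset sU1 hYproj.1)
  (hXproj.2 p hp) (fun q Uq => hYproj.2 q (U1U q Uq)) (hXhor p hp) (hYhor p hp)).
Qed.
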